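(* Let $K$ be a field of characteristic $0$, $R=K[x_1,\dots,x_n]$, let $I\subseteq R$ be a homogeneous ideal and let $\tau$ be any term order on $R$ with $x_1>_\tau x_2>_\tau\dots>_\tau x_n$. Then: (a) $\beta_{ijp}(R/I)\le \beta_{ijp}(R/\mathrm{Gin}_\tau(I))$ for all $i,j,p$; (b) $\beta_{ijp}(R/I)\le \beta_{ijp}(R/\mathrm{Lex}(I))$ for all $i,j,p$.
   Context: $R$ has the standard grading, and a subscript $j$ on the right of a graded module denotes its degree $j$ component. Koszul-Betti numbers: for $p=1,\dots,n$ let $H_i(p,R/I)$ be the $i$-th homology of the graded Koszul complex with values in $R/I$ with respect to a sequence of $p$ generic linear forms $y_1,\dots,y_p$ of $R$, and set $\beta_{ijp}(R/I)=\dim_K H_i(p,R/I)_j$. (''Generic'' means: $(y_1,\dots,y_p)$ belongs to a nonempty Zariski open subset of $(R_1)^p$ on which these dimensions are constant.) For $p=0$ one sets $H_0(0,R/I)=R/I$, and $H_i(p,R/I)=0$ whenever $i>p$. Thus $i\ge 0$, $j\in\mathbb Z$, $0\le p\le n$. Generic initial ideal: $g=(g_{ij})\in \mathrm{GL}_n(K)$ acts on $R$ as the graded $K$-algebra isomorphism $g(x_i)=\sum_{j=1}^n g_{ji}x_j$. $\mathrm{Gin}_\tau(I)$ is the initial ideal $\mathrm{in}_\tau(g(I))$ for a generic $g\in\mathrm{GL}_n(K)$ (i.e. the common value for $g$ in a suitable nonempty Zariski open subset). Lex-segment ideal: for a vector space $V$ of forms of degree $d$, $\mathrm{Lex}(V)$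 is the vector space generated by the $\dim_K V$ largest monomials of degree $d$ in the lexicographic order (with $x_1>\dots>x_n$). For a homogeneous ideal $I$, $\mathrm{Lex}(I)=\bigoplus_d \mathrm{Lex}(I_d)$, which is an ideal by Macaulay's theorem. *)

(* Defs.v *)
From HB Require Import structures.
From mathcomp Require Import all_boot all_order all_algebra.
From mathcomp Require Import mathcomp_extra boolp classical_sets.
From mathcomp Require Import mpoly.

Set Implicit Arguments.
Unset Strict Implicit.
Unset Printing Implicit Defensive.

Import Order.TTheory GRing.Theory.
Local Open Scope ring_scope.
Local Open Scope classical_set_scope.

(* Throughout, R is {mpoly K[n]}, with the variables x_1, ..., x_n indexed     *)
(* from 0 by 'I_n. Vector subspaces and ideals are sets, and "the" unique      *)
(* object with a property is selected by xget (whose default is irrelevant).   *)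

Section Quotients.
Context (K : fieldType) (V : lmodType K).

(* Dimension of Z / B for subspaces B `<=` Z of V: e lists vectors of Z whose  *)
(* classes form a basis of Z / B.                                              *)
Definition has_quot_dim (Z B : set V) (d : nat) : Prop :=
  exists e : 'I_d -> V,
    [/\ forall k, Z (e k),
        forall c : 'I_d -> K, B (\sum_k c k *: e k) -> forall k, c k = 0
      & forall z, Z z -> exists c : 'I_d -> K, B (z - \sum_k c k *: e k)].

Definition quot_dim (Z B : set V) : nat := xget 0%N (has_quot_dim Z B).

Definition subspace_dim (Z : set V) : nat := quot_dim Z [set 0].

End Quotients.

Section Generic.
Context (K : fieldType) (m n : nat).

Definition zariski_open (U : set 'M[K]_(m, n)) : Prop :=
  exists S : set {mpoly K[m * n]},
    U = [set A | exists2 f, S f & f.@[mxvec A 0] != 0].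

Definition generically (P : 'M[K]_(m, n) -> Prop) : Prop :=
  exists U : set 'M[K]_(m, n), [/\ zariski_open U, U !=set0 & U `<=` P].

End Generic.

Section Ideals.
Context (K : fieldType) (n : nat).
Local Notation R := {mpoly K[n]}.

Definition ideal (I : set R) : Prop :=
  [/\ I 0, forall f g, I f -> I g -> I (f + g) & forall f g, I g -> I (f * g)].

Definition homogeneous_ideal (I : set R) : Prop :=
  ideal I /\ forall f d, I f -> I (pihomog mdeg d f).

Definition ideal_generated (G : set R) : set R :=
  [set f | forall J, ideal J -> G `<=` J -> J f].

(* R_d for d an integer: it is 0 when d < 0.                                   *)
Definition graded_piece (d : int) : set R :=
  [set f | match d with Posz k => f \is k.-homog | Negz _ => f = 0 end].

End Ideals.

Section Koszul.
Context (K : fieldType) (n p : nat).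
Local Notation R := {mpoly K[n]}.
Implicit Types (A : 'M[K]_(p, n)) (I : set R) (i : nat) (j : int).

(* The exterior algebra of R^p: u S is the coordinate of u on e_S, the wedge   *)
(* product of the basis vectors e_s, s \in S, in increasing order of s.        *)
Local Notation ext := {ffun {set 'I_p} -> R}.

(* A point A of (R_1)^p, i.e. the sequence y_1, ..., y_p of linear forms.      *)
Definition lin_form A (s : 'I_p) : R := \sum_l A s l *: 'X_l.

(* Koszul differential: e_S is sent to the sum over s in S of                  *)
(* (-1)^(number of t in S with t < s) y_s e_(S \ s).                           *)
Definition koszul_diff A (u : ext) : ext :=
  [ffun T : {set 'I_p} =>
     \sum_(s | s \notin T)
       (-1) ^+ #|[pred t in T | (t < s)%N]| * lin_form A s * u (s |: T)%SET].

(* Degree j part of K_i = (wedge^i R^p)(-i); each e_s has degree 1.            *)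
Definition koszul_chain i j : set ext :=
  [set u | forall S : {set 'I_p},
     if #|S| == i then graded_piece (j - i%:Z) (u S) else u S = 0].

Definition coords_in I : set ext := [set u | forall S, I (u S)].

(* Cycles and boundaries of the Koszul complex with values in R/I, in          *)
(* homological degree i and internal degree j, pulled back from R/I to R: both *)
(* contain the chains with coordinates in I, so their quotient is              *)
(* H_i(y; R/I)_j.                                                              *)
Definition koszul_cycles A I i j : set ext :=
  [set u | koszul_chain i j u /\ coords_in I (koszul_diff A u)].

Definition koszul_boundaries A I i j : set ext :=
  [set u | koszul_chain i j u /\
     exists2 v, koszul_chain i.+1 j v & coords_in I (u - koszul_diff A v)].

Definition koszul_homology_dim A I i j : nat :=
  quot_dim (koszul_cycles A I i j) (koszul_boundaries A I i j).

End Koszul.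

(* beta_{ijp}(R/I): the value of dim_K H_i(p, R/I)_j at generic linear forms.  *)
Definition koszul_betti (K : fieldType) (n : nat) (I : set {mpoly K[n]})
    (i : nat) (j : int) (p : nat) : nat :=
  xget 0%N [set b | generically (fun A : 'M[K]_(p, n) =>
                      koszul_homology_dim A I i j = b)].

Section InitialIdeals.
Context (K : fieldType) (n : nat).
Local Notation R := {mpoly K[n]}.
Implicit Types (tau : rel 'X_{1..n}) (I J : set R).

(* tau m1 m2 stands for m1 <=_tau m2.                                          *)
Definition term_order tau : Prop :=
  [/\ antisymmetric tau, transitive tau, total tau,
      forall m, tau 0%MM m
    & forall m m1 m2, tau m1 m2 -> tau (m + m1)%MM (m + m2)%MM].

Definition decreasing_vars tau : Prop :=
  forall i j : 'I_n, (i < j)%N ->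
    tau U_(j)%MM U_(i)%MM && ~~ tau U_(i)%MM U_(j)%MM.

Definition initial_monomial tau (f : R) (m : 'X_{1..n}) : Prop :=
  m \in msupp f /\ forall m', m' \in msupp f -> tau m' m.

Definition initial_ideal tau J : set R :=
  ideal_generated
    [set h | exists f m, [/\ J f, initial_monomial tau f m & h = 'X_[m]]].

Definition gl_act (g : 'M[K]_n) (f : R) : R :=
  f \mPo [tuple \sum_(j < n) g j i *: 'X_j | i < n].

Definition is_gin tau I J : Prop :=
  generically (fun g : 'M[K]_n =>
    g \in unitmx /\ initial_ideal tau (gl_act g @` I) = J).

Definition Gin tau I : set R := xget set0 (is_gin tau I).

End InitialIdeals.

Section Lex.
Context (K : fieldType) (n : nat).
Local Notation R := {mpoly K[n]}.

(* The r largest monomials of degree d. The order of mpoly on 'X_{1..n}        *)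
(* compares the degrees, then the exponents lexicographically (see ltmcP; it   *)
(* is not degrevlex, despite the header of mpoly): in fixed degree it is the   *)
(* lexicographic order with x_1 > ... > x_n.                                   *)
Definition lex_largest (d r : nat) : seq 'X_{1..n} :=
  take r (sort (fun m1 m2 => (m2 <= m1)%O)
    [seq m <- map val (enum {: 'X_{1..n < d.+1}}) | mdeg m == d]).

(* Lex(V), for V a space of forms of degree d.                                 *)
Definition lex_space (d : nat) (V : set R) : set R :=
  [set f | {subset msupp f <= lex_largest d (subspace_dim V)}].

Definition degree_part (I : set R) (d : nat) : set R :=
  [set f | I f /\ f \is d.-homog].

Definition Lex (I : set R) : set R :=
  [set f | forall d, lex_space d (degree_part I d) (pihomog mdeg d f)].

End Lex.

(* Main.v *)
Require Import Defs.
From HB Require Import structures.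
From mathcomp Require Import all_boot all_order all_algebra.
From mathcomp Require Import mathcomp_extra boolp classical_sets.
From mathcomp Require Import perm zify mpoly.

Set Implicit Arguments.
Unset Strict Implicit.
Unset Printing Implicit Defensive.

Import Order.TTheory GRing.Theory.
Local Open Scope ring_scope.
Local Open Scope classical_set_scope.

(* Both parts rest on semicontinuity. With respect to bases adapted to a graded
   ideal J, dim H_i(A; R/J)_j is a constant minus the ranks of matrices that are
   polynomial in the linear forms A, so it is minimal at generic A. Letting a
   generic diagonal matrix act on J rescales the monomials of R, and comparing the
   tau-leading coefficients of minors shows that these ranks are at least those
   for in_tau(J); hence beta(R/I) <= dim H(A; R/in_tau(g I)) for all A and all
   invertible g. Part (a) follows by choosing A generic for Gin(I) = in_tau(g I).

   In characteristic 0, Gin(I) is strongly stable. For a strongly stable monomial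
   ideal and the forms x_n, ..., x_(n-p+1), a contracting homotopy of the Koszul
   complex leaves only explicit critical cells, whose number is a sum by parts of
   the numbers M_v(d) of monomials of degree d of the ideal in x_1, ..., x_v. A
   theorem of Bigatti says that, among strongly stable sets of given size, a lex
   segment minimizes every M_v; hence Lex(I) has at least as many critical cells
   as Gin(I). Gaussian elimination on the linear forms shows that the last p
   variables already are generic for a strongly stable ideal, which gives (b). *)

(** * Polynomial conditions and ranks at generic points *)

(** In [koszul_rank] the dimension of $H_i$ is a count minus two ranks. The count involves [J] only
    through the number of its initial monomials in each degree, so it is common to [J] and its
    initial ideal; the ranks can only drop in a limit. The degeneration uses the full diagonal
    torus, whose coordinate monomials are compared by [tau] itself, so no weight vector representing
    [tau] has to be found. The ideal $\mathrm{Lex}(I)$ need not be an initial ideal of $I$ in any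
    coordinates. Hence (b) goes through $\mathrm{Gin}(I)$ and exact formulas for two strongly stable
    ideals with the same Hilbert function. Characteristic 0 enters in three ways: $K$ is infinite,
    so generic conditions have common points; 2 is invertible in the proof that the differential
    squares to zero; and an exponent of $x_l$, appearing as a coefficient of a sheared monomial, is
    nonzero in $K$. A further obstacle is that each degree gives its own open set of coordinate
    changes. Dickson's lemma reduces their intersection to finitely many degrees. *)

Section Polynomials.
Variable K : fieldType.

Lemma meval_muni N (q : {mpoly K[N.+1]}) v :
  q.@[v] = (map_poly (meval (fun j => v (widen_ord (leqnSn N) j))) (muni q)).[v ord_max].
Proof.
rewrite muniE rmorph_sum /= horner_sum mevalE; apply: eq_bigr => m _.
rewrite map_polyZ /= map_polyXn hornerZ hornerXn mevalZ mevalX big_ord_recr /= mulrA.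
by congr (_ * _ * _); apply: eq_bigr => i _; rewrite mnmE.
Qed.

Lemma muni_eq0 N (q : {mpoly K[N.+1]}) : (muni q == 0) = (q == 0).
Proof.
apply/eqP/eqP => [q'|->]; last exact: muni0.
apply/mpolyP => m0; rewrite mcoeff0.
pose r (m : 'X_{1..N.+1}) : 'X_{1..N} :=
  [multinom (m (widen_ord (leqnSn N) i)) | i < N].
have := congr1 (fun P : {poly {mpoly K[N]}} => P`_(m0 ord_max)@_(r m0)) q'.
rewrite coef0 mcoeff0 => <-; rewrite muniE coef_sum raddf_sum /=.
rewrite [in LHS](mpolyE q) raddf_sum /=; apply: eq_bigr => m _.
rewrite coefZ coefXn mcoeffZ mcoeffX; case: (eqVneq m m0) => [->|ne].
  by rewrite !eqxx !mulr1 mcoeffZ mcoeffX eqxx mulr1.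
case: (eqVneq (m0 ord_max) (m ord_max)) => [e1|_]; last by rewrite !mulr0 mcoeff0.
rewrite mulr1 mcoeffZ mcoeffX; case: (eqVneq (r m) (r m0)) => [e2|_] //.
case/eqP: ne; apply/mnmP => i; case: (unliftP ord_max i) => [j ->|-> //].
have := congr1 (fun m : 'X_{1..N} => m j) e2; rewrite !mnmE.
suff -> : widen_ord (leqnSn N) j = lift ord_max j by [].
by apply: val_inj; rewrite /= /bump leqNgt ltn_ord.
Qed.

Hypothesis K0 : [pchar K] =i pred0.

Lemma poly_nonroot (P : {poly K}) : P != 0 -> exists x, P.[x] != 0.
Proof.
move=> P0; apply: contrapT => H.
have all0 x : root P x by apply/rootP/eqP/negPn/negP => h; apply: H; exists x.
pose s := [seq i%:R : K | i <- iota 0 (size P)].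
have us : uniq s.
  rewrite map_inj_uniq ?iota_uniq // => i j.
  wlog ij : i j / (i <= j)%N.
    by move=> W e; case/orP: (leq_total i j) => l; [|apply/esym]; apply: W.
  move=> /esym/eqP; rewrite -subr_eq0 -natrB // (pcharf0P K).1 // => e0.
  by apply/eqP; rewrite eqn_leq ij /= -subn_eq0.
have := max_poly_roots P0 (introT allP (fun x _ => all0 x)) us.
by rewrite size_map size_iota ltnn.
Qed.

(** Induction on the variables: at a point where the leading coefficient of [muni q] survives, a
    nonzero univariate polynomial in the last variable remains. *)
Lemma meval_neq0 N (q : {mpoly K[N]}) : q != 0 -> exists v, q.@[v] != 0.
Proof.
elim: N q => [|N IH] q q0.
  exists (fun=> 0); apply: contra_neq q0 => e.
  have m0 (m' : 'X_{1..0}) : m' = 0%MM by apply/mnmP => -[].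
  have q1 : (msize q <= 1)%N.
    by rewrite msizeE; apply/bigmax_leqP_seq => m _ _; rewrite (m0 m) mdeg0.
  by move: e; rewrite (msize1_polyC q1) mevalC => ->; rewrite mpolyC0.
have P0 : muni q != 0 by rewrite muni_eq0.
have [v hv] := IH _ (etrans (congr1 negb (lead_coef_eq0 (muni q))) P0).
have [|x hx] := @poly_nonroot (map_poly (meval v) (muni q)).
  apply: contra_neq hv => e.
  by have := congr1 (fun P : {poly K} => P`_(size (muni q)).-1) e; rewrite coef_map coef0.
exists (fun i => oapp v x (unlift ord_max i)).
rewrite meval_muni unlift_none /=; congr (_ != 0): hx.
congr _.[_]; apply: eq_map_poly => p; apply: meval_eq => j.
have -> : widen_ord (leqnSn N) j = lift ord_max j.
  by apply: val_inj; rewrite /= /bump leqNgt ltn_ord.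
by rewrite liftK.
Qed.

End Polynomials.

Section Generic.
Variables (K : fieldType) (N : nat).
Implicit Types (f g : ('I_N -> K) -> K) (P Q : ('I_N -> K) -> Prop).

Definition polyfn f := exists q : {mpoly K[N]}, forall v, f v = q.@[v].

Lemma polyfn_cst c : polyfn (fun=> c).
Proof. by exists c%:MP => v; rewrite mevalC. Qed.

Lemma polyfn_coord i : polyfn (fun v => v i).
Proof. by exists 'X_i => v; rewrite mevalXU. Qed.

Lemma polyfnD f g : polyfn f -> polyfn g -> polyfn (fun v => f v + g v).
Proof. by move=> [p hp] [q hq]; exists (p + q) => v; rewrite hp hq mevalD. Qed.

Lemma polyfnM f g : polyfn f -> polyfn g -> polyfn (fun v => f v * g v).
Proof. by move=> [p hp] [q hq]; exists (p * q) => v; rewrite hp hq mevalM. Qed.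

Lemma polyfn_sum (T : Type) (r : seq T) (C : pred T) (F : T -> _) :
  (forall i, C i -> polyfn (F i)) -> polyfn (fun v => \sum_(i <- r | C i) F i v).
Proof.
move=> H; elim: r => [|x r IH].
  by under eq_fun do rewrite big_nil; exact: polyfn_cst.
under eq_fun do rewrite big_cons; case Cx: (C x) => //.
by apply: polyfnD => //; apply: H.
Qed.

Lemma polyfn_prod (T : Type) (r : seq T) (C : pred T) (F : T -> _) :
  (forall i, C i -> polyfn (F i)) -> polyfn (fun v => \prod_(i <- r | C i) F i v).
Proof.
move=> H; elim: r => [|x r IH].
  by under eq_fun do rewrite big_nil; exact: polyfn_cst.
under eq_fun do rewrite big_cons; case Cx: (C x) => //.
by apply: polyfnM => //; apply: H.
Qed.

Lemma polyfn_det m (M : _ -> 'M[K]_m) :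
  (forall i j, polyfn (fun v => M v i j)) -> polyfn (fun v => \det (M v)).
Proof.
move=> H; apply: polyfn_sum => s _; apply: polyfnM; first exact: polyfn_cst.
by apply: polyfn_prod => i _; exact: H.
Qed.

Lemma polyfn_mulmx a b c (A : _ -> 'M[K]_(a, b)) (B : _ -> 'M[K]_(b, c)) :
  (forall i j, polyfn (fun v => A v i j)) ->
  (forall i j, polyfn (fun v => B v i j)) ->
  forall i j, polyfn (fun v => (A v *m B v) i j).
Proof.
move=> HA HB i j; under eq_fun do rewrite mxE.
by apply: polyfn_sum => k _; apply: polyfnM.
Qed.

(** A single polynomial suffices, since a nonempty open set contains a nonempty principal one.
    Conjunction becomes a product, and the existence of a point is left to [generic_ex], where $K$
    must be infinite. *)
Definition generic P := exists2 q : {mpoly K[N]}, q != 0 & forall v, q.@[v] != 0 -> P v.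

Lemma generic_and P Q : generic P -> generic Q -> generic (fun v => P v /\ Q v).
Proof.
move=> [p p0 hp] [q q0 hq]; exists (p * q); first by rewrite mulf_neq0.
by move=> v; rewrite mevalM mulf_eq0 negb_or => /andP[/hp ? /hq].
Qed.

Lemma generic_sub P Q : generic P -> (forall v, P v -> Q v) -> generic Q.
Proof. by move=> [p p0 hp] H; exists p => // v /hp /H. Qed.

Lemma generic_true P : (forall v, P v) -> generic P.
Proof. by move=> H; exists 1 => //; exact: oner_neq0. Qed.

Lemma generic_all (T : eqType) (r : seq T) (P : T -> _) :
  (forall x, x \in r -> generic (P x)) -> generic (fun v => forall x, x \in r -> P x v).
Proof.
elim: r => [|a r IH] H; first by apply: generic_true.
have h1 : generic (P a) by apply: H; rewrite mem_head.
have h2 : generic (fun v => forall x, x \in r -> P x v).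
  by apply: IH => x xr; apply: H; rewrite in_cons xr orbT.
apply: generic_sub (generic_and h1 h2) _ => v [Pa Pr] x.
by rewrite in_cons => /predU1P[->|/Pr].
Qed.

Lemma generic_fin (T : finType) (P : T -> _) :
  (forall x, generic (P x)) -> generic (fun v => forall x, P x v).
Proof.
move=> H; apply: generic_sub (generic_all (r := enum T) (fun x _ => H x)) _.
by move=> v h x; apply: h; rewrite mem_enum.
Qed.

Lemma generic_polyfn f v0 : polyfn f -> f v0 != 0 -> generic (fun v => f v != 0).
Proof.
move=> [q hq] h0; exists q => [|v]; last by rewrite hq.
by apply: contra_neq h0 => q0; rewrite hq q0 meval0.
Qed.

(** Constant matrices [P] and [Q] with [P *m M v0 *m Q] the identity select a minor that is nonzero
    at [v0]; it is a polynomial in [v], hence nonzero at generic [v]. *)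
Lemma generic_rank_ge a b (M : _ -> 'M[K]_(a, b)) v0 :
  (forall i j, polyfn (fun v => M v i j)) ->
  generic (fun v => (\rank (M v0) <= \rank (M v))%N).
Proof.
move=> HM.
have [P [Q e]] : exists (P : 'M_(_, a)) (Q : 'M_(b, _)), P *m M v0 *m Q = 1%:M :> 'M_(\rank (M v0)).
  have e0 := mulmx_ebase (M v0); set r := \rank (M v0) in e0 *.
  exists (pid_mx r *m invmx (col_ebase (M v0))).
  exists (invmx (row_ebase (M v0)) *m pid_mx r).
  rewrite -{2}e0 !mulmxA mulmxKV ?col_ebase_unit // mulmxK ?row_ebase_unit //.
  rewrite !mul_pid_mx !minnn (minn_idPr (rank_leq_row _)) minnn.
  by rewrite (minn_idPr (rank_leq_col _)) ?minnn pid_mx_1.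
have pf : polyfn (fun v => \det (P *m M v *m Q)).
  apply: polyfn_det; apply: polyfn_mulmx; last by move=> i j; exact: polyfn_cst.
  by apply: polyfn_mulmx => // i j; exact: polyfn_cst.
have := @generic_polyfn _ v0 pf; rewrite e det1 oner_neq0 => /(_ isT) g.
apply: generic_sub g _ => v; rewrite -unitfE -unitmxE => u.
apply: leq_trans (mxrankM_maxr P (M v)); apply: leq_trans (mxrankM_maxl _ Q).
by rewrite mxrank_unit.
Qed.

Lemma generic_rank_max a b (M : _ -> 'M[K]_(a, b)) :
  (forall i j, polyfn (fun v => M v i j)) ->
  exists2 v0, generic (fun v => \rank (M v) = \rank (M v0)) &
    forall v, (\rank (M v) <= \rank (M v0))%N.
Proof.
move=> HM.
have [v0 hv0] : exists v0, forall v, (\rank (M v) <= \rank (M v0))%N.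
  have ex : exists r, `[< exists v, \rank (M v) = r >].
    by exists (\rank (M (fun=> 0))); apply/asboolP; exists (fun=> 0).
  have ub r : `[< exists v, \rank (M v) = r >] -> (r <= a)%N.
    by move=> /asboolP[v <-]; exact: rank_leq_row.
  case: (ex_maxnP ex ub) => r /asboolP[v0 <-] h; exists v0 => v.
  by apply: h; apply/asboolP; exists v.
exists v0 => //; apply: generic_sub (generic_rank_ge v0 HM) _ => v h.
by apply/eqP; rewrite eqn_leq h hv0.
Qed.

Hypothesis K0 : [pchar K] =i pred0.

Lemma generic_ex P : generic P -> exists v, P v.
Proof. by move=> [q /(meval_neq0 K0)[v hv] h]; exists v; apply: h. Qed.

End Generic.

Section Generically.
Variables (K : fieldType) (m n : nat).
Hypothesis K0 : [pchar K] =i pred0.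

Lemma generically_generic (P : 'M[K]_(m, n) -> Prop) :
  generically P <-> generic (fun v : 'I_(m * n) -> K => P (vec_mx (\row_i v i))).
Proof.
have E (v : 'I_(m * n) -> K) : mxvec (vec_mx (\row_i v i)) 0 =1 v by move=> i; rewrite vec_mxK mxE.
split.
- move=> [U [[S ->] [A [f Sf fA]] sub]]; exists f.
    by apply: contra_neq fA => ->; rewrite meval0.
  by move=> v hv; apply: sub; exists f => //; rewrite (meval_eq _ (E v)).
- move=> [q q0 h]; exists [set A | q.@[mxvec A 0] != 0]; split.
  + exists [set q]; apply/seteqP; split => A; first by exists q.
    by case=> f ->.
  + by have [v hv] := meval_neq0 K0 q0; exists (vec_mx (\row_i v i)); rewrite /= (meval_eq _ (E v)).
  + move=> A /= hA; have := h (mxvec A 0) hA.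
    suff -> : \row_i mxvec A 0 i = mxvec A by rewrite mxvecK.
    by apply/rowP => i; rewrite mxE.
Qed.

Lemma polyfn_entry i j : polyfn (fun v : 'I_(m * n) -> K => vec_mx (\row_k v k) i j).
Proof. by under eq_fun do rewrite !mxE; exact: polyfn_coord. Qed.

End Generically.

(** * Ranks of families of vectors indexed by finite types *)

Section Families.
Variables (K : fieldType) (T T' : finType).
Implicit Types (F G : T -> T' -> K) (x : T' -> K).

Definition fam_mx (T1 T2 : finType) (F : T1 -> T2 -> K) : 'M_(#|T1|, #|T2|) :=
  \matrix_(i, j) F (enum_val i) (enum_val j).

Definition fam_rank (T1 T2 : finType) (F : T1 -> T2 -> K) := \rank (fam_mx F).

Definition fam_row (T2 : finType) (x : T2 -> K) : 'rV_#|T2| := \row_j x (enum_val j).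

Lemma sub_famP x F :
  (fam_row x <= fam_mx F)%MS <-> exists c : T -> K, forall b, x b = \sum_t c t * F t b.
Proof.
split.
- case/submxP => c e; exists (fun t => c 0 (enum_rank t)) => b.
  have /rowP/(_ (enum_rank b)) := e; rewrite !mxE enum_rankK => ->.
  rewrite (reindex _ (onW_bij _ (enum_val_bij T))) /=.
  by apply: eq_bigr => t _; rewrite !mxE !enum_valK enum_rankK.
- case=> c e; apply/submxP; exists (\row_i c (enum_val i)); apply/rowP => j.
  rewrite !mxE e (reindex _ (onW_bij _ (enum_val_bij T))) /=.
  by apply: eq_bigr => t _; rewrite !mxE.
Qed.

Lemma row_fam F i : row i (fam_mx F) = fam_row (F (enum_val i)).
Proof. by apply/rowP => j; rewrite !mxE. Qed.

End Families.

Section FamilyRank.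
Variables (K : fieldType).

Lemma fam_sub (T1 T2 T' : finType) (F : T1 -> T' -> K) (G : T2 -> T' -> K) :
  (forall t, exists c : T2 -> K, forall b, F t b = \sum_s c s * G s b) ->
  (fam_mx F <= fam_mx G)%MS.
Proof. by move=> H; apply/row_subP => i; rewrite row_fam; apply/sub_famP. Qed.

Lemma fam_sub_row (T1 T2 T' : finType) (F : T1 -> T' -> K) (G : T2 -> T' -> K) :
  (fam_mx F <= fam_mx G)%MS -> forall t, (fam_row (F t) <= fam_mx G)%MS.
Proof.
move=> /row_subP H t; have := H (enum_rank t); by rewrite row_fam enum_rankK.
Qed.

Lemma fam_rank_le (T1 T2 T' : finType) (F : T1 -> T' -> K) (G : T2 -> T' -> K) :
  (forall t, exists c : T2 -> K, forall b, F t b = \sum_s c s * G s b) ->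
  (fam_rank F <= fam_rank G)%N.
Proof. by move=> /fam_sub/mxrankS. Qed.

Lemma fam_rank_free (T T' : finType) (F : T -> T' -> K) (X : {pred T}) :
  (forall t b, t \notin X -> F t b = 0) ->
  (forall c : T -> K, (forall b, \sum_(t in X) c t * F t b = 0) ->
     forall t, t \in X -> c t = 0) ->
  fam_rank F = #|X|.
Proof.
move=> FX free; pose E := \matrix_(i < #|X|, j < #|T'|) F (enum_val i) (enum_val j).
have rE : row_free E.
  rewrite -kermx_eq0; apply/eqP/row_matrixP => i; rewrite row0.
  have := sub_kermx E (row i (kermx E)); rewrite row_sub => /esym/eqP e.
  apply/rowP => k; rewrite [RHS]mxE; set u := row i _ in e *.
  pose d (t : T) := \sum_(k | enum_val k == t) u 0 k.
  have dE k' : d (enum_val k') = u 0 k'.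
    rewrite /d (big_pred1 k') // => k2; apply/eqP/eqP => [/enum_val_inj //|-> //].
  rewrite -dE; apply: free; last exact: enum_valP.
  move=> b; have /rowP/(_ (enum_rank b)) := e; rewrite !mxE => e'; apply: etrans e'.
  rewrite [LHS]big_enum_val /=; apply: eq_bigr => k' _.
  by rewrite dE !mxE enum_rankK.
transitivity (\rank E); last exact/eqP.
apply/eqP; rewrite eqn_leq; apply/andP; split; apply: mxrankS; apply/row_subP => i.
- have [Xi|Xi] := boolP (enum_val i \in X).
    rewrite (_ : row i _ = row (enum_rank_in Xi (enum_val i)) E) ?row_sub //.
    by apply/rowP => j; rewrite !mxE enum_rankK_in.
  rewrite (_ : row i _ = 0) ?sub0mx //.
  by apply/rowP => j; rewrite !mxE FX.
- rewrite (_ : row i E = row (enum_rank (enum_val i)) (fam_mx F)) ?row_sub //.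
  by apply/rowP => j; rewrite !mxE enum_rankK.
Qed.

Lemma tau_max (T : eqType) (tau : rel T) (s : seq T) :
  transitive tau -> total tau -> s != [::] ->
  exists2 x, x \in s & forall y, y \in s -> tau y x.
Proof.
move=> tr to; elim: s => // a [|b s] IH _.
  by exists a; rewrite ?mem_head // => y; rewrite inE => /eqP->; have := to a a; rewrite orbb.
have [//|x xs h] := IH; have [ax|xa] := orP (to a x).
  exists x; first by rewrite in_cons xs orbT.
  by move=> y; rewrite in_cons => /predU1P[->|/h].
exists a; first by rewrite mem_head.
move=> y; rewrite in_cons => /predU1P[->|/h yx]; last exact: tr xa.
by have := to a a; rewrite orbb.
Qed.

(** In a relation [c], take [t] with [c t] nonzero and [g t] largest for [tau]: in column [l t] no
    other row of the relation contributes. *)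
Lemma triangular_free (T T' : finType) (U : eqType) (F : T -> T' -> K) (X : {pred T})
    (l : T -> T') (g : T -> U) (tau : rel U) :
  transitive tau -> total tau ->
  (forall t, t \in X -> F t (l t) != 0) ->
  (forall s t, s \in X -> t \in X -> F s (l t) != 0 -> tau (g s) (g t) -> s = t) ->
  forall c : T -> K, (forall b, \sum_(t in X) c t * F t b = 0) ->
  forall t, t \in X -> c t = 0.
Proof.
move=> tr to Fd Ft c c0 t0 Xt0.
apply/eqP/negPn/negP => ct0.
pose s := [seq g t | t <- enum X & c t != 0].
have s0 : s != [::].
  have : g t0 \in s by apply: map_f; rewrite mem_filter ct0 mem_enum.
  by case: s.
have [x /mapP[t]] := tau_max tr to s0.
rewrite mem_filter mem_enum => /andP[ct Xt] -> h.
have := c0 (l t); rewrite (bigD1 t) //= big1 ?addr0.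
  by move/eqP; rewrite mulf_eq0 (negbTE ct) (negbTE (Fd _ Xt)).
move=> u /andP[Xu ut]; apply/eqP; rewrite mulf_eq0; apply/norP => -[cu Fu].
case/eqP: ut; apply: Ft => //.
by apply: h; apply: map_f; rewrite mem_filter cu mem_enum.
Qed.

Lemma fam_rank_triangular (T T' : finType) (U : eqType) (F : T -> T' -> K) (X : {pred T})
    (l : T -> T') (g : T -> U) (tau : rel U) :
  transitive tau -> total tau ->
  (forall t b, t \notin X -> F t b = 0) ->
  (forall t, t \in X -> F t (l t) != 0) ->
  (forall s t, s \in X -> t \in X -> F s (l t) != 0 -> tau (g s) (g t) -> s = t) ->
  fam_rank F = #|X|.
Proof. by move=> tr to F0 Fd Ft; apply: fam_rank_free => //; apply: (triangular_free tr to Fd Ft). Qed.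

End FamilyRank.

(** * Leading coefficients with respect to a term order *)

Section Degeneration.
Variables (K : fieldType) (n : nat) (tau : rel 'X_{1..n}).
Hypothesis tau_order : term_order tau.
Implicit Types (f g : {mpoly K[n]}).

(** Only a bound: the coefficient at [a] may vanish. A whole row of polynomials can thus share one
    bound, and its coefficients there form a row that may contain zeros. *)
Definition tau_le f a := forall m, m \in msupp f -> tau m a.

Lemma tau_leD f g a : tau_le f a -> tau_le g a -> tau_le (f + g) a.
Proof. by move=> hf hg m /msuppD_le; rewrite mem_cat => /orP[/hf|/hg]. Qed.

Lemma tau_le_sum (I : Type) (r : seq I) (P : pred I) (F : I -> {mpoly K[n]}) a :
  (forall i, P i -> tau_le (F i) a) -> tau_le (\sum_(i <- r | P i) F i) a.
Proof.
move=> H; apply: (big_ind (fun f => tau_le f a)) => //; last by move=> *; apply: tau_leD.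
by move=> m; rewrite msupp0.
Qed.

(** By compatibility and cancellation, [(a, b)] is the only pair of monomials below [a] and [b] that
    multiplies to [a + b]. *)
Lemma tau_leM f g a b : tau_le f a -> tau_le g b ->
  tau_le (f * g) (a + b)%MM /\ (f * g)@_(a + b) = f@_a * g@_b.
Proof.
case: tau_order => an tr _ _ ad hf hg.
have st k1 k2 : tau k1 a -> tau k2 b -> tau (k1 + k2)%MM (a + b)%MM.
  move=> h1 h2; apply: (tr (k1 + b)%MM); first exact: ad.
  by rewrite ![(_ + b)%MM]addmC; apply: ad.
split.
  by move=> m /msuppM_le/allpairsP[[m1 m2] /= [h1 h2 ->]]; apply: st; [apply: hf|apply: hg].
have da : (mdeg a < (mdeg (a + b)).+1)%N by rewrite ltnS mdegD leq_addr.
have db : (mdeg b < (mdeg (a + b)).+1)%N by rewrite ltnS mdegD leq_addl.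
rewrite mcoeffM (bigD1 (BMultinom da, BMultinom db)) //= big1 ?addr0 // => -[k1 k2] /=.
move=> /andP[/eqP e ne]; apply/eqP; rewrite mulf_eq0; apply/norP => -[].
rewrite -!mcoeff_msupp => /hf h1 /hg h2; case/eqP: ne.
have h3 : tau (a + k2)%MM (k1 + k2)%MM by rewrite -e; apply: ad.
have h4 : tau (k1 + k2)%MM (a + k2)%MM by rewrite ![(_ + bmnm k2)%MM]addmC; apply: ad.
have e1 : bmnm k1 = a by apply: (@addIm _ (bmnm k2)); apply: an; rewrite h3 h4.
have e2 : bmnm k2 = b by apply: (@addmI _ a); rewrite -{1}e1.
by congr (_, _); apply: val_inj.
Qed.

Lemma tau_le_prod (I : Type) (r : seq I) (F : I -> {mpoly K[n]}) (a : I -> 'X_{1..n}) :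
  (forall i, tau_le (F i) (a i)) ->
  tau_le (\prod_(i <- r) F i) (\sum_(i <- r) a i)%MM /\
  (\prod_(i <- r) F i)@_(\sum_(i <- r) a i)%MM = \prod_(i <- r) (F i)@_(a i).
Proof.
move=> H; elim: r => [|x r [IH1 IH2]].
  rewrite !big_nil mcoeff1 eqxx; split=> // m; rewrite -[1]mpolyX0 msuppX inE => /eqP->.
  by case: tau_order.
by rewrite !big_cons; have [h1 h2] := tau_leM (H x) IH1; split; rewrite ?h2 ?IH2.
Qed.

Lemma tau_le_det m (M : 'M[{mpoly K[n]}]_m) (e : 'I_m -> 'X_{1..n}) :
  (forall i j, tau_le (M i j) (e i)) ->
  (\det M)@_(\sum_i e i)%MM = \det (\matrix_(i, j) (M i j)@_(e i)).
Proof.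
move=> H; rewrite raddf_sum /=; apply: eq_bigr => s _.
have -> : (-1) ^+ s = ((-1) ^+ s : K)%:MP :> {mpoly K[n]} by rewrite rmorphXn rmorphN1.
rewrite mcoeffCM; congr (_ * _).
have [_ ->] := tau_le_prod (index_enum _) (fun i => H i (s i)).
by apply: eq_bigr => i _; rewrite mxE.
Qed.

(* In each row the tau-leading coefficients dominate, so a minor of the matrix of
   leading coefficients is the leading coefficient of a minor of M. *)
Lemma generic_rank_lead a b (M : 'M[{mpoly K[n]}]_(a, b)) (e : 'I_a -> 'X_{1..n}) :
  (forall i j, tau_le (M i j) (e i)) ->
  generic (fun v => (\rank (\matrix_(i, j) (M i j)@_(e i))
                     <= \rank (map_mx (meval v) M))%N).
Proof.
move=> H; set L := \matrix_(i, j) _.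
pose f := maxrankfun L; have fr : row_free (rowsub f L) := maxrowsub_free L.
pose Q := pinvmx (rowsub f L).
pose N := rowsub f M *m map_mx (@mpolyC n K) Q.
have HN i j : tau_le (N i j) (e (f i)).
  rewrite mxE; apply: tau_le_sum => k _ m; rewrite !mxE mulrC mul_mpolyC => /msuppZ_le.
  exact: H.
have dN : (\det N)@_(\sum_i e (f i))%MM = 1.
  rewrite tau_le_det // (_ : \matrix_(i, j) _ = 1%:M) ?det1 // -(mulmxVp fr).
  apply/matrixP => i j; rewrite !mxE raddf_sum /=; apply: eq_bigr => k _.
  by rewrite !mxE mulrC mcoeffCM mulrC.
exists (\det N).
  by apply: contraTneq (oner_neq0 K) => N0; rewrite -dN N0 mcoeff0 eqxx.
move=> v; rewrite -det_map_mx -unitfE -unitmxE => u.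
rewrite -(mxrank_unit u) map_mxM /=; apply: leq_trans (mxrankM_maxl _ _) _.
rewrite (_ : map_mx _ (rowsub f M) = rowsub f (map_mx (meval v) M)); last first.
  by apply/matrixP => i j; rewrite !mxE.
by apply/mxrankS/rowsub_sub.
Qed.

Lemma generic_fam_rank_lead (T T' : finType) (F : T -> T' -> {mpoly K[n]}) (e : T -> 'X_{1..n}) :
  (forall t b, tau_le (F t b) (e t)) ->
  generic (fun v => (fam_rank (fun t b => (F t b)@_(e t))
                     <= fam_rank (fun t b => (F t b).@[v]))%N).
Proof.
move=> H; pose M := \matrix_(i < #|T|, j < #|T'|) F (enum_val i) (enum_val j).
have HM i j : tau_le (M i j) (e (enum_val i)) by rewrite mxE.
apply: generic_sub (generic_rank_lead HM) _ => v; rewrite /fam_rank.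
rewrite (_ : (\matrix_(i, j) _) = fam_mx (fun t b => (F t b)@_(e t))); last first.
  by apply/matrixP => i j; rewrite !mxE.
rewrite (_ : map_mx _ _ = fam_mx (fun t b => (F t b).@[v])) //.
by apply/matrixP => i j; rewrite !mxE.
Qed.

End Degeneration.

(** * Dimensions of quotients through ranks *)

Lemma has_quot_dim_uniq (K : fieldType) (V : lmodType K) (Z B : set V) d d' :
  (forall m (c : 'I_m -> K) e, (forall k, B (e k)) -> B (\sum_k c k *: e k)) ->
  has_quot_dim Z B d -> has_quot_dim Z B d' -> d = d'.
Proof.
move=> Blin; have BD u v : B u -> B v -> B (u + v).
  move=> Bu Bv; have := Blin 2 (fun=> 1) (fun k => if k == 0 then u else v).
  by rewrite !big_ord_recl big_ord0 addr0 /= !scale1r; apply => k; case: ifP.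
suff le a b : has_quot_dim Z B a -> has_quot_dim Z B b -> (b <= a)%N.
  by move=> h1 h2; apply/eqP; rewrite eqn_leq !le.
move=> [e [eZ eB eS]] [f [fZ fB fS]].
have [M MP] := choice (fun k => eS (f k) (fZ k)).
pose N := \matrix_(k, l) M k l; suff : row_free N by rewrite /row_free => /eqP <-; exact: rank_leq_col.
rewrite -kermx_eq0; apply/eqP/row_matrixP => i; rewrite row0.
have := sub_kermx N (row i (kermx N)); rewrite row_sub; set u := row _ _ => /esym/eqP uN.
apply/rowP => k; rewrite [RHS]mxE; apply: (fB (fun k => u 0 k)) => {k}.
have -> : \sum_k u 0 k *: f k = \sum_k u 0 k *: (f k - \sum_l M k l *: e l).
  apply/eqP; rewrite -subr_eq0 -sumrB; apply/eqP.
  transitivity (\sum_k \sum_l (u 0 k * M k l) *: e l).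
    apply: eq_bigr => k _; rewrite -scalerBr opprB addrC subrK scaler_sumr.
    by apply: eq_bigr => l _; rewrite scalerA.
  rewrite exchange_big big1 //= => l _; rewrite -scaler_suml.
  have /rowP/(_ l) := uN; rewrite !mxE => e0.
  rewrite (_ : \sum_k _ = 0) ?scale0r // -[RHS]e0.
  by apply: eq_bigr => k _; rewrite [N _ _]mxE.
by apply: Blin => k; exact: MP.
Qed.

Section QuotDim.
Variables (K : fieldType) (V : lmodType K) (N a b : nat) (k : {linear V -> 'rV[K]_N}).
Variables (C Z B : set V) (Zm : 'M[K]_(a, N)) (Bm : 'M[K]_(b, N)).
Hypothesis ZC : Z `<=` C.
Hypothesis C_lin : forall d (c : 'I_d -> K) (e : 'I_d -> V),
  (forall i, C (e i)) -> C (\sum_i c i *: e i).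
Hypothesis CB : forall u v, C u -> C v -> C (u - v).
Hypothesis ZP : forall u, C u -> Z u <-> (k u <= Zm)%MS.
Hypothesis BP : forall u, C u -> B u <-> (k u <= Bm)%MS.
Hypothesis surj : forall v : 'rV_N, (v <= Zm)%MS -> exists2 u, C u & k u = v.
Hypothesis BZm : (Bm <= Zm)%MS.

(** The ambient module is infinite-dimensional, so membership in [Z] and [B] is tested, on a
    subspace [C], through coordinates [k] in the row spaces of [Zm] and [Bm]. *)
Lemma has_quot_dimP d : has_quot_dim Z B d <-> (d + \rank Bm)%N = \rank Zm.
Proof.
have kB u v : k (u - v) = k u - k v by exact: linearB.
split.
- move=> [e [eZ eB eS]]; pose E := \matrix_(i < d) k (e i).
  have kE c : k (\sum_i c i *: e i) = (\row_i c i) *m E.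
    rewrite linear_sum mulmx_sum_row; apply: eq_bigr => i _.
    by rewrite linearZ rowK mxE.
  have Ce c : C (\sum_i c i *: e i) by apply: C_lin => i; exact: ZC.
  have free (c : 'rV_d) : (c *m E <= Bm)%MS -> c = 0.
    move=> h; apply/rowP => i; rewrite mxE; apply: (eB (fun i => c 0 i)) => //.
    apply/(BP (Ce _)); rewrite kE (_ : \row_i _ = c) //.
    by apply/rowP => j; rewrite mxE.
  have rE : row_free E.
    rewrite -kermx_eq0; apply/eqP/row_matrixP => i; rewrite row0; apply: free.
    have := sub_kermx E (row i (kermx E)); rewrite row_sub => /esym/eqP->.
    exact: sub0mx.
  have cap : (E :&: Bm)%MS = 0.
    apply/eqP/rowV0P => v; rewrite sub_capmx => /andP[/submxP[c ->] /free->].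
    by rewrite mul0mx.
  move: rE; rewrite /row_free => /eqP {1}<-; rewrite -mxrank_disjoint_sum //.
  apply/eqP; rewrite eqn_leq; apply/andP; split; apply: mxrankS.
    rewrite addsmx_sub BZm andbT; apply/row_subP => i; rewrite rowK.
    by apply/ZP; [apply: ZC|]; exact: eZ.
  apply/row_subP => i; have [u Cu uE] := surj (row_sub i Zm).
  have Zu : Z u by apply/ZP => //; rewrite uE row_sub.
  have [c Bc] := eS u Zu; rewrite -uE -[u](subrK (\sum_i c i *: e i)) addrC linearD.
  rewrite addmx_sub_adds //; last by apply/BP => //; exact: CB.
  by rewrite kE submxMl.
- move=> dE; pose W := (Zm :\: Bm)%MS.
  have rW : \rank W = d.
    by have := mxrank_cap_compl Zm Bm; rewrite (capmx_idPr BZm) -dE addnC => /addIn.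
  have W0 : (W :&: Bm)%MS = 0 := capmx_diff Zm Bm.
  have WZ : (W <= Zm)%MS := diffmxSl Zm Bm.
  have WB : (W + Bm :=: Zm)%MS.
    apply: eqmx_trans (addsmx_diff_cap_eq Zm Bm); apply: adds_eqmx => //.
    exact/eqmx_sym/capmx_idPr.
  pose R : 'M_(d, N) := castmx (rW, erefl N) (row_base W).
  have RW : (R :=: W)%MS by apply: eqmx_trans (eqmx_cast _ _) (eq_row_base _).
  have ex i : exists u, C u /\ k u = row i R.
    have /surj[u ? ?] : (row i R <= Zm)%MS by rewrite (submx_trans (row_sub _ _)) // RW.
    by exists u.
  have [e eP] := choice ex.
  have kE c : k (\sum_i c i *: e i) = (\row_i c i) *m R.
    rewrite linear_sum mulmx_sum_row; apply: eq_bigr => i _.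
    by rewrite linearZ (eP i).2 mxE.
  have Ce c : C (\sum_i c i *: e i) by apply: C_lin => i; case: (eP i).
  have Rf : row_free R by rewrite /row_free RW rW.
  exists e; split.
  + move=> i; apply/ZP; first by case: (eP i).
    by rewrite (eP i).2 (submx_trans (row_sub _ _)) // RW.
  + move=> c /(BP (Ce c)); rewrite kE => h i.
    have hW : ((\row_i c i) *m R <= W)%MS by apply: submx_trans (submxMl _ _) _; rewrite RW.
    have : ((\row_i c i) *m R <= W :&: Bm)%MS by rewrite sub_capmx hW.
    rewrite W0 submx0 => /eqP e0.
    have e1 : \row_i c i = 0 by apply/eqP; rewrite -(mulmx_free_eq0 _ Rf) e0.
    by have /rowP/(_ i) := e1; rewrite !mxE.
  + move=> z Zz; have : (k z <= W + Bm)%MS by rewrite WB; apply/ZP => //; exact: ZC.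
    case/sub_addsmxP => -[w b'] /= kz.
    have : (w *m W <= R)%MS by rewrite RW submxMl.
    case/submxP => c cE; exists (fun i => c 0 i).
    apply/BP; first by apply: CB => //; exact: ZC.
    have cR : \row_i c 0 i = c by apply/rowP => j; rewrite mxE.
    have -> : k (z - \sum_i c 0 i *: e i) = b' *m Bm.
      by rewrite kB kz (kE (fun i => c 0 i)) cR cE addrC addrA addNr add0r.
    exact: submxMl.
Qed.

Lemma quot_dimP : (quot_dim Z B + \rank Bm)%N = \rank Zm.
Proof.
apply/has_quot_dimP; rewrite /quot_dim; apply: (@xgetPex _ 0%N).
by exists (\rank Zm - \rank Bm)%N; apply/has_quot_dimP; rewrite subnK // mxrankS.
Qed.

End QuotDim.

(** * The Koszul complex of a graded ideal *)

Section KoszulAlgebra.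
Variables (K : fieldType) (n p : nat).
Local Notation R := {mpoly K[n]}.
Local Notation ext := {ffun {set 'I_p} -> R}.
Implicit Types (A : 'M[K]_(p, n)) (u v : ext) (s t r : 'I_p) (S T : {set 'I_p}).

Definition ksgn s T : R := (-1) ^+ #|[pred t in T | (t < s)%N]|.

Lemma card_setU1_lt s t T : s \notin T ->
  #|[pred x in (s |: T)%SET | (x < t)%N]| = ((s < t) + #|[pred x in T | (x < t)%N]|)%N.
Proof.
move=> sT; rewrite -(cardID (pred1 s)); congr (_ + _)%N.
  case: ltnP => st.
    rewrite (@eq_card1 _ s) // => x; rewrite !inE.
    by case: eqVneq => [->|]; rewrite ?andbF // st.
  rewrite eq_card0 // => x; rewrite !inE.
  by case: eqVneq => [->|]; rewrite ?andbF // ltnNge st.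
apply: eq_card => x; rewrite !inE; case: eqVneq => [->|] //=.
by rewrite (negbTE sT).
Qed.

Lemma ksgnU s t T : s \notin T -> ksgn t (s |: T)%SET = (-1) ^+ (s < t)%N * ksgn t T.
Proof. by move=> sT; rewrite /ksgn -exprD card_setU1_lt. Qed.

Lemma ksgnK s T : ksgn s T * ksgn s T = 1.
Proof. by rewrite /ksgn -expr2 sqrr_sign. Qed.

(** Interior product with the dual vector of $e_s$; the differential is the sum of these operators
    weighted by the linear forms. *)
Definition contract s u : ext :=
  [ffun T : {set 'I_p} => if s \in T then 0 else ksgn s T * u (s |: T)%SET].

Definition wedge r u : ext :=
  [ffun T : {set 'I_p} => if r \in T then ksgn r (T :\ r)%SET * u (T :\ r)%SET else 0].

Definition ext_scale (f : R) u : ext := [ffun T => f * u T].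

Lemma koszul_diffE A u : koszul_diff A u = \sum_s ext_scale (lin_form A s) (contract s u).
Proof.
apply/ffunP => T; rewrite ffunE sum_ffunE [RHS]big_mkcond [LHS]big_mkcond /=.
apply: eq_bigr => s _; rewrite !ffunE; case: ifP => // sT.
  by rewrite (negbTE sT) mulrCA mulrA.
by rewrite (negbFE sT) mulr0.
Qed.

Lemma contractC s t u : contract s (contract t u) = - contract t (contract s u).
Proof.
apply/ffunP => T; rewrite !ffunE !inE (eq_sym s t).
case: (boolP (s \in T)) => sT; case: (boolP (t \in T)) => tT; rewrite ?orbT ?mulr0 ?oppr0 ?orbF //.
case: (eqVneq t s) => [->|ts]; first by rewrite !mulr0 oppr0.
rewrite finset.setUCA !ksgnU //.
have [st|st|/val_inj e] := ltngtP s t; last by rewrite e eqxx in ts.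
  by rewrite expr1 expr0 !mul1r !mulN1r !mulNr mulrN mulrCA.
by rewrite expr1 expr0 !mul1r !mulN1r !mulNr mulrN opprK mulrCA.
Qed.

(** The anticommutation relation of interior and exterior products. With [contractC] it carries the
    signs for the identities on the differential below. *)
Lemma contract_wedge s r u :
  contract s (wedge r u) + wedge r (contract s u) = if s == r then u else 0.
Proof.
apply/ffunP => T; rewrite !ffunE !inE; case: (eqVneq s r) => [->|sr].
  case: (boolP (r \in T)) => rT; last first.
    by rewrite addr0 finset.setU1K // mulrA ksgnK mul1r.
  by rewrite add0r finset.setD1K // mulrA ksgnK mul1r.
rewrite ffunE /=.
case: (boolP (s \in T)) => sT; case: (boolP (r \in T)) => rT; rewrite ?mulr0 ?addr0 //.
have e : ((s |: T) :\ r = s |: (T :\ r))%SET.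
  by apply/setP => x; rewrite !inE; case: (eqVneq x r) => // ->; rewrite eq_sym (negbTE sr).
have sT' : s \notin (T :\ r)%SET by rewrite !inE negb_and sT orbT.
have -> : ksgn s T = (-1) ^+ (r < s)%N * ksgn s (T :\ r)%SET.
  by rewrite -{1}(finset.setD1K rT) ksgnU ?finset.setD11.
rewrite e ksgnU //.
have [st|st|/val_inj e'] := ltngtP s r; last by rewrite e' eqxx in sr.
  by rewrite expr1 expr0 !mul1r !mulN1r !mulNr mulrN mulrCA addNr.
by rewrite expr1 expr0 !mul1r !mulN1r !mulNr mulrCA addNr.
Qed.

Lemma contract0 s u : contract s (contract s u) = 0.
Proof. by apply/ffunP => T; rewrite !ffunE !inE eqxx /= mulr0; case: ifP. Qed.

Fact contract_is_linear s : linear (contract s).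
Proof.
move=> c u v; apply/ffunP => T; rewrite !ffunE; case: ifP => _; first by rewrite scaler0 addr0.
by rewrite mulrDr scalerAr.
Qed.
HB.instance Definition _ s := GRing.isLinear.Build K ext ext _ _ (contract_is_linear s).

Fact wedge_is_linear r : linear (wedge r).
Proof.
move=> c u v; apply/ffunP => T; rewrite !ffunE; case: ifP => _; last by rewrite scaler0 addr0.
by rewrite mulrDr scalerAr.
Qed.
HB.instance Definition _ s := GRing.isLinear.Build K ext ext _ _ (wedge_is_linear s).

Fact ext_scale_is_linear f : linear (ext_scale f).
Proof. by move=> c u v; apply/ffunP => T; rewrite !ffunE mulrDr scalerAr. Qed.
HB.instance Definition _ f := GRing.isLinear.Build K ext ext _ _ (ext_scale_is_linear f).

Fact koszul_diff_is_linear A : linear (koszul_diff A).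
Proof.
move=> c u v; rewrite !koszul_diffE scaler_sumr -big_split /=; apply: eq_bigr => s _.
by rewrite !linearP.
Qed.
HB.instance Definition _ A := GRing.isLinear.Build K ext ext _ _ (koszul_diff_is_linear A).

Lemma contract_scale s f u : contract s (ext_scale f u) = ext_scale f (contract s u).
Proof. by apply/ffunP => T; rewrite !ffunE; case: ifP; rewrite ?mulr0 // mulrCA. Qed.

Lemma wedge_scale s f u : wedge s (ext_scale f u) = ext_scale f (wedge s u).
Proof. by apply/ffunP => T; rewrite !ffunE; case: ifP; rewrite ?mulr0 // mulrCA. Qed.

Lemma ext_scaleA f g u : ext_scale f (ext_scale g u) = ext_scale (f * g) u.
Proof. by apply/ffunP => T; rewrite !ffunE mulrA. Qed.

Lemma koszul_diff_contract A s u :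
  contract s (koszul_diff A u) = - koszul_diff A (contract s u).
Proof.
rewrite !koszul_diffE raddf_sum -sumrN; apply: eq_bigr => t _ /=.
by rewrite contract_scale contractC raddfN.
Qed.

Lemma koszul_diff_wedge A r u :
  koszul_diff A (wedge r u) = ext_scale (lin_form A r) u - wedge r (koszul_diff A u).
Proof.
rewrite !koszul_diffE raddf_sum /= -sumrN.
have -> : ext_scale (lin_form A r) u = \sum_s if s == r then ext_scale (lin_form A s) u else 0.
  by rewrite -big_mkcond big_pred1_eq.
rewrite -big_split /=; apply: eq_bigr => s _; rewrite wedge_scale.
have /(canRL (addrK _)) -> := contract_wedge s r u.
by rewrite raddfB /=; case: ifP => // _; rewrite raddf0.
Qed.

(** Exchanging the two contractions shows that the square equals its own negative; division by 2
    finishes. *)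
Lemma koszul_diffK A u : [pchar K] =i pred0 -> koszul_diff A (koszul_diff A u) = 0.
Proof.
move=> K0; pose G s t := ext_scale (lin_form A s * lin_form A t) (contract s (contract t u)).
have dd : koszul_diff A (koszul_diff A u) = \sum_s \sum_t G s t.
  rewrite [LHS]koszul_diffE; apply: eq_bigr => s _; rewrite koszul_diffE !raddf_sum /=.
  by apply: eq_bigr => t _; rewrite contract_scale ext_scaleA.
have e : \sum_s \sum_t G s t = - \sum_s \sum_t G s t.
  rewrite {1}exchange_big -sumrN; apply: eq_bigr => s _; rewrite -sumrN; apply: eq_bigr => t _.
  by rewrite /G contractC raddfN mulrC.
rewrite dd; apply/ffunP => T; apply/mpolyP => m; rewrite !ffunE mcoeff0.
have := congr1 (fun v : ext => (v T)@_m) e; rewrite ffunE mcoeffN => /eqP.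
by rewrite -addr_eq0 -mulr2n -mulr_natr mulf_eq0 (pcharf0P K).1 // orbF => /eqP.
Qed.

(** That is, $N^2=0$ for $N=e_r\wedge\iota_s$, so that $1+cN$ has the inverse $1-cN$. *)
Lemma wedge_contractK r s u : r != s ->
  wedge r (contract s (wedge r (contract s u))) = 0.
Proof.
move=> rs; have := contract_wedge s r (contract s u); rewrite eq_sym (negbTE rs).
by rewrite contract0 raddf0 addr0 => ->; rewrite raddf0.
Qed.

(* Adding c y_r to y_s conjugates the differential by exp(c N), where the operator
   N = e_r /\ contract e_s has square 0. *)
Lemma row_add_conj A r s (c : K) u : r != s ->
  let A' := \matrix_(k, l) (A k l + (if k == s then c * A r l else 0)) in
  let f w := w + c *: wedge r (contract s w) in
  koszul_diff A (f u) = f (koszul_diff A' u).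
Proof.
move=> rs A' f; pose N w := wedge r (contract s w).
have dN w : koszul_diff A (N w) = ext_scale (lin_form A r) (contract s w) + N (koszul_diff A w).
  by rewrite /N koszul_diff_wedge koszul_diff_contract raddfN.
have Nc f0 w : N (ext_scale f0 (contract s w)) = 0.
  by rewrite /N contract_scale contract0 !raddf0.
have dA' w : koszul_diff A' w = koszul_diff A w + c *: ext_scale (lin_form A r) (contract s w).
  rewrite !koszul_diffE.
  have -> : c *: ext_scale (lin_form A r) (contract s w) =
    \sum_k if k == s then c *: ext_scale (lin_form A r) (contract k w) else 0.
    by rewrite -big_mkcond big_pred1_eq.
  rewrite -big_split /=; apply: eq_bigr => k _; apply/ffunP => T; rewrite !ffunE.
  have -> : lin_form A' k = lin_form A k + (if k == s then c *: lin_form A r else 0).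
    rewrite /lin_form; case: (eqVneq k s) => [->|ks]; last first.
      by rewrite addr0; apply: eq_bigr => l _; rewrite mxE (negbTE ks) addr0.
    rewrite scaler_sumr -big_split /=; apply: eq_bigr => l _.
    by rewrite mxE eqxx scalerDl scalerA.
  rewrite mulrDl; congr (_ + _); case: eqP => _; last by rewrite mul0r ffunE.
  by rewrite !ffunE scalerAl.
have NL w1 w2 : N (w1 + c *: w2) = N w1 + c *: N w2.
  by rewrite /N addrC !linearP addrC.
rewrite /f -/(N u) -/(N (koszul_diff A' u)) dA' NL Nc scaler0 addr0.
by rewrite addrC linearP /= -/(N u) dN scalerDr addrC addrA.
Qed.

End KoszulAlgebra.

Section KoszulChains.
Variables (K : fieldType) (n p : nat).
Local Notation R := {mpoly K[n]}.
Local Notation ext := {ffun {set 'I_p} -> R}.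
Implicit Types (A : 'M[K]_(p, n)) (u v w : ext) (S T : {set 'I_p}) (i : nat) (j : int).

Lemma koszul_chainP i j u : koszul_chain i j u <->
  forall S m, m \in msupp (u S) -> #|S| = i /\ (mdeg m + i)%:Z = j.
Proof.
split=> H S.
- move=> m mS; move: (H S); case: eqP => [Si|_ u0]; last by rewrite u0 msupp0 in mS.
  move=> gp; split => //; rewrite PoszD -[RHS](subrK i%:Z j); congr (_ + _).
  move: gp; rewrite /graded_piece /=; case: (j - i%:Z) => [k|k] /=.
    by move=> /dhomogP /(_ m mS) ->.
  by move=> u0; rewrite u0 msupp0 in mS.
- case: eqP => [Si|ne]; last first.
    by apply: msuppnil0; case e: (msupp (u S)) => [//|m s]; case: (H S m) => //; rewrite e mem_head.
  rewrite /graded_piece /=; case e: (j - i%:Z) => [k|k].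
    apply/dhomogP => m /H[_ e']; apply/eqP; rewrite -eqz_nat -e -e' PoszD addrK //.
  apply: msuppnil0; case e': (msupp (u S)) => [//|m s].
  by case: (H S m); rewrite ?e' ?mem_head // => _ e2; move: e; rewrite -e2 PoszD addrK.
Qed.

Lemma koszul_chain_lin i j c u v : koszul_chain i j u -> koszul_chain i j v ->
  koszul_chain i j (c *: u + v).
Proof.
move=> /koszul_chainP hu /koszul_chainP hv; apply/koszul_chainP => S m.
rewrite !ffunE => /msuppD_le; rewrite mem_cat => /orP[/msuppZ_le|]; first exact: hu.
exact: hv.
Qed.

Lemma koszul_chain0 i j : koszul_chain i j (0 : ext).
Proof. by apply/koszul_chainP => S m; rewrite ffunE msupp0. Qed.

Lemma koszul_chain_sum i j (I : Type) (r : seq I) (P : pred I) (F : I -> ext) (c : I -> K) :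
  (forall x, P x -> koszul_chain i j (F x)) ->
  koszul_chain i j (\sum_(x <- r | P x) c x *: F x).
Proof.
move=> H; elim: r => [|x r IH]; first by rewrite big_nil; apply: koszul_chain0.
by rewrite big_cons; case: ifP => // /H Fx; apply: koszul_chain_lin.
Qed.

Lemma koszul_chainB i j u v : koszul_chain i j u -> koszul_chain i j v ->
  koszul_chain i j (u - v).
Proof.
move=> hu hv; rewrite addrC -scaleN1r; exact: koszul_chain_lin.
Qed.

Lemma lin_form_homog A s : lin_form A s \is 1.-homog.
Proof. by apply: rpred_sum => l _; apply: rpredZ; rewrite dhomogX /= mdeg1. Qed.

(** The truncated predecessor is harmless at [i = 0]: there the differential is zero, and zero is a
    chain in every degree. *)
Lemma koszul_diff_chain A i j u : koszul_chain i j u -> koszul_chain i.-1 j (koszul_diff A u).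
Proof.
move=> /koszul_chainP H; rewrite koszul_diffE -[\sum_s _]scale1r scaler_sumr.
apply: koszul_chain_sum => s _; apply/koszul_chainP => T m; rewrite !ffunE.
case: ifP => sT; first by rewrite mulr0 msupp0.
rewrite mulrCA /ksgn -signr_odd mulr_sign.
case: odd; rewrite ?(perm_mem (msuppN _)) => /msuppM_le/allpairsP[[m1 m2] /= [h1 h2 ->]];
  have [] := H _ _ h2; rewrite finset.cardsU1 sT /= => <- <-; split=> //;
  have /dhomogP/(_ _ h1) /= e1 := lin_form_homog A s;
  by rewrite mdegD e1 /= add1n add1n addnS.
Qed.

Definition single S (f : R) : ext := [ffun S' => if S' == S then f else 0].

Fact single_is_linear S : linear (single S).
Proof. by move=> c f g; apply/ffunP => T; rewrite !ffunE; case: ifP; rewrite ?scaler0 ?addr0. Qed.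
HB.instance Definition _ S := GRing.isLinear.Build K R ext _ _ (single_is_linear S).

End KoszulChains.

Section Coordinates.
Variables (K : fieldType) (n p : nat) (j : int).
Local Notation R := {mpoly K[n]}.
Local Notation ext := {ffun {set 'I_p} -> R}.
Local Notation D := (`|j|.+1)%N.
Local Notation T := ({set 'I_p} * 'X_{1..n < D})%type.
Implicit Types (A : 'M[K]_(p, n)) (u v w : ext) (S : {set 'I_p}) (i : nat).

(** A basis chain satisfies [mdeg m + i = j], so degrees up to [|j|] suffice. As [T] does not depend
    on [i], the matrices of consecutive homological degrees share their rows and columns. *)
Definition cells i : pred T := fun t => (#|t.1| == i) && ((mdeg t.2 + i)%:Z == j).

Definition coords u : 'rV[K]_#|{: T}| := fam_row (fun t : T => (u t.1)@_(t.2)).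

Fact coords_is_linear : linear coords.
Proof. by move=> c u v; apply/rowP => k; rewrite !mxE !ffunE mcoeffD mcoeffZ. Qed.
HB.instance Definition _ := GRing.isLinear.Build K ext 'rV[K]_#|{: T}| _ coords coords_is_linear.

Lemma chain_deg i u S m : koszul_chain i j u -> m \in msupp (u S) -> (mdeg m < D)%N.
Proof. by move=> /koszul_chainP H /H[_ <-]; rewrite absz_nat ltnS leq_addr. Qed.

Lemma coords_inj i u v : koszul_chain i j u -> koszul_chain i j v -> coords u = coords v -> u = v.
Proof.
move=> hu hv e; apply/ffunP => S; apply/mpolyP => m.
have [lt|ge] := ltnP (mdeg m) D.
  have /rowP/(_ (enum_rank ((S, BMultinom lt) : T))) := e.
  by rewrite !mxE enum_rankK.
have out w : koszul_chain i j w -> (w S)@_m = 0.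
  by move=> hw; apply: memN_msupp_eq0; apply: contraL ge => /(chain_deg hw); rewrite ltnNge.
by rewrite !out.
Qed.

Lemma coords_cells i u (t : T) : koszul_chain i j u -> (u t.1)@_(t.2) != 0 -> t \in cells i.
Proof.
move=> /koszul_chainP H; rewrite -mcoeff_msupp => /H[e1 e2].
by rewrite unfold_in /cells e1 eqxx e2 eqxx.
Qed.

Lemma single_chain i (t : T) : t \in cells i -> koszul_chain i j (single t.1 'X_[K, t.2]).
Proof.
move=> /andP[/eqP e1 /eqP e2]; apply/koszul_chainP => S m; rewrite ffunE.
case: eqP => [->|_]; last by rewrite msupp0.
by rewrite msuppX inE => /eqP->.
Qed.

Lemma coords_ext i u v : koszul_chain i j u -> koszul_chain i j v ->
  (forall t : T, (u t.1)@_(t.2) = (v t.1)@_(t.2)) -> u = v.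
Proof. by move=> hu hv H; apply: (coords_inj hu hv); apply/rowP => k; rewrite !mxE. Qed.

Lemma chain_expand i u : koszul_chain i j u ->
  u = \sum_(t : T | t \in cells i) (u t.1)@_(t.2) *: single t.1 'X_[t.2].
Proof.
move=> hu; apply: (coords_ext hu).
  by apply: koszul_chain_sum => t; exact: single_chain.
move=> t; rewrite sum_ffunE raddf_sum /=.
have [ti|ti] := boolP (t \in cells i).
  rewrite (bigD1 t) //= big1 ?addr0.
    by rewrite !ffunE eqxx mcoeffZ mcoeffX eqxx mulr1.
  move=> s /andP[_ st]; rewrite !ffunE; case: eqP => [e1|_]; last by rewrite scaler0 mcoeff0.
  rewrite mcoeffZ mcoeffX; case: eqP => [e2|_]; last by rewrite mulr0.
  by case/eqP: st; case: s t e1 e2 {ti} => [a b] [a' b'] /= -> /val_inj ->.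
rewrite big1; first by apply/eqP; apply: contraNT ti; exact: coords_cells.
move=> s si; rewrite !ffunE; case: eqP => [e1|_]; last by rewrite scaler0 mcoeff0.
rewrite mcoeffZ mcoeffX; case: eqP => [e2|_]; last by rewrite mulr0.
by case/negP: ti; case: s t e1 e2 si => [a b] [a' b'] /= -> /val_inj ->.
Qed.

(** Rows outside [cells i] are padded with zeros, which does not change the rank. *)
Definition diff_fam A i (t b : T) : K :=
  if t \in cells i then (koszul_diff A (single t.1 'X_[t.2]) b.1)@_(b.2) else 0.

Definition ideal_fam (E : pred 'X_{1..n}) (f : 'X_{1..n} -> R) i (t b : T) : K :=
  if (t \in cells i) && E t.2 then (single t.1 (f t.2) b.1)@_(b.2) else 0.

Definition sum_fam A E f i i' (t : T + T) (b : T) : K :=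
  match t with inl t => diff_fam A i t b | inr t => ideal_fam E f i' t b end.

Lemma sum_fam_mx A E f i i' :
  (fam_mx (sum_fam A E f i i') :=: fam_mx (diff_fam A i) + fam_mx (ideal_fam E f i'))%MS.
Proof.
apply/eqmxP/andP; split.
  apply/row_subP => k; rewrite row_fam.
  case: (enum_val k) => t.
    by apply: submx_trans (addsmxSl _ _); apply: fam_sub_row (submx_refl _) t.
  by apply: submx_trans (addsmxSr _ _); apply: fam_sub_row (submx_refl _) t.
rewrite addsmx_sub; apply/andP; split; apply/row_subP => k; rewrite row_fam.
  exact: (fam_sub_row (submx_refl _) (inl (enum_val k) : T + T)).
exact: (fam_sub_row (submx_refl _) (inr (enum_val k) : T + T)).
Qed.

Lemma coords_diff A i u : koszul_chain i j u ->
  coords (koszul_diff A u) = coords u *m fam_mx (diff_fam A i).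
Proof.
move=> hu; rewrite [in LHS](chain_expand hu) !raddf_sum /= mulmx_sum_row.
rewrite (reindex _ (onW_bij _ (enum_val_bij T))) big_mkcond /=; apply: eq_bigr => k _.
rewrite mxE row_fam; case: ifP => tk; last first.
  apply/rowP => b; rewrite !mxE (_ : _@__ = 0) ?mul0r //.
  by apply/eqP; apply: contraFT tk; exact: coords_cells.
rewrite !linearZ /=; congr (_ *: _); apply/rowP => b; rewrite !mxE /diff_fam tk //.
Qed.

Definition cell_fam i (t b : T) : K := if t \in cells i then (b == t)%:R else 0.

Lemma cell_fam_rank i : fam_rank (cell_fam i) = #|cells i|.
Proof.
apply: fam_rank_free => [t b ti|c H t ti]; first by rewrite /cell_fam (negbTE ti).
have := H t; rewrite (bigD1 t) //= big1 ?addr0 /cell_fam ?ti ?eqxx ?mulr1 //.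
by move=> s /andP[si st]; rewrite si eq_sym (negbTE st) mulr0.
Qed.

Lemma sub_cell_fam i (v : 'rV_#|{: T}|) :
  (v <= fam_mx (cell_fam i))%MS <-> exists2 u, koszul_chain i j u & coords u = v.
Proof.
split=> [/submxP[c ->]|[u hu <-]].
  exists (\sum_(t | t \in cells i) c 0 (enum_rank t) *: single t.1 'X_[t.2]).
    by apply: koszul_chain_sum => t; exact: single_chain.
  rewrite raddf_sum /= mulmx_sum_row [RHS](reindex _ (onW_bij _ (enum_rank_bij T))).
  rewrite big_mkcond /=; apply: eq_bigr => t _; rewrite row_fam enum_rankK linearZ /=.
  case: ifP => ti; last first.
    rewrite (_ : fam_row _ = 0) ?scaler0 //; apply/rowP => b.
    by rewrite !mxE /cell_fam ti.
  congr (_ *: _); apply/rowP => b; rewrite !mxE ffunE /cell_fam ti.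
  case: (enum_val b) t {ti} => [S m] [S' m'] /=; rewrite -pair_eqE /pair_eq /= -val_eqE /=.
  by case: eqP => _; rewrite ?mcoeff0 // mcoeffX eq_sym.
apply/sub_famP; exists (fun t : T => (u t.1)@_(t.2)) => b.
rewrite (bigD1 b) //= big1 ?addr0 /cell_fam => [|t tb]; last first.
  by rewrite eq_sym (negbTE tb); case: ifP; rewrite mulr0.
case: ifP => bi; first by rewrite eqxx mulr1.
by rewrite mulr0; apply/eqP; apply: contraFT bi; exact: coords_cells.
Qed.

Section Ideal.
Variables (J : set R) (E : pred 'X_{1..n}) (f : 'X_{1..n} -> R).
Hypothesis K0 : [pchar K] =i pred0.
Hypothesis idJ : ideal J.

(** Only spanning is recorded; independence is drawn from leading monomials in [ideal_fam_rank].
    Indexing by monomials lets an ideal and its initial ideal have bases over the same set [E]. *)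
Definition graded_basis :=
  (forall m, E m -> J (f m) /\ f m \is (mdeg m).-homog) /\
  (forall d k g, (d < k)%N -> J g -> g \is d.-homog ->
     exists c : 'X_{1..n} -> K,
       g = \sum_(m : 'X_{1..n < k} | (mdeg m == d) && E m) c m *: f m).

Hypothesis gb : graded_basis.

Lemma ideal_sum (I : Type) (r : seq I) (P : pred I) (F : I -> R) (c : I -> K) :
  (forall x, P x -> J (F x)) -> J (\sum_(x <- r | P x) c x *: F x).
Proof.
case: idJ => J0 JD JM H; elim: r => [|x r IH]; first by rewrite big_nil.
rewrite big_cons; case: ifP => // /H Fx; apply: JD => //.
by rewrite -mul_mpolyC; apply: JM.
Qed.

Lemma coords_in_diff A u : coords_in J u -> coords_in J (koszul_diff A u).
Proof.
case: idJ => J0 JD JM hu S; rewrite ffunE; apply: big_ind => // s _.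
by apply: JM.
Qed.

Lemma ideal_fam_chain i (t : T) : t \in cells i -> E t.2 -> koszul_chain i j (single t.1 (f t.2)).
Proof.
move=> /andP[/eqP e1 /eqP e2] Et; apply/koszul_chainP => S m; rewrite ffunE.
case: eqP => [->|_]; last by rewrite msupp0.
by have [_ /dhomogP h] := gb.1 _ Et; move=> /h /= ->.
Qed.

Lemma coords_in_fam i w : koszul_chain i j w ->
  coords_in J w <-> (coords w <= fam_mx (ideal_fam E f i))%MS.
Proof.
move=> hw; split.
- move=> Jw.
  have ex S : exists c : 'X_{1..n} -> K,
     w S = \sum_(m : 'X_{1..n < D} | ((S, m) \in cells i) && E m) c m *: f m.
    have [Si|Si] := eqVneq #|S| i; last first.
      exists (fun=> 0); rewrite big1 => [|m _]; last by rewrite scale0r.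
      by have := hw S; rewrite (negbTE Si).
    case e : (msupp (w S)) => [|m0 s].
      by exists (fun=> 0); rewrite big1 => [|m _]; [apply: msuppnil0|rewrite scale0r].
    have m0w : m0 \in msupp (w S) by rewrite e mem_head.
    have [_ dj] := (koszul_chainP i j w).1 hw S m0 m0w.
    have hh : w S \is (mdeg m0).-homog.
      apply/dhomogP => m /((koszul_chainP i j w).1 hw S)[_]; rewrite -dj => -[] /eqP.
      by rewrite eqn_add2r => /eqP.
    have [c cE] := gb.2 _ D _ (chain_deg hw m0w) (Jw S) hh.
    exists c; rewrite [LHS]cE; apply: eq_bigl => m; congr (_ && _).
    by rewrite unfold_in /cells /= Si eqxx -(eqn_add2r i) -eqz_nat dj.
  have [c cE] := choice ex; apply/sub_famP; exists (fun t : T => c t.1 t.2) => -[S b] /=.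
  rewrite [LHS](congr1 (mcoeff b) (cE S)) raddf_sum /=.
  pose G S' (m : 'X_{1..n < D}) := c S' m * ideal_fam E f i (S', m) (S, b).
  rewrite (eq_bigr (fun t : T => G t.1 t.2)); last by case.
  rewrite -(pair_bigA _ G) (bigD1 S) //= [X in _ = _ + X]big1 ?addr0 => [|S' ne].
    rewrite big_mkcond /=; apply: eq_bigr => m _; rewrite /G /ideal_fam ffunE eqxx.
    by case: ifP; rewrite ?mulr0 // mcoeffZ.
  rewrite big1 // => m _; rewrite /G /ideal_fam ffunE eq_sym (negbTE ne) mcoeff0.
  by case: ifP; rewrite mulr0.
- case/sub_famP => c cE S.
  have -> : w = \sum_(t : T | (t \in cells i) && E t.2) c t *: single t.1 (f t.2).
    apply: (coords_ext hw).
      by apply: koszul_chain_sum => t /andP[]; exact: ideal_fam_chain.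
    move=> b; rewrite cE sum_ffunE raddf_sum [RHS]big_mkcond /=; apply: eq_bigr => t _.
    by rewrite /ideal_fam; case: ifP; rewrite ?mul0r ?mulr0 // !ffunE mcoeffZ.
  rewrite sum_ffunE; under eq_bigr do rewrite ffunE.
  apply: ideal_sum => t /andP[_ /gb.1[Jf _]]; rewrite ffunE.
  by case: ifP => // _; case: idJ.
Qed.

Lemma mul_cell_diff A i : fam_mx (cell_fam i) *m fam_mx (diff_fam A i) = fam_mx (diff_fam A i).
Proof.
apply/row_matrixP => k; rewrite row_mul !row_fam.
have [ti|ti] := boolP (enum_val k \in cells i).
  have -> : fam_row (cell_fam i (enum_val k)) = coords (single (enum_val k).1 'X_[(enum_val k).2]).
    apply/rowP => b; rewrite !mxE ffunE /cell_fam ti.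
    case: (enum_val b) (enum_val k) {ti} => [S m] [S' m'] /=; rewrite -pair_eqE /pair_eq /= -val_eqE /=.
    by case: eqP => _; rewrite ?mcoeff0 // mcoeffX eq_sym.
  by rewrite -coords_diff; [|exact: single_chain]; apply/rowP => b; rewrite !mxE /diff_fam ti.
rewrite (_ : fam_row _ = 0) ?mul0mx; last by apply/rowP => b; rewrite !mxE /cell_fam (negbTE ti).
by apply/rowP => b; rewrite !mxE /diff_fam (negbTE ti).
Qed.

Lemma sub_kermx_coker a b (X : 'M[K]_(a, #|{: T}|)) (Y : 'M[K]_(#|{: T}|, #|{: T}|)) (Q : 'M[K]_(b, #|{: T}|)) :
  (X <= kermx (Y *m cokermx Q))%MS = (X *m Y <= Q)%MS.
Proof. by rewrite sub_kermx mulmxA submxE. Qed.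

(** Boundaries plus $J$ have the first rank. Cycles are the kernel of the differential modulo $J$,
    whose rank is that of the image plus $J$, minus that of $J$. Hence larger ranks mean smaller
    homology. For [i = 0] the differential is zero and the terms with [i.-1] cancel. *)
Lemma koszul_rank A i :
  (koszul_homology_dim A J i j + fam_rank (sum_fam A E f i.+1 i)
     + fam_rank (sum_fam A E f i i.-1)
   = #|cells i| + fam_rank (ideal_fam E f i.-1))%N.
Proof.
pose P := fam_mx (cell_fam i); pose Dm := fam_mx (diff_fam A i).
pose Jm := fam_mx (ideal_fam E f i.-1).
pose Zm := (P :&: kermx (Dm *m cokermx Jm))%MS.
pose Bm := fam_mx (sum_fam A E f i.+1 i).
have ZP u : koszul_chain i j u -> koszul_cycles A J i j u <-> (coords u <= Zm)%MS.
  move=> hu; rewrite sub_capmx sub_kermx_coker -coords_diff //.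
  have -> : (coords u <= P)%MS by apply/sub_cell_fam; exists u.
  have hd := coords_in_fam (koszul_diff_chain A hu).
  by split=> [[_ h]|h]; [apply: hd.1|split=> //; apply: hd.2].
have BP u : koszul_chain i j u -> koszul_boundaries A J i j u <-> (coords u <= Bm)%MS.
  move=> hu; rewrite sum_fam_mx; split.
    case=> _ [v hv Juv]; rewrite -[u](subrK (koszul_diff A v)) addrC raddfD /=.
    have hd : koszul_chain i j (koszul_diff A v) := koszul_diff_chain A hv.
    rewrite addmx_sub_adds //; first by rewrite (coords_diff A hv) submxMl.
    by apply/coords_in_fam => //; exact: koszul_chainB.
  case/sub_addsmxP => -[x y] /= e; split=> //.
  have /sub_cell_fam[v hv ve] : (x *m fam_mx (cell_fam i.+1) <= fam_mx (cell_fam i.+1))%MS by rewrite submxMl.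
  have hd : koszul_chain i j (koszul_diff A v) := koszul_diff_chain A hv.
  exists v => //; apply: (coords_in_fam (koszul_chainB hu hd)).2.
  by rewrite raddfB /= e (coords_diff A hv) ve -mulmxA mul_cell_diff addrC addKr submxMl.
have BmP : (Bm <= P)%MS.
  rewrite sum_fam_mx addsmx_sub; apply/andP; split; apply/row_subP => k; rewrite row_fam; apply/sub_cell_fam.
    have [ti|ti] := boolP (enum_val k \in cells i.+1).
      exists (koszul_diff A (single (enum_val k).1 'X_[(enum_val k).2])).
        exact: (koszul_diff_chain A (single_chain ti)).
      by apply/rowP => b; rewrite !mxE /diff_fam ti.
    exists 0; first exact: koszul_chain0.
    by rewrite raddf0; apply/rowP => b; rewrite !mxE /diff_fam (negbTE ti).
  have [/andP[ti Et]|ti] := boolP ((enum_val k \in cells i) && E (enum_val k).2).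
    exists (single (enum_val k).1 (f (enum_val k).2)); first exact: ideal_fam_chain.
    by apply/rowP => b; rewrite !mxE /ideal_fam ti Et.
  exists 0; first exact: koszul_chain0.
  by rewrite raddf0; apply/rowP => b; rewrite !mxE /ideal_fam (negbTE ti).
have BZ : (Bm <= Zm)%MS.
  apply/row_subP => k; have kB := row_sub k Bm.
  have /sub_cell_fam[u hu ue] := submx_trans kB BmP.
  rewrite -ue in kB *; move/(BP _ hu): kB => [_ [v hv Juv]]; apply/(ZP _ hu); split=> //.
  rewrite -[u](subrK (koszul_diff A v)) raddfD /= koszul_diffK // addr0.
  exact: coords_in_diff.
have surj (x : 'rV_#|{: T}|) : (x <= Zm)%MS -> exists2 u, koszul_chain i j u & coords u = x.
  by rewrite sub_capmx => /andP[/sub_cell_fam].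
have Clin d (c : 'I_d -> K) (e : 'I_d -> ext) :
    (forall k, koszul_chain i j (e k)) -> koszul_chain i j (\sum_k c k *: e k).
  by move=> h; apply: koszul_chain_sum => k _.
have CB u v := @koszul_chainB K n p i j u v.
have ZC : koszul_cycles A J i j `<=` koszul_chain i j by move=> u [].
have h := quot_dimP ZC Clin CB ZP BP surj BZ.
rewrite -/(koszul_homology_dim A J i j) in h.
have -> : fam_rank (sum_fam A E f i.+1 i) = \rank Bm by [].
rewrite h.
have r1 : (\rank (Dm *m cokermx Jm) + \rank Zm)%N = #|cells i|.
  by rewrite -cell_fam_rank /fam_rank -/P -(mxrank_mul_ker P (Dm *m cokermx Jm)) mulmxA mul_cell_diff.
have r2 := mxrank_mul_ker Dm (cokermx Jm).
have r3 := mxrank_sum_cap Dm Jm.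
have r4 : \rank (Dm :&: kermx (cokermx Jm)) = \rank (Dm :&: Jm).
  apply/eqmx_rank/eqmxP; apply/cap_eqmx => //; apply/eqmxP/andP; split.
    by rewrite submxE mulmx_ker.
  by rewrite sub_kermx -submxE.
have -> : fam_rank (sum_fam A E f i i.-1) = \rank (Dm + Jm)%MS by rewrite /fam_rank sum_fam_mx.
rewrite -r1 /fam_rank -/Jm; rewrite r4 in r2.
have -> : \rank (Dm + Jm)%MS = (\rank (Dm *m cokermx Jm) + \rank Jm)%N.
  by apply: (@addIn (\rank (Dm :&: Jm)%MS)); rewrite r3 -r2 addnAC.
by rewrite addnA (addnC (\rank Zm)).
Qed.

End Ideal.

End Coordinates.

(** * Monomial ideals, initial ideals and the action of GL *)

Section MonomialIdeals.
Variables (K : fieldType) (n : nat).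
Local Notation R := {mpoly K[n]}.
Implicit Types (E : pred 'X_{1..n}).

Definition mono_ideal E : set R := [set f | {subset msupp f <= E}].

Definition up_closed E := forall m m', E m -> E (m + m')%MM.

Lemma mono_idealX E m : E m -> mono_ideal E 'X_[K, m].
Proof. by move=> Em m'; rewrite msuppX inE => /eqP->. Qed.

Lemma mono_ideal_ideal E : up_closed E -> ideal (mono_ideal E).
Proof.
move=> up; split.
- by move=> m; rewrite msupp0.
- by move=> f g hf hg m /msuppD_le; rewrite mem_cat => /orP[/hf|/hg].
- move=> f g hg m /msuppM_le/allpairsP[[m1 m2] /= [_ h2 ->]].
  by rewrite addmC; apply: up; exact: hg.
Qed.

Lemma mcoeff_pihomog d (f : R) m : (pihomog mdeg d f)@_m = if mdeg m == d then f@_m else 0.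
Proof.
rewrite (pihomogwE _ _ (leq_maxl (msize f) (mdeg m).+1)) raddf_sum /=.
have lt : (mdeg m < maxn (msize f) (mdeg m).+1)%N by rewrite leq_max ltnSn orbT.
case: ifP => md.
  rewrite (bigD1 (BMultinom lt)) //= big1 ?addr0 => [|m' /andP[_ ne]].
    by rewrite mcoeffZ mcoeffX eqxx mulr1.
  by rewrite mcoeffZ mcoeffX; case: eqP => [e|]; rewrite ?mulr0 //; case/eqP: ne; apply: val_inj.
rewrite big1 // => m' /eqP md'; rewrite mcoeffZ mcoeffX; case: eqP => [e|]; rewrite ?mulr0 //.
by rewrite -e md' eqxx in md.
Qed.

Lemma homog_expand d k (g : R) : (d < k)%N -> g \is d.-homog ->
  g = \sum_(m : 'X_{1..n < k} | mdeg m == d) g@_m *: 'X_[m].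
Proof.
move=> dk hg; rewrite -{1}(pihomog_dE hg); apply: pihomogwE.
rewrite msizeE; apply/bigmax_leqP_seq => m mg _.
by have /dhomogP/(_ m mg) /= -> := hg.
Qed.

Lemma mono_basis E : graded_basis (mono_ideal E) E (fun m => 'X_[K, m]).
Proof.
split=> [m Em|d k g dk Jg hg]; first by split; [exact: mono_idealX|rewrite dhomogX /=].
exists (fun m => g@_m); rewrite {1}(homog_expand dk hg) big_mkcondr /=.
apply: eq_bigr => m _; case: ifP => // /negbT Em.
by rewrite (memN_msupp_eq0 (contra (Jg m) _)) ?scale0r.
Qed.

End MonomialIdeals.

Section InitialMonomials.
Variables (K : fieldType) (n : nat) (tau : rel 'X_{1..n}) (J : set {mpoly K[n]}).
Local Notation R := {mpoly K[n]}.
Hypothesis tau_order : term_order tau.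
Hypothesis homJ : homogeneous_ideal J.

Definition initial_monomials : pred 'X_{1..n} :=
  fun m => `[< exists2 f, J f & initial_monomial tau f m >].

Let idJ : ideal J := homJ.1.

Lemma idealZ (c : K) f : J f -> J (c *: f).
Proof. by move=> Jf; rewrite -mul_mpolyC; case: idJ => _ _; apply. Qed.

Definition lead_form m (f : R) :=
  [/\ J f, f \is (mdeg m).-homog, f@_m = 1 & tau_le tau f m].

(** The component of [f] of degree [mdeg m] stays in [J] and still has leading monomial [m], even if
    [tau] does not refine the degree; scaling makes it monic. *)
Lemma initial_monomialsP m : reflect (exists f, lead_form m f) (initial_monomials m).
Proof.
apply: (iffP idP) => [/asboolP[f Jf [mf le]]|[f [Jf hf f1 le]]]; last first.
  by apply/asboolP; exists f => //; split=> //; rewrite mcoeff_msupp f1 oner_neq0.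
exists ((f@_m)^-1 *: pihomog mdeg (mdeg m) f); split.
- by apply: idealZ; exact: homJ.2.
- by apply: rpredZ; exact: pihomogP.
- by rewrite mcoeffZ mcoeff_pihomog eqxx mulVf // -mcoeff_msupp.
- move=> m' /msuppZ_le; rewrite mcoeff_msupp mcoeff_pihomog; case: ifP; rewrite ?eqxx // => _.
  by rewrite -mcoeff_msupp; exact: le.
Qed.

Definition lead_basis m : R := xget 0 (lead_form m).

Lemma lead_basisP m : initial_monomials m -> lead_form m (lead_basis m).
Proof. by move=> /initial_monomialsP h; rewrite /lead_basis; apply: xgetPex. Qed.

Lemma initial_exists (f : R) : J f -> f != 0 ->
  exists2 m, m \in msupp f & initial_monomials m.
Proof.
move=> Jf f0; case: tau_order => _ tr to _ _.
have [|m mf h] := @tau_max _ tau (msupp f) tr to; first by rewrite msupp_eq0.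
by exists m => //; apply/asboolP; exists f.
Qed.

(** Division by linear algebra: the coefficients of the lead forms at initial monomials form a
    triangular matrix of full rank, so a combination of lead forms matches [g] at all of them. The
    remainder lies in [J] and has no initial monomial in its support, hence is zero. *)
Lemma initial_basis : graded_basis J initial_monomials lead_basis.
Proof.
split=> [m /lead_basisP[] //|d k g dk Jg hg].
case: tau_order => an tr to _ _.
pose X : pred 'X_{1..n < k} := fun m => (mdeg m == d) && initial_monomials m.
pose F (m b : 'X_{1..n < k}) := if X m && X b then (lead_basis m)@_b else 0.
pose M (m b : 'X_{1..n < k}) : K := if X m then (b == m)%:R else 0.
have rF : fam_rank F = #|X|.
  apply: (@fam_rank_triangular _ _ _ _ F X id (@bmnm n k) tau) => //.
  - by move=> t b Xt; have /negbTE {}Xt : ~~ X t := Xt; rewrite /F Xt.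
  - move=> t Xt; have {}Xt : X t := Xt; rewrite /F Xt /=.
    by have /andP[_ /lead_basisP[_ _ -> _]] := Xt; exact: oner_neq0.
  - move=> s t Xs Xt; have {}Xs : X s := Xs; have {}Xt : X t := Xt; rewrite /F Xs Xt /= -mcoeff_msupp.
    have /andP[_ /lead_basisP[_ _ _ h]] := Xs => /h ts st.
    by apply: val_inj; apply: an; rewrite ts st.
have rM : fam_rank M = #|X|.
  apply: fam_rank_free => [t b Xt|c H t Xt].
    by have /negbTE {}Xt : ~~ X t := Xt; rewrite /M Xt.
  have {}Xt : X t := Xt; have := H t; rewrite (bigD1 t) //= big1 ?addr0 /M ?Xt ?eqxx ?mulr1 //.
  by move=> s /andP[Xs st]; have {}Xs : X s := Xs; rewrite Xs eq_sym (negbTE st) mulr0.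
have subX (x : 'X_{1..n < k} -> K) : (fam_row (fun b => if X b then x b else 0%R) <= fam_mx M)%MS.
  apply/sub_famP; exists x => b; rewrite (bigD1 b) //= big1 ?addr0 /M.
    by rewrite eqxx; case: ifP; rewrite ?mulr0 ?mulr1.
  by move=> t tb; rewrite eq_sym (negbTE tb); case: ifP; rewrite mulr0.
have FM : (fam_mx F <= fam_mx M)%MS.
  apply/row_subP => i; rewrite row_fam; set t := enum_val i.
  rewrite (_ : fam_row _ = fam_row (fun b => if X b then (if X t then (lead_basis t)@_b else 0) else 0)) //.
  by apply/rowP => b; rewrite !mxE /F; case: (X t); case: (X _).
have MF : (fam_mx M <= fam_mx F)%MS.
  by rewrite -(mxrank_leqif_sup FM).2 -/(fam_rank F) -/(fam_rank M) rF rM.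
have /sub_famP[c cE] := submx_trans (subX (fun b => g@_b)) MF.
pose r := g - \sum_(m | X m) c m *: lead_basis m.
have Jr : J r.
  case: (idJ) => J0 JD _; apply: JD => //; rewrite -scaleN1r; apply: idealZ.
  by apply: ideal_sum => // m /andP[_ /lead_basisP[]].
have hr : r \is d.-homog.
  by apply: rpredB => //; apply: rpred_sum => m /andP[/eqP <- /lead_basisP[_ h _ _]]; apply: rpredZ.
have rX (m : 'X_{1..n < k}) : X m -> r@_m = 0.
  move=> Xm; rewrite mcoeffB raddf_sum /=; have := cE m; rewrite Xm => ->.
  apply/eqP; rewrite subr_eq0; apply/eqP; rewrite [RHS]big_mkcond /=; apply: eq_bigr => t _.
  by rewrite /F Xm andbT; case: ifP; rewrite ?mulr0 // mcoeffZ.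
have r0 : r = 0.
  apply/eqP/negPn/negP => r0; have [m mr im] := initial_exists Jr r0.
  have md : mdeg m = d by have /dhomogP/(_ m mr) := hr.
  have mk : (mdeg m < k)%N by rewrite md.
  have := @rX (BMultinom mk); rewrite /X /= md eqxx im => /(_ isT).
  by move/eqP; apply/negP; rewrite -mcoeff_msupp.
exists (fun m => if insub m is Some m' then c m' else 0).
apply/eqP; rewrite -subr_eq0 -[X in _ == X]r0; apply/eqP; congr (_ - _).
by apply: eq_bigr => m _; rewrite valK.
Qed.

Lemma initial_up_closed : up_closed initial_monomials.
Proof.
move=> m m' /initial_monomialsP[f [Jf _ f1 le]]; apply/asboolP; exists (f * 'X_[m']).
  by rewrite mulrC; case: idJ => _ _; apply.
split; first by rewrite mcoeff_msupp addmC mcoeffMX f1 oner_neq0.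
move=> m2; rewrite (perm_mem (msuppMX _ _)) => /mapP[m3 /le h ->].
by case: tau_order => _ _ _ _ ad; rewrite (addmC m m'); apply: ad.
Qed.

Lemma initial_idealE : initial_ideal tau J = mono_ideal initial_monomials :> set R.
Proof.
apply/seteqP; split=> f.
  move=> H; apply: H; first by apply: mono_ideal_ideal; exact: initial_up_closed.
  move=> _ [g [m [Jg gm ->]]]; apply: mono_idealX.
  by apply/asboolP; exists g.
move=> H J' idJ' sub; rewrite (mpolyE f).
case: (idJ') => J0 JD JM; rewrite big_seq; apply: ideal_sum => // m /H.
move=> /asboolP[g Jg gm]; apply: sub.
by exists g, m.
Qed.

End InitialMonomials.

(** * Isomorphisms of Koszul complexes and the action of GL *)

Section Transport.
Variables (K : fieldType) (n p : nat).
Local Notation R := {mpoly K[n]}.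
Local Notation ext := {ffun {set 'I_p} -> R}.

Lemma quot_dim_transport (V : lmodType K) (Z B Z' B' : set V) (psi : {linear V -> V}) :
  (forall z, exists u, psi u = z) ->
  (forall u, Z u <-> Z' (psi u)) -> (forall u, B u <-> B' (psi u)) ->
  quot_dim Z B = quot_dim Z' B'.
Proof.
move=> sj hZ hB; rewrite /quot_dim; congr (xget _ _); apply/seteqP; split=> d [e [eZ eB eS]].
- exists (psi \o e); split=> [k|c H|z Zz].
  + by apply/hZ/eZ.
  + apply: eB; apply/hB; congr B': H; rewrite raddf_sum /=.
    by apply: eq_bigr => k _; rewrite linearZ.
  + have [u uz] := sj z; rewrite -uz in Zz *; have [c Bc] := eS u ((hZ u).2 Zz).
    exists c; move/hB: Bc; congr B'; rewrite raddfB raddf_sum /=; congr (_ - _).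
    by apply: eq_bigr => k _; rewrite linearZ.
- have [e' e'P] := choice (fun k => sj (e k)).
  have eE c : psi (\sum_k c k *: e' k) = \sum_k c k *: e k.
    by rewrite raddf_sum; apply: eq_bigr => k _; rewrite /= linearZ /= e'P.
  exists e'; split=> [k|c H|z Zz].
  + by apply/hZ; rewrite e'P; apply: eZ.
  + by apply: eB; rewrite -eE; apply/hB.
  + have [c Bc] := eS (psi z) ((hZ z).1 Zz); exists c; apply/hB.
    by rewrite raddfB /= eE.
Qed.

Lemma koszul_transport (A A' : 'M[K]_(p, n)) (J J' : set R) (psi psi' : {linear ext -> ext}) :
  cancel psi psi' -> cancel psi' psi ->
  (forall i j u, koszul_chain i j u -> koszul_chain i j (psi u)) ->
  (forall i j u, koszul_chain i j u -> koszul_chain i j (psi' u)) ->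
  (forall u, coords_in J u -> coords_in J' (psi u)) ->
  (forall u, coords_in J' u -> coords_in J (psi' u)) ->
  (forall u, koszul_diff A' (psi u) = psi (koszul_diff A u)) ->
  forall i j, koszul_homology_dim A J i j = koszul_homology_dim A' J' i j.
Proof.
move=> k1 k2 c1 c2 J1 J2 dpsi i j.
have cP i' u : koszul_chain i' j u <-> koszul_chain i' j (psi u).
  by split=> [|/c2]; [exact: c1|rewrite k1].
have JP u : coords_in J u <-> coords_in J' (psi u).
  by split=> [|/J2]; [exact: J1|rewrite k1].
apply: (@quot_dim_transport _ _ _ _ _ psi) => [z|u|u].
- by exists (psi' z).
- split=> -[h1 h2]; split; [exact: c1| |exact: (cP _ _).2|].
    by rewrite dpsi; apply: (JP _).1.
  by apply: (JP _).2; rewrite -dpsi.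
- split=> -[h1 [v hv Jv]]; split; [exact: c1| |exact: (cP _ _).2|].
    by exists (psi v); [exact: c1|rewrite dpsi -raddfB; apply: (JP _).1].
  exists (psi' v); first exact: c2.
  by apply: (JP _).2; rewrite raddfB /= -dpsi k2.
Qed.

End Transport.

Section GLAction.
Variables (K : fieldType) (n : nat).
Local Notation R := {mpoly K[n]}.
Implicit Types (g h : 'M[K]_n) (f : R) (J : set R).

Definition gl_form g i : R := \sum_(k < n) g k i *: 'X_k.

Fact gl_act_is_linear g : linear (gl_act g).
Proof. by move=> c f f'; rewrite /gl_act linearP. Qed.
HB.instance Definition _ g := GRing.isLinear.Build K R R _ (gl_act g) (gl_act_is_linear g).

Fact gl_act_is_multiplicative g : monoid_morphism (gl_act g).
Proof. by split=> [|f f']; rewrite /gl_act ?rmorph1 ?rmorphM. Qed.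
HB.instance Definition _ g := GRing.isMonoidMorphism.Build R R (gl_act g)
  (gl_act_is_multiplicative g).

Lemma gl_actZ g c f : gl_act g (c *: f) = c *: gl_act g f.
Proof. exact: linearZ. Qed.

Lemma gl_actX g m : gl_act g 'X_[m] = \prod_(i < n) gl_form g i ^+ m i.
Proof. by rewrite /gl_act comp_mpolyX; apply: eq_bigr => i _; rewrite tnth_mktuple. Qed.

Lemma gl_actXU g i : gl_act g 'X_i = gl_form g i.
Proof.
rewrite gl_actX (bigD1 i) //= mnm1E eqxx expr1 big1 ?mulr1 // => k ki.
by rewrite mnm1E eq_sym (negbTE ki).
Qed.

Lemma gl_act_form g h i : gl_act g (gl_form h i) = gl_form (g *m h) i.
Proof.
rewrite /gl_form raddf_sum /=.
transitivity (\sum_k \sum_l (g l k * h k i) *: 'X_l : R).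
  apply: eq_bigr => k _; rewrite linearZ /= gl_actXU scaler_sumr.
  by apply: eq_bigr => l _; rewrite scalerA mulrC.
rewrite exchange_big; apply: eq_bigr => l _; rewrite -scaler_suml; congr (_ *: _).
by rewrite mxE.
Qed.

Lemma gl_actE g f : gl_act g f = \sum_(m <- msupp f) f@_m *: gl_act g 'X_[m].
Proof. exact: comp_mpolyEX. Qed.

Lemma gl_actM g h f : gl_act g (gl_act h f) = gl_act (g *m h) f.
Proof.
rewrite (gl_actE h) (gl_actE (g *m h)) raddf_sum /=; apply: eq_bigr => m _.
rewrite linearZ /=; congr (_ *: _).
rewrite !gl_actX rmorph_prod /=; apply: eq_bigr => i _.
by rewrite rmorphXn /= gl_act_form.
Qed.

Lemma gl_act1 f : gl_act 1%:M f = f.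
Proof.
rewrite -[RHS]comp_mpoly_id /gl_act; congr (_ \mPo _); apply: eq_from_tnth => i.
rewrite !tnth_mktuple (bigD1 i) //= big1 ?addr0 => [|k ki].
  by rewrite mxE eqxx scale1r.
by rewrite mxE (negbTE ki) scale0r.
Qed.

Lemma gl_actK g : g \in unitmx -> cancel (gl_act g) (gl_act (invmx g)).
Proof. by move=> u f; rewrite gl_actM mulVmx // gl_act1. Qed.

Lemma gl_actVK g : g \in unitmx -> cancel (gl_act (invmx g)) (gl_act g).
Proof. by move=> u f; rewrite gl_actM mulmxV // gl_act1. Qed.

Lemma gl_act_homog g d f : f \is d.-homog -> gl_act g f \is d.-homog.
Proof.
move=> hf; rewrite gl_actE big_seq; apply: rpred_sum => m mf.
apply: rpredZ; have /dhomogP/(_ m mf) /= <- := hf.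
rewrite gl_actX mdegE; elim/big_rec2: _ => [|i d' F _ IH]; first exact: dhomog1.
rewrite addnC mulrC; apply: dhomogM => //.
have h1 : gl_form g i \is 1.-homog.
  by apply: rpred_sum => k _; apply: rpredZ; rewrite dhomogX /= mdeg1.
by have := dhomogMn (m i) h1; rewrite mul1n.
Qed.

Lemma eq_linear_monomials (W : lmodType K) (L1 L2 : {linear R -> W}) :
  (forall m, L1 'X_[m] = L2 'X_[m]) -> L1 =1 L2.
Proof.
move=> H f; rewrite (mpolyE f) !linear_sum; apply: eq_bigr => m _.
by rewrite !linearZ H.
Qed.

Lemma gl_act_pihomog g d f : gl_act g (pihomog mdeg d f) = pihomog mdeg d (gl_act g f).
Proof.
apply: (@eq_linear_monomials _ (gl_act g \o pihomog mdeg d) (pihomog mdeg d \o gl_act g)) => m /=.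
have hm : gl_act g 'X_[m] \is (mdeg m).-homog by apply: gl_act_homog; rewrite dhomogX /=.
rewrite pihomogX; case: eqVneq => [<-|ne]; first by rewrite pihomog_dE.
by rewrite linear0 (pihomog_ne0 _ hm).
Qed.

Lemma gl_act_ideal g J : g \in unitmx -> homogeneous_ideal J ->
  homogeneous_ideal (gl_act g @` J).
Proof.
move=> u [[J0 JD JM] Jh]; split; first split.
- by exists 0 => //; exact: raddf0.
- by move=> _ _ [a Ja <-] [b Jb <-]; exists (a + b); [exact: JD|exact: raddfD].
- move=> a _ [b Jb <-]; exists (gl_act (invmx g) a * b); first exact: JM.
  by rewrite rmorphM /= gl_actVK.
- move=> _ d [f Jf <-]; exists (pihomog mdeg d f); first exact: Jh.
  exact: gl_act_pihomog.
Qed.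

Section Ext.
Variable p : nat.
Local Notation ext := {ffun {set 'I_p} -> R}.

Definition gl_ext g (u : ext) : ext := [ffun S => gl_act g (u S)].

Fact gl_ext_is_linear g : linear (gl_ext g).
Proof. by move=> c u v; apply/ffunP => S; rewrite !ffunE linearP. Qed.
HB.instance Definition _ g := GRing.isLinear.Build K ext ext _ _ (gl_ext_is_linear g).

Lemma gl_ext_chain g i j (u : ext) : koszul_chain i j u -> koszul_chain i j (gl_ext g u).
Proof.
move=> H S; rewrite ffunE; move: (H S); case: ifP => _; last by move->; rewrite raddf0.
by rewrite /graded_piece /=; case: (j - _) => [k|k] /=; [exact: gl_act_homog|move->; rewrite raddf0].
Qed.

(** A row of [A] is the coefficient vector of a form, while a column of [g] is the image of a
    variable; hence the transpose. *)
Lemma gl_lin_form g (A : 'M[K]_(p, n)) s : gl_act g (lin_form A s) = lin_form (A *m g^T) s.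
Proof.
rewrite /lin_form raddf_sum /=.
transitivity (\sum_k \sum_l (A s k * g l k) *: 'X_l : R).
  apply: eq_bigr => k _; rewrite linearZ /= gl_actXU scaler_sumr.
  by apply: eq_bigr => l _; rewrite scalerA.
rewrite exchange_big; apply: eq_bigr => l _; rewrite -scaler_suml; congr (_ *: _).
by rewrite mxE; apply: eq_bigr => k _; rewrite mxE.
Qed.

Lemma koszul_gl g (A : 'M[K]_(p, n)) J i j : g \in unitmx ->
  koszul_homology_dim A J i j = koszul_homology_dim (A *m g^T) (gl_act g @` J) i j.
Proof.
move=> u; apply: (@koszul_transport K n p _ _ _ _ (gl_ext g) (gl_ext (invmx g))).
- by move=> w; apply/ffunP => S; rewrite !ffunE gl_actK.
- by move=> w; apply/ffunP => S; rewrite !ffunE gl_actVK.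
- by move=> *; apply: gl_ext_chain.
- by move=> *; apply: gl_ext_chain.
- by move=> w H S; rewrite ffunE; exists (w S).
- by move=> w H S; rewrite ffunE; have [f Jf <-] := H S; rewrite gl_actK.
- move=> w; apply/ffunP => S; rewrite !ffunE raddf_sum /=; apply: eq_bigr => s _.
  by rewrite ffunE !rmorphM rmorphXn rmorphN1 /= gl_lin_form.
Qed.

(** The isomorphism is the operator $1+cN$ of [row_add_conj]. It respects the grading because $N$
    trades $e_s$ for $e_r$. *)
Lemma koszul_row_add (A : 'M[K]_(p, n)) J r s (c : K) i j : r != s -> ideal J ->
  koszul_homology_dim (\matrix_(k, l) (A k l + (if k == s then c * A r l else 0))) J i j =
  koszul_homology_dim A J i j.
Proof.
move=> rs [J0 JD JM].
have Zl c' : linear (fun u : ext => u + c' *: wedge r (contract s u)).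
  by move=> a u v; rewrite !linearP scalerDr addrACA.
pose F c' : {linear ext -> ext} := HB.pack (fun u : ext => u + c' *: wedge r (contract s u))
  (GRing.isLinear.Build K ext ext _ _ (Zl c')).
have FE c' u : F c' u = u + c' *: wedge r (contract s u) by [].
have NN (w : ext) : wedge r (contract s (wedge r (contract s w))) = 0.
  exact: wedge_contractK.
have FK c' : cancel (F c') (F (- c')).
  move=> u; rewrite !FE !raddfD /= linearZ /= linearZ /= NN !scaler0 addr0.
  by rewrite scaleNr addrK.
have Fch c' i' j' u : koszul_chain i' j' u -> koszul_chain i' j' (F c' u).
  move=> hu; rewrite FE addrC; apply: koszul_chain_lin => //.
  apply/koszul_chainP => S m; rewrite !ffunE; case: ifP => rS; last by rewrite msupp0.
  rewrite !inE; case: ifP => [_|sS]; first by rewrite mulr0 msupp0.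
  rewrite mulrCA mulrA /ksgn -exprD -signr_odd mulr_sign => mS.
  have {mS} : m \in msupp (u (s |: S :\ r)%SET).
    by move: mS; case: odd; rewrite ?(perm_mem (msuppN _)).
  move=> /((koszul_chainP _ _ _).1 hu)[<- <-].
  have -> : #|(s |: S :\ r)%SET| = #|S|.
    by rewrite finset.cardsU1 !inE sS (finset.cardsD1 r S) rS.
  by [].
have FJ c' u : coords_in J u -> coords_in J (F c' u).
  move=> hu S; rewrite FE !ffunE; apply: JD => //.
  rewrite -mul_mpolyC; apply: (JM _); case: ifP => _ //; apply: (JM _).
  by case: ifP => _ //; apply: (JM _).
apply: (@koszul_transport K n p _ _ _ _ (F c) (F (- c))) => //.
- by move=> u; have := FK (- c) u; rewrite opprK.
- by move=> *; apply: Fch.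
- by move=> *; apply: Fch.
- by move=> *; apply: FJ.
- by move=> *; apply: FJ.
- by move=> u; have := row_add_conj A c u rs.
Qed.

End Ext.
End GLAction.

(** * Semicontinuity of the Koszul-Betti numbers *)

Section Betti.
Variables (K : fieldType) (n p : nat).
Local Notation R := {mpoly K[n]}.
Local Notation ext := {ffun {set 'I_p} -> R}.
Hypothesis K0 : [pchar K] =i pred0.

(** Exhibits each coefficient as linear in the entries of [A], so that the ranks are those of
    polynomial matrices. *)
Lemma mcoeff_koszul_diff (A : 'M[K]_(p, n)) (w : ext) S m :
  (koszul_diff A w S)@_m =
  \sum_(s | s \notin S) \sum_l
    A s l * ((-1) ^+ #|[pred t in S | (t < s)%N]| * 'X_l * w (s |: S)%SET)@_m.
Proof.
rewrite ffunE raddf_sum /=; apply: eq_bigr => s _.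
rewrite /lin_form mulr_sumr mulr_suml raddf_sum /=; apply: eq_bigr => l _.
by rewrite -scalerAr -scalerAl mcoeffZ.
Qed.

Section Basis.
Variables (J : set R) (E : pred 'X_{1..n}) (f : 'X_{1..n} -> R).
Hypothesis idJ : ideal J.
Hypothesis gb : graded_basis J E f.
Variables (i : nat) (j : int).

(** Both ranks of [koszul_rank] reach their maxima at a common generic point, and the right-hand
    side there does not depend on [A]. *)
Lemma betti_min : exists A0 : 'M[K]_(p, n),
  [/\ generic (fun v : 'I_(p * n) -> K => koszul_homology_dim (@vec_mx K p n (\row_k v k)) J i j
                        = koszul_homology_dim A0 J i j),
      forall A : 'M[K]_(p, n), (koszul_homology_dim A0 J i j <= koszul_homology_dim A J i j)%N
    & koszul_betti J i j p = koszul_homology_dim A0 J i j].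
Proof.
pose M i1 i2 (v : 'I_(p * n) -> K) := fam_mx (@sum_fam K n p j (@vec_mx K p n (\row_k v k)) E f i1 i2).
have pf i1 i2 a b : polyfn (fun v => M i1 i2 v a b).
  under eq_fun do rewrite mxE; case: (enum_val a) => t /=; last exact: polyfn_cst.
  rewrite /diff_fam; case: (t \in _); last exact: polyfn_cst.
  under eq_fun do rewrite mcoeff_koszul_diff.
  apply: polyfn_sum => s _; apply: polyfn_sum => l _; apply: polyfnM; last exact: polyfn_cst.
  exact: polyfn_entry.
have [v1 g1 m1] := generic_rank_max (pf i.+1 i).
have [v2 g2 m2] := generic_rank_max (pf i i.-1).
have g12 := generic_and g1 g2.
have [v [e1 e2]] := generic_ex K0 g12.
have rk (A : 'M[K]_(p, n)) := koszul_rank j K0 idJ gb A i.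
have key (w : 'I_(p * n) -> K) :
  (koszul_homology_dim (@vec_mx K p n (\row_k w k)) J i j + \rank (M i.+1 i w) + \rank (M i i.-1 w))%N =
  (koszul_homology_dim (@vec_mx K p n (\row_k v k)) J i j + \rank (M i.+1 i v) + \rank (M i i.-1 v))%N.
  by rewrite [LHS]rk [RHS]rk.
exists (@vec_mx K p n (\row_k v k)).
have gen : generic (fun v' : 'I_(p * n) -> K => koszul_homology_dim (@vec_mx K p n (\row_k v' k)) J i j
                        = koszul_homology_dim (@vec_mx K p n (\row_k v k)) J i j).
  apply: generic_sub g12 _ => w [f1 f2]; have := key w.
  by rewrite f1 f2 e1 e2 => /addIn/addIn.
split=> // [A|].
  have := key (mxvec A 0); rewrite (_ : vec_mx _ = A); last first.
    by rewrite (_ : \row_k _ = mxvec A) ?mxvecK //; apply/rowP => k; rewrite mxE.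
  rewrite e1 e2 => e; have h1 := m1 (mxvec A 0); have h2 := m2 (mxvec A 0).
  rewrite -(leq_add2r (\rank (M i.+1 i v1))) -(leq_add2r (\rank (M i i.-1 v2))) -e.
  by rewrite -!addnA leq_add2l leq_add.
(* A generic value exists, so [xget] returns one, and two generic values agree at a common generic
   point. *)
rewrite /koszul_betti; set X := [set b | _].
have /(xgetPex 0%N) /(generically_generic K0) gx : exists b, X b.
  by exists (koszul_homology_dim (@vec_mx K p n (\row_k v k)) J i j); apply/(generically_generic K0).
by have [w [<- <-]] := generic_ex K0 (generic_and gx gen).
Qed.

Lemma betti_le (A : 'M[K]_(p, n)) : (koszul_betti J i j p <= koszul_homology_dim A J i j)%N.
Proof. by have [A0 [_ h ->]] := betti_min. Qed.

Lemma betti_generic :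
  generic (fun v : 'I_(p * n) -> K => koszul_homology_dim (@vec_mx K p n (\row_k v k)) J i j = koszul_betti J i j p).
Proof. by have [A0 [h _ ->]] := betti_min. Qed.

End Basis.

(** The leading monomials make the family triangular, so its rank depends on [E] alone and not on
    the polynomials [f m]. *)
Lemma ideal_fam_rank (tau : rel 'X_{1..n}) (E : pred 'X_{1..n}) (f : 'X_{1..n} -> R) i j :
  term_order tau ->
  (forall m, E m -> (f m)@_m != 0 /\ tau_le tau (f m) m) ->
  fam_rank (@ideal_fam K n p j E f i) = #|[pred t | (t \in @cells n p j i) && E t.2]|.
Proof.
move=> [an tr to _ _] H.
apply: (@fam_rank_triangular _ _ _ _ _ _ id (fun t => bmnm t.2) tau) => // [t b|t|s t].
- by rewrite inE /ideal_fam => /negbTE->.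
- by rewrite inE /ideal_fam => tE; rewrite tE ffunE eqxx; case/andP: tE => _ /H[].
rewrite !inE /ideal_fam => sE tE; rewrite sE ffunE.
case: (t.1 =P s.1) => [e|_]; last by rewrite mcoeff0 eqxx.
rewrite -mcoeff_msupp; case/andP: sE => _ /H[_ h] /h ts st.
by case: s t e ts st {tE h} => [a b] [a' b'] /= -> ts st; congr (_, _); apply: val_inj; apply: an; rewrite ts st.
Qed.

Section Degenerate.
Variables (tau : rel 'X_{1..n}) (J : set R).
Hypothesis tau_order : term_order tau.
Hypothesis homJ : homogeneous_ideal J.
Local Notation E := (initial_monomials tau J).
Local Notation f := (lead_basis tau J).

Lemma torus_form (v : 'I_n -> K) i : gl_form (diag_mx (\row_k v k)) i = v i *: 'X_i.
Proof.
rewrite /gl_form (bigD1 i) //= big1 ?addr0 => [|k ki]; first by rewrite !mxE eqxx.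
by rewrite !mxE (negbTE ki) mulr0n scale0r.
Qed.

Lemma mcoeff_torus (v : 'I_n -> K) g m :
  (gl_act (diag_mx (\row_k v k)) g)@_m = g@_m * ('X_[m] : R).@[v].
Proof.
rewrite gl_actE raddf_sum /= [in RHS](mpolyE g) raddf_sum /= mulr_suml.
apply: eq_bigr => m' _; rewrite gl_actX !mcoeffZ.
rewrite (eq_bigr (fun i => (v i ^+ m' i)%:MP * 'X_i ^+ m' i)); last first.
  by move=> i _; rewrite torus_form exprZn mul_mpolyC.
rewrite big_split /= -mpolyXE_id -rmorph_prod /= mcoeffCM mcoeffX mevalX.
by case: eqP => [->|_]; rewrite ?mulr1 ?mulr0 ?mul0r.
Qed.

Lemma torus_unit (v : 'I_n -> K) : (forall i, v i != 0) -> diag_mx (\row_k v k) \in unitmx.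
Proof.
move=> h; rewrite unitmxE det_diag unitfE; apply/prodf_neq0 => i _.
by rewrite mxE.
Qed.

Lemma generic_torus : generic (fun v : 'I_n -> K => forall i, v i != 0).
Proof.
apply: generic_fin => i; exists 'X_i; first by rewrite -msupp_eq0 msuppX.
by move=> v; rewrite mevalXU.
Qed.

Lemma torus_basis (v : 'I_n -> K) : (forall i, v i != 0) ->
  graded_basis (gl_act (diag_mx (\row_k v k)) @` J) E
    (fun m => gl_act (diag_mx (\row_k v k)) (f m)).
Proof.
move=> v0; have [gb1 gb2] := initial_basis tau_order homJ; split=> [m /gb1[Jm hm]|].
  by split; [exists (f m)|exact: gl_act_homog].
move=> d k _ dk [g Jg <-] hg.
have hg' : g \is d.-homog.
  by rewrite -(gl_actK (torus_unit v0) g); apply: gl_act_homog.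
have [c ->] := gb2 d k g dk Jg hg'; exists c.
by rewrite raddf_sum /=; apply: eq_bigr => m _; rewrite linearZ.
Qed.

Lemma generic_sum_fam_lead (A : 'M[K]_(p, n)) i i' j :
  generic (fun v => (fam_rank (@sum_fam K n p j A E (fun m => 'X_[m]) i i') <=
    fam_rank (@sum_fam K n p j A E (fun m => gl_act (diag_mx (\row_k v k)) (f m)) i i'))%N).
Proof.
pose F t b : R := match t with
  | inl t => (@diff_fam K n p j A i t b)%:MP
  | inr t => @ideal_fam K n p j E f i' t b *: 'X_[b.2] end.
pose e (t : {set 'I_p} * 'X_{1..n < `|j|.+1} + {set 'I_p} * 'X_{1..n < `|j|.+1}) : 'X_{1..n} :=
  match t with inl _ => 0%MM | inr t => t.2 end.
have leF t b : tau_le tau (F t b) (e t).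
  case: t => t m /=.
    rewrite msuppC; case: ifP => // _; rewrite inE => /eqP->.
    by case: tau_order.
  rewrite /ideal_fam; case: ifP => [/andP[_ Et]|_]; last by rewrite scale0r msupp0.
  rewrite ffunE; case: ifP => _; last by rewrite mcoeff0 scale0r msupp0.
  have [->|c0] := eqVneq (f t.2)@_b.2 0; first by rewrite scale0r msupp0.
  rewrite msuppMCX // inE => /eqP->.
  by have [_ _ _] := lead_basisP homJ Et; apply; rewrite mcoeff_msupp.
apply: generic_sub (generic_fam_rank_lead tau_order leF) _ => v.
congr (_ <= _)%N; congr (fam_rank _); apply/funext => t; apply/funext => b; case: t => t /=.
- by rewrite mcoeffC eqxx mulr1.
- rewrite mcoeffZ mcoeffX /ideal_fam; case: ifP => [/andP[_ Et]|_]; last by rewrite mul0r.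
  rewrite !ffunE; case: ifP => _; last by rewrite !mcoeff0 mul0r.
  rewrite mcoeffX eq_sym; case: eqP => [<-|_]; last by rewrite mulr0.
  by have [_ _ -> _] := lead_basisP homJ Et; rewrite mulr1.
- by rewrite mevalC.
- rewrite mevalZ /ideal_fam; case: ifP => _; last by rewrite mul0r.
  by rewrite !ffunE; case: ifP => _; [rewrite mcoeff_torus|rewrite !mcoeff0 mul0r].
Qed.

(* A diagonal matrix v multiplies the coefficient at x^m by v^m. For unknown v the
   rows become polynomials whose tau-leading coefficients are the rows for the
   initial ideal, so at generic v the ranks are at least those for it. *)
Lemma koszul_le_initial (A : 'M[K]_(p, n)) i j :
  (koszul_betti J i j p <= koszul_homology_dim A (mono_ideal E) i j)%N.
Proof.
have [v [v0 [h1 h2]]] := generic_ex K0 (generic_and generic_torus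
  (generic_and (generic_sum_fam_lead A i.+1 i j) (generic_sum_fam_lead A i i.-1 j))).
set g := diag_mx _ in h1 h2.
have ug : g \in unitmx := torus_unit v0.
have gb := torus_basis v0; rewrite -/g in gb.
have id1 : ideal (gl_act g @` J) := (gl_act_ideal ug homJ).1.
have := koszul_rank j K0 (mono_ideal_ideal K (initial_up_closed tau_order homJ)) (mono_basis K E) A i.
have := koszul_rank j K0 id1 gb A i.
(* The torus keeps leading monomials, so the constant terms of the two rank formulas coincide. *)
have -> : fam_rank (@ideal_fam K n p j E (fun m => gl_act g (f m)) i.-1) =
          fam_rank (@ideal_fam K n p j E (fun m => 'X_[m]) i.-1).
  rewrite !(@ideal_fam_rank tau) // => m Em.
    split; first by rewrite mcoeffX eqxx oner_neq0.
    by move=> m'; rewrite msuppX inE => /eqP->; case: tau_order => _ _ to _ _; have := to m m; rewrite orbb.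
  have [_ _ e1 le] := lead_basisP homJ Em; split.
    rewrite mcoeff_torus e1 mul1r mevalX; apply/prodf_neq0 => k _; exact: expf_neq0.
  move=> m'; rewrite mcoeff_msupp mcoeff_torus mulf_eq0 negb_or => /andP[+ _].
  by rewrite -mcoeff_msupp; exact: le.
move=> <- e.
have hle : (koszul_homology_dim A (gl_act g @` J) i j <= koszul_homology_dim A (mono_ideal E) i j)%N.
  have e' := leq_add (leq_add (leqnn (koszul_homology_dim A (mono_ideal E) i j)) h1) h2.
  by rewrite e -!addnA leq_add2r in e'.
apply: leq_trans hle.
(* The forms are arbitrary, hence they are the image under [g] of other forms; this undoes the torus
   action on [J]. *)
have -> : A = (A *m (invmx g)^T) *m g^T by rewrite -mulmxA -trmx_mul mulmxV // trmx1 mulmx1.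
rewrite -koszul_gl //; apply: (betti_le (homJ.1) (initial_basis tau_order homJ)).
Qed.

End Degenerate.

(** One inequality is enough, as it can be applied to the inverse of [g]. The order [tau] supplies
    the graded bases. *)
Lemma betti_gl (J : set R) g i j (tau : rel 'X_{1..n}) : term_order tau -> homogeneous_ideal J ->
  g \in unitmx -> koszul_betti (gl_act g @` J) i j p = koszul_betti J i j p.
Proof.
move=> to hJ ug.
wlog suff: J g hJ ug / (koszul_betti (gl_act g @` J) i j p <= koszul_betti J i j p)%N.
  move=> W; apply/eqP; rewrite eqn_leq W //=.
  have := W (gl_act g @` J) (invmx g) (gl_act_ideal ug hJ).
  rewrite unitmx_inv => /(_ ug); congr (koszul_betti _ _ _ _ <= _)%N.
  apply/seteqP; split=> [_ [_ [a Ja <-] <-]|a Ja]; first by rewrite gl_actK.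
  by exists (gl_act g a); [exists a|rewrite gl_actK].
have [A [_ _ ->]] := betti_min hJ.1 (initial_basis to hJ) i j.
rewrite (koszul_gl A J i j ug); apply: betti_le; first exact: (gl_act_ideal ug hJ).1.
exact: (initial_basis to (gl_act_ideal ug hJ)).
Qed.

Lemma betti_le_gl_initial (J : set R) tau g (A : 'M[K]_(p, n)) i j :
  term_order tau -> homogeneous_ideal J -> g \in unitmx ->
  (koszul_betti J i j p <=
   koszul_homology_dim A (mono_ideal (initial_monomials tau (gl_act g @` J))) i j)%N.
Proof.
move=> to hJ ug; rewrite -(betti_gl i j to hJ ug).
exact: (koszul_le_initial to (gl_act_ideal ug hJ)).
Qed.

End Betti.

(** * Existence and strong stability of the generic initial ideal *)

Section Dickson.
Variable n : nat.
Implicit Types (P : 'X_{1..n} -> Prop) (F : seq 'X_{1..n}).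

(** For [v.+1], start from a finite set [F0] for [v]. A monomial whose next exponent is at least all
    those in [F0] is dominated by a member of [F0]; the others lie in finitely many slices of
    constant exponent, each covered by induction. *)
Lemma dickson_partial v P : exists F, (forall m, m \in F -> P m) /\
  forall m, P m -> exists2 m', m' \in F & forall i : 'I_n, (i < v)%N -> (m' i <= m i)%N.
Proof.
elim: v P => [|v IH] P.
  have [[m Pm]|no] := pselect (exists m, P m).
    exists [:: m]; split=> [m'|m' _]; first by rewrite inE => /eqP->.
    by exists m; rewrite ?mem_head.
  by exists [::]; split=> // m Pm; case: no; exists m.
have [F0 [F0P F0h]] := IH P.
have [nv|vn] := leqP n v.
  exists F0; split=> // m /F0h[m' m'F h]; exists m' => // i _.
  by apply: h; apply: leq_trans (ltn_ord i) nv.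
pose iv := Ordinal vn.
have slices c : exists F, (forall m, m \in F -> P m) /\
    forall m, P m -> (m iv < c)%N ->
      exists2 m', m' \in F & forall i : 'I_n, (i < v.+1)%N -> (m' i <= m i)%N.
  elim: c => [|c [F [FP Fh]]]; first by exists [::].
  have [F1 [F1P F1h]] := IH (fun m => P m /\ m iv = c).
  exists (F ++ F1); split=> [m|m Pm].
    by rewrite mem_cat => /orP[/FP|/F1P[]].
  rewrite ltnS leq_eqVlt => /predU1P[mc|lt].
    have [m' m'F h] := F1h m (conj Pm mc); exists m'; first by rewrite mem_cat m'F orbT.
    move=> i; rewrite ltnS leq_eqVlt => /predU1P[e|]; last exact: h.
    have -> : i = iv by apply: val_inj.
    by have [_ ->] := F1P _ m'F; rewrite mc.
  have [m' m'F h] := Fh m Pm lt; exists m' => //; by rewrite mem_cat m'F.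
have [F1 [F1P F1h]] := slices (\max_(m <- F0) m iv)%N.
exists (F0 ++ F1); split=> [m|m Pm].
  by rewrite mem_cat => /orP[/F0P|/F1P].
have [lt|ge] := ltnP (m iv) (\max_(m <- F0) m iv)%N.
  have [m' m'F h] := F1h m Pm lt; exists m' => //; by rewrite mem_cat m'F orbT.
have [m' m'F h] := F0h m Pm; exists m'; first by rewrite mem_cat m'F.
move=> i; rewrite ltnS leq_eqVlt => /predU1P[e|]; last exact: h.
have -> : i = iv by apply: val_inj.
by apply: leq_trans ge; rewrite (big_rem m') //= leq_maxl.
Qed.

Lemma dickson P : exists D, forall m, P m ->
  exists m', [/\ P m', (m' <= m)%MM & (mdeg m' <= D)%N].
Proof.
have [F [FP Fh]] := dickson_partial n P; exists (\max_(m <- F) mdeg m)%N => m /Fh[m' m'F h].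
exists m'; split; [exact: FP|by apply/mnm_lepP => i; apply: h|].
by rewrite (big_rem m') //= leq_maxl.
Qed.

End Dickson.

(** * Initial monomials counted by truncated ranks *)

Section TruncatedRank.
Variables (K : fieldType) (n : nat).
Local Notation R := {mpoly K[n]}.

Definition basis_fam (T' : finType) d (E : pred 'X_{1..n}) (f : 'X_{1..n} -> R)
    (L : T' -> R -> K) (m : 'X_{1..n < d.+1}) (b : T') : K :=
  if (mdeg m == d) && E m then L b (f m) else 0.

Lemma basis_fam_rank_le (T' : finType) d J E f E' f' (L : T' -> R -> K) :
  (forall b, linear_for *%R (L b)) ->
  graded_basis J E f -> graded_basis J E' f' ->
  (fam_rank (@basis_fam T' d E f L) <= fam_rank (@basis_fam T' d E' f' L))%N.
Proof.
move=> Llin [f1 _] [_ f2]; apply: fam_rank_le => m; rewrite /basis_fam.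
case: (boolP ((mdeg m == d) && E m)) => [/andP[/eqP md Em]|_]; last first.
  by exists (fun=> 0) => b; rewrite big1 // => s _; rewrite mul0r.
have [Jm hm] := f1 m Em; rewrite md in hm.
have [c cE] := f2 d d.+1 (f m) (ltnSn d) Jm hm; exists (fun m => c (bmnm m)) => b.
have LS (I : Type) (r : seq I) (P : pred I) (F : I -> R) (a : I -> K) :
    L b (\sum_(i <- r | P i) a i *: F i) = \sum_(i <- r | P i) a i * L b (F i).
  elim: r => [|x r IH]; last by rewrite !big_cons; case: (P x); rewrite ?Llin ?IH.
  by rewrite !big_nil; have := Llin b (-1) 0 0; rewrite scaler0 addr0 mulN1r addNr.
by rewrite cE LS big_mkcond /=; apply: eq_bigr => s _; case: ifP; rewrite ?mulr0.
Qed.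

(** Either rank is that of the functionals [L] on the degree [d] part of [J]. This allows the lead
    forms of $g(I)$, chosen separately for each $g$, to be replaced by the $g$-images of those of
    $I$, which are polynomial in $g$. *)
Lemma basis_fam_rank (T' : finType) d J E f E' f' (L : T' -> R -> K) :
  (forall b, linear_for *%R (L b)) ->
  graded_basis J E f -> graded_basis J E' f' ->
  fam_rank (@basis_fam T' d E f L) = fam_rank (@basis_fam T' d E' f' L).
Proof.
by move=> h b1 b2; apply/eqP; rewrite eqn_leq !(basis_fam_rank_le d h b1 b2, basis_fam_rank_le d h b2 b1).
Qed.

Definition trunc (tau : rel 'X_{1..n}) (mu : 'X_{1..n}) d (b : 'X_{1..n < d.+1}) (f : R) : K :=
  if tau mu b then f@_b else 0.

Lemma trunc_linear tau mu d (b : 'X_{1..n < d.+1}) : linear_for *%R (trunc tau mu b).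
Proof.
by move=> a f g; rewrite /trunc; case: ifP => _; rewrite ?mulr0 ?addr0 // mcoeffD mcoeffZ.
Qed.

Definition rank_above (tau : rel 'X_{1..n}) (E : pred 'X_{1..n}) d (mu : 'X_{1..n}) : nat :=
  #|[pred m : 'X_{1..n < d.+1} | [&& mdeg m == d, E m & tau mu m]]|.

(** Lead forms of monomials not above [mu] are truncated to zero, and the others stay triangular.
    Positions of initial monomials thus become ranks, to which genericity applies. *)
Lemma lead_trunc_rank tau J d mu : term_order tau -> homogeneous_ideal J ->
  fam_rank (@basis_fam _ d (initial_monomials tau J) (lead_basis tau J) (@trunc tau mu d))
  = rank_above tau (initial_monomials tau J) d mu.
Proof.
move=> to hJ; have [an tr tot _ _] := to.
apply: (@fam_rank_triangular _ _ _ _ _ _ id (fun t => bmnm t) tau) => //.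
- move=> t b; rewrite inE /basis_fam /trunc; case: (mdeg t == d) => //=.
  case Et : (initial_monomials tau J t) => //=; case: ifP => // mb mt.
  apply: memN_msupp_eq0; apply: contra mt => bt; apply: tr mb _.
  by have [_ _ _] := lead_basisP hJ Et; apply.
- move=> t; rewrite inE /basis_fam /trunc => /and3P[-> Et ->]; rewrite Et /=.
  by have [_ _ -> _] := lead_basisP hJ Et; rewrite oner_neq0.
- move=> s t; rewrite !inE => /and3P[sd Es _] /and3P[_ _ mt].
  rewrite /basis_fam /trunc sd Es mt /= -mcoeff_msupp.
  have [_ _ _ h] := lead_basisP hJ Es => /h ts st.
  by apply: val_inj; apply: an; rewrite ts st.
Qed.

(** At the [tau]-largest monomial where [E] and [E'] differ, the two counts would differ by one. *)
Lemma rank_above_inj tau E E' d : term_order tau ->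
  (forall mu, mdeg mu = d -> rank_above tau E d mu = rank_above tau E' d mu) ->
  forall m, mdeg m = d -> E m = E' m.
Proof.
move=> [an tr tot _ _] H m md; apply/eqP/negPn/negP => ne.
have mk : (mdeg m < d.+1)%N by rewrite md.
pose s := [seq bmnm x | x <- enum [pred x : 'X_{1..n < d.+1} | (mdeg x == d) && (E x != E' x)]].
have s0 : s != [::].
  have : m \in s.
    apply/mapP; exists (BMultinom mk) => //.
    by rewrite mem_enum inE /= md eqxx.
  by case: s.
have [x /mapP[y]] := tau_max tr tot s0.
rewrite mem_enum inE => /andP[/eqP yd yE] -> h.
have := H y yd; rewrite /rank_above (cardD1 y) [RHS](cardD1 y) !inE yd eqxx /=.
have -> : tau y y by have := tot y y; rewrite orbb.
rewrite !andbT.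
have -> : #|[predD1 [pred m0 : 'X_{1..n < d.+1} | [&& mdeg m0 == d, E m0 & tau y m0]] & y]| =
  #|[predD1 [pred m0 : 'X_{1..n < d.+1} | [&& mdeg m0 == d, E' m0 & tau y m0]] & y]|.
  apply: eq_card => z; rewrite !inE; case: (eqVneq z y) => //= zy; case: (eqVneq (mdeg z) d) => //= zd.
  case: (boolP (tau y z)) => yz; rewrite ?andbF // !andbT.
  apply/eqP/negPn/negP => ne'; case/eqP: zy; apply: val_inj; apply: an; rewrite yz andbT.
  by apply: h; apply/mapP; exists z => //; rewrite mem_enum inE zd eqxx.
move=> /addIn; case: (E y) yE; case: (E' y) => //.
Qed.

Lemma gl_basis (g : 'M[K]_n) J E f : g \in unitmx -> graded_basis J E f ->
  graded_basis (gl_act g @` J) E (fun m => gl_act g (f m)).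
Proof.
move=> ug [gb1 gb2]; split=> [m /gb1[Jm hm]|].
  by split; [exists (f m)|exact: gl_act_homog].
move=> d k _ dk [h Jh <-] hg.
have hg' : h \is d.-homog by rewrite -(gl_actK ug h); apply: gl_act_homog.
have [c ->] := gb2 d k h dk Jh hg'; exists c.
by rewrite raddf_sum /=; apply: eq_bigr => m _; rewrite linearZ.
Qed.

Definition degree_count (E : pred 'X_{1..n}) d : nat :=
  #|[pred m : 'X_{1..n < d.+1} | (mdeg m == d) && E m]|.

Lemma eq_degree_count (E E' : pred 'X_{1..n}) d : (forall m, mdeg m = d -> E m = E' m) ->
  degree_count E d = degree_count E' d.
Proof. by move=> h; apply: eq_card => m; rewrite !inE; case: eqVneq => //= /h. Qed.

Lemma degree_count_sub (E E' : pred 'X_{1..n}) d : (forall m, E m -> E' m) ->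
  degree_count E d = degree_count E' d -> forall m, mdeg m = d -> E m = E' m.
Proof.
move=> sub e m md; have lt : (mdeg m < d.+1)%N by rewrite md.
pose X (P : pred 'X_{1..n}) := [pred m' : 'X_{1..n < d.+1} | (mdeg m' == d) && P (bmnm m')].
have sX : X E \subset X E' by apply/fintype.subsetP => m'; rewrite !inE => /andP[-> /sub].
have : X E =i X E' by apply/fintype.subset_cardP.
by move=> /(_ (BMultinom lt)); rewrite !inE /= md eqxx.
Qed.

Lemma lead_basis_free tau J d (c : 'X_{1..n < d.+1} -> K) : term_order tau -> homogeneous_ideal J ->
  let X := [pred m : 'X_{1..n < d.+1} | (mdeg m == d) && initial_monomials tau J m] in
  \sum_(t in X) c t *: lead_basis tau J t = 0 -> forall t, t \in X -> c t = 0.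
Proof.
move=> to hJ X S0; have [an tr tot _ _] := to.
apply: (@triangular_free _ _ _ _ (fun s b : 'X_{1..n < d.+1} => (lead_basis tau J s)@_b) X id
          (@bmnm n d.+1) tau) => //.
- by move=> t; rewrite inE => /andP[_ /(lead_basisP hJ)[_ _ -> _]]; exact: oner_neq0.
- move=> s t; rewrite !inE -mcoeff_msupp => /andP[_ /(lead_basisP hJ)[_ _ _ h]] _ /h ts st.
  by apply: val_inj; apply: an; rewrite ts st.
- move=> b; have := congr1 (mcoeff b) S0; rewrite raddf_sum mcoeff0 => e; rewrite -[RHS]e.
  by apply: eq_bigr => t _; rewrite /= mcoeffZ.
Qed.

Lemma basis_free_rank tau J (g : 'M[K]_n) d : term_order tau -> homogeneous_ideal J -> g \in unitmx ->
  fam_rank (@basis_fam _ d (initial_monomials tau J) (fun m => gl_act g (lead_basis tau J m))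
    (fun (b : 'X_{1..n < d.+1}) f => f@_b)) = degree_count (initial_monomials tau J) d.
Proof.
move=> to hJ ug; set X := [pred m : 'X_{1..n < d.+1} | (mdeg m == d) && initial_monomials tau J m].
have [gb _] := initial_basis to hJ.
apply: (@fam_rank_free _ _ _ _ X) => [t b|c H].
  by rewrite inE /basis_fam => /negbTE->.
have S0 : \sum_(t in X) c t *: lead_basis tau J t = 0.
  apply: (can_inj (gl_actK ug)); rewrite raddf_sum linear0 /=.
  apply/mpolyP => b; rewrite mcoeff0.
  have [lt|ge] := ltnP (mdeg b) d.+1.
    have := H (BMultinom lt); rewrite raddf_sum /= => e; rewrite -[RHS]e.
    apply: eq_bigr => t; rewrite inE /basis_fam => tX; rewrite tX.
    by rewrite linearZ mcoeffZ.
  rewrite raddf_sum big1 //= => t; rewrite inE => /andP[/eqP td Et].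
  rewrite linearZ mcoeffZ (_ : _@__ = 0) ?mulr0 //; apply: memN_msupp_eq0.
  have [_ /(gl_act_homog g)/dhomogP ht] := gb _ Et.
  by apply: contraL ge => /ht /= ->; rewrite td -ltnNge.
exact: lead_basis_free S0.
Qed.

Lemma degree_count_gl tau J (g : 'M[K]_n) d : term_order tau -> homogeneous_ideal J -> g \in unitmx ->
  degree_count (initial_monomials tau (gl_act g @` J)) d = degree_count (initial_monomials tau J) d.
Proof.
move=> to hJ ug; rewrite -(basis_free_rank d to hJ ug).
have hg := gl_act_ideal ug hJ.
rewrite -(basis_free_rank d to hg (unitmx1 _ _)).
apply: basis_fam_rank.
- by move=> b a f f'; rewrite mcoeffD mcoeffZ.
- rewrite (_ : (fun m => gl_act _ _) = lead_basis tau (gl_act g @` J)); first exact: initial_basis.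
  by apply/funext => m; rewrite gl_act1.
- by apply: gl_basis => //; exact: initial_basis.
Qed.

End TruncatedRank.

Section PolynomialFamilies.
Variables (K : fieldType) (n N : nat).
Local Notation R := {mpoly K[n]}.
Implicit Types (G H : ('I_N -> K) -> R).

Definition polyfam G := forall m, polyfn (fun v => (G v)@_m).

Lemma polyfamM G H : polyfam G -> polyfam H -> polyfam (fun v => G v * H v).
Proof.
move=> hG hH m; under eq_fun do rewrite mcoeffM.
by apply: polyfn_sum => k _; apply: polyfnM.
Qed.

Lemma polyfam_cst f : polyfam (fun=> f).
Proof. by move=> m; exact: polyfn_cst. Qed.

Lemma polyfam_prod (T : Type) (r : seq T) (F : T -> _) :
  (forall i, polyfam (F i)) -> polyfam (fun v => \prod_(i <- r) F i v).
Proof.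
move=> h; elim: r => [|x r IH].
  by under eq_fun do rewrite big_nil; exact: polyfam_cst.
by under eq_fun do rewrite big_cons; exact: polyfamM.
Qed.

Lemma polyfam_sum (T : Type) (r : seq T) (F : T -> _) :
  (forall i, polyfam (F i)) -> polyfam (fun v => \sum_(i <- r) F i v).
Proof.
by move=> h m; under eq_fun do rewrite raddf_sum; apply: polyfn_sum => i _; exact: h.
Qed.

Lemma polyfam_scale c G : polyfn c -> polyfam G -> polyfam (fun v => c v *: G v).
Proof. by move=> hc hG m; under eq_fun do rewrite mcoeffZ; exact: polyfnM. Qed.

Lemma polyfam_exp G k : polyfam G -> polyfam (fun v => G v ^+ k).
Proof.
move=> hG; elim: k => [|k IH].
  by under eq_fun do rewrite expr0; exact: polyfam_cst.
by under eq_fun do rewrite exprS; exact: polyfamM.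
Qed.

End PolynomialFamilies.

Lemma polyfam_gl_act (K : fieldType) n (f : {mpoly K[n]}) :
  polyfam (fun v : 'I_(n * n) -> K => gl_act (@vec_mx K n n (\row_k v k)) f).
Proof.
under eq_fun do rewrite gl_actE.
apply: polyfam_sum => m; apply: polyfam_scale; first exact: polyfn_cst.
under eq_fun do rewrite gl_actX.
apply: polyfam_prod => i; apply: polyfam_exp; apply: polyfam_sum => k.
by apply: polyfam_scale; [exact: polyfn_entry|exact: polyfam_cst].
Qed.

Section GinExists.
Variables (K : fieldType) (n : nat) (tau : rel 'X_{1..n}) (I : set {mpoly K[n]}).
Local Notation R := {mpoly K[n]}.
Hypothesis K0 : [pchar K] =i pred0.
Hypothesis tau_order : term_order tau.
Hypothesis homI : homogeneous_ideal I.
Local Notation inm g := (initial_monomials tau (gl_act g @` I)).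
Local Notation fmx v := (@vec_mx K n n (\row_k v k)).

Lemma rank_above_gl g d mu : g \in unitmx ->
  rank_above tau (inm g) d mu =
  fam_rank (@basis_fam K n _ d (initial_monomials tau I) (fun m => gl_act g (lead_basis tau I m))
    (@trunc K n tau mu d)).
Proof.
move=> ug; rewrite -(lead_trunc_rank d mu tau_order (gl_act_ideal ug homI)).
apply: basis_fam_rank.
- by move=> b; exact: trunc_linear.
- exact: initial_basis tau_order (gl_act_ideal ug homI).
- exact: gl_basis ug (initial_basis tau_order homI).
Qed.

Lemma generic_unit : generic (fun v : 'I_(n * n) -> K => fmx v \in unitmx).
Proof.
have pd : polyfn (fun v : 'I_(n * n) -> K => \det (fmx v)).
  by apply: polyfn_det => a b; exact: polyfn_entry.
have := @generic_polyfn _ _ _ (mxvec 1%:M 0) pd.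
rewrite (_ : vec_mx _ = 1%:M); last first.
  by rewrite (_ : \row_k _ = mxvec 1%:M) ?mxvecK //; apply/rowP => k; rewrite mxE.
rewrite det1 oner_neq0 => /(_ isT) h; apply: generic_sub h _ => v.
by rewrite unitmxE unitfE.
Qed.

(* r mu is the maximal, hence generic, number of monomials >= mu of degree d in
   the initial ideal of g(I). *)
Lemma generic_rank_above d : exists r : 'X_{1..n} -> nat,
  generic (fun v => fmx v \in unitmx /\ forall mu, mdeg mu = d -> rank_above tau (inm (fmx v)) d mu = r mu) /\
  forall g mu, mdeg mu = d -> g \in unitmx -> (rank_above tau (inm g) d mu <= r mu)%N.
Proof.
pose M mu (v : 'I_(n * n) -> K) := fam_mx (@basis_fam K n _ d (initial_monomials tau I)
  (fun m => gl_act (fmx v) (lead_basis tau I m)) (@trunc K n tau mu d)).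
have pf mu a b : polyfn (fun v => M mu v a b).
  under eq_fun do rewrite mxE /basis_fam /trunc.
  case: (_ && _); last exact: polyfn_cst.
  case: (tau _ _); last exact: polyfn_cst.
  exact: polyfam_gl_act.
have ex mu : exists r, generic (fun v => \rank (M mu v) = r) /\ forall v, (\rank (M mu v) <= r)%N.
  by have [v0 g m] := generic_rank_max (pf mu); exists (\rank (M mu v0)).
have [r rP] := choice ex; exists r; split.
  have gall := generic_fin (fun mu : 'X_{1..n < d.+1} => (rP mu).1).
  apply: generic_sub (generic_and generic_unit gall) _ => v [uv h]; split=> // mu mud.
  have lt : (mdeg mu < d.+1)%N by rewrite mud.
  by rewrite rank_above_gl // -(h (BMultinom lt)).
move=> g mu _ ug; rewrite rank_above_gl //; have := (rP mu).2 (mxvec g 0).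
rewrite /M (_ : vec_mx _ = g) //.
by rewrite (_ : \row_k _ = mxvec g) ?mxvecK //; apply/rowP => k; rewrite mxE.
Qed.

(** Infinitely many degrees impose infinitely many open conditions, whose intersection could be
    empty. Up to the degrees of generators of [E] they are finitely many; in the other degrees
    equality follows from an inclusion and equal Hilbert functions. *)
Lemma gin_exists : exists E : pred 'X_{1..n},
  [/\ Gin tau I = mono_ideal E,
      exists2 g, g \in unitmx & inm g = E
    & forall g d mu, mdeg mu = d -> g \in unitmx -> (rank_above tau (inm g) d mu <= rank_above tau E d mu)%N].
Proof.
have [r rP] := choice generic_rank_above.
pose good d v := fmx v \in unitmx /\ forall mu, mdeg mu = d -> rank_above tau (inm (fmx v)) d mu = r d mu.
have gd d : generic (good d) := (rP d).1.
have [w wP] := choice (fun d => generic_ex K0 (gd d)).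
(* [E] is assembled degree by degree from separate points [w d]; that it is closed under
   multiplication needs a common good point for only two degrees at a time. *)
pose E : pred 'X_{1..n} := fun m => inm (fmx (w (mdeg m))) m.
have gE d v : good d v -> forall m, mdeg m = d -> inm (fmx v) m = E m.
  move=> [uv hv] m md; rewrite /E md; have [uw hw] := wP d.
  by apply: (rank_above_inj tau_order _ md) => mu mud; rewrite hv ?hw.
have upE : up_closed E.
  move=> m m' Em; have [v [v1 v2]] := generic_ex K0 (generic_and (gd (mdeg m)) (gd (mdeg (m + m')%MM))).
  rewrite -(gE _ _ v2) //; apply: (initial_up_closed tau_order (gl_act_ideal v1.1 homI)).
  by rewrite (gE _ _ v1).
have [D DP] := dickson E.
(* [D] bounds the degrees of a set of generators of [E], so goodness up to [D] already places [E]
   inside the initial ideal. *)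
have full v : (forall d, d \in iota 0 D.+1 -> good d v) -> inm (fmx v) = E.
  move=> h; have [uv _] : good 0%N v by apply: h; rewrite mem_iota.
  have sub m : E m -> inm (fmx v) m.
    move=> /DP[m' [Em' le m'D]]; rewrite -(submK le) addmC.
    apply: (initial_up_closed tau_order (gl_act_ideal uv homI)).
    by rewrite (gE (mdeg m')) //; apply: h; rewrite mem_iota add0n ltnS.
  apply/funext => m; have [uw _] := wP (mdeg m).
  have c1 := degree_count_gl (mdeg m) tau_order homI uv.
  have c2 := degree_count_gl (mdeg m) tau_order homI uw.
  have c3 : degree_count (inm (fmx (w (mdeg m)))) (mdeg m) = degree_count E (mdeg m).
    by apply: eq_degree_count => m' e; rewrite /E e.
  by rewrite (degree_count_sub sub (etrans (esym c3) (etrans c2 (esym c1)))).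
have gfull : generic (fun v => fmx v \in unitmx /\ inm (fmx v) = E).
  apply: generic_sub (generic_all (r := iota 0 D.+1) (fun d _ => gd d)) _ => v h; split; last exact: full.
  by have [] : good 0%N v by apply: h; rewrite mem_iota.
have gin1 : is_gin tau I (mono_ideal E).
  apply/(generically_generic K0); apply: generic_sub gfull _ => v [uv vE]; split=> //.
  by rewrite (initial_idealE tau_order (gl_act_ideal uv homI)) vE.
exists E; split.
(* Two candidates for the generic initial ideal coincide at a common generic point. *)
- rewrite /Gin; set X := xget _ _.
  have /(generically_generic K0) g1 := gin1.
  have /(generically_generic K0) gX : is_gin tau I X by apply: (@xgetPex _ set0); exists (mono_ideal E).
  by have [v [[_ <-] [_ <-]]] := generic_ex K0 (generic_and gX g1).
- by have [v [uv vE]] := generic_ex K0 gfull; exists (fmx v).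
- move=> g d mu mud ug; apply: leq_trans ((rP d).2 g mu mud ug) _.
  have [v [[uv vE] [_ h]]] := generic_ex K0 (generic_and gfull (gd d)).
  by rewrite -vE h.
Qed.

End GinExists.

Definition strongly_stable n (E : pred 'X_{1..n}) :=
  forall (m : 'X_{1..n}) (k l : 'I_n), (k < l)%N -> (0 < m l)%N -> E m -> E (m - U_(l) + U_(k))%MM.

Section Shear.
Variables (K : fieldType) (n : nat) (k l : 'I_n).
Hypothesis kl : k != l.
Local Notation R := {mpoly K[n]}.

Definition shear (c : K) : 'M[K]_n := 1%:M + c *: delta_mx k l.

Definition slide (m : 'X_{1..n}) b : 'X_{1..n} := (m - U_(l) *+ b + U_(k) *+ b)%MM.

Lemma shear_form c i : gl_form (shear c) i = 'X_i + (if i == l then c *: 'X_k else 0) :> R.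
Proof.
rewrite /gl_form; under eq_bigr => a _ do rewrite !mxE scalerDl.
rewrite big_split /=; congr (_ + _).
  rewrite (bigD1 i) //= eqxx scale1r big1 ?addr0 // => a ai.
  by rewrite (negbTE ai) scale0r.
rewrite (bigD1 k) //= eqxx /= big1 ?addr0 => [|a ak]; last by rewrite (negbTE ak) mulr0 scale0r.
by case: eqP; rewrite ?mulr1 // mulr0 scale0r.
Qed.

(** Binomial expansion of $(x_l+c x_k)^{m_l}$; the binomial coefficients are where the
    characteristic will matter. *)
Lemma shearX c (m : 'X_{1..n}) : gl_act (shear c) 'X_[m] =
  \sum_(b < (m l).+1) (c ^+ b *+ 'C(m l, b)) *: 'X_[slide m b] :> R.
Proof.
rewrite gl_actX (bigD1 l) //= shear_form eqxx exprDn mulr_suml; apply: eq_bigr => b _.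
rewrite (eq_bigr (fun i => 'X_i ^+ m i)) => [|i /negbTE il]; last by rewrite shear_form il addr0.
rewrite exprZn -scalerAr scalerMnl -scalerAl; congr (_ *: _).
have -> : \prod_(i < n | i != l) 'X_i ^+ m i = 'X_[m - U_(l) *+ m l] :> R.
  rewrite [RHS]mpolyXE_id [RHS](bigD1 l) //= mnmBE mulmnE mnm1E eqxx mul1n subnn expr0 mul1r.
  apply: eq_bigr => i /negbTE il; rewrite mnmBE mulmnE mnm1E eq_sym il mul0n subn0 //.
rewrite !mpolyXn -!mpolyXD; congr ('X_[_]); apply/mnmP => i.
rewrite /slide !(mnmDE, mnmBE, mulmnE, mnm1E).
have bl := ltn_ord b; rewrite ltnS in bl.
case: (eqVneq l i) => [<-|il]; first by rewrite (negbTE kl); lia.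
by case: (k == i); lia.
Qed.

Lemma shearM a b : shear a *m shear b = shear (a + b).
Proof.
rewrite /shear mulmxDl !mulmxDr !mul1mx !mulmx1 -scalemxAl -scalemxAr mul_delta_mx_0 //.
  by rewrite !scaler0 addr0 scalerDl -addrA [b *: _ + _]addrC.
by rewrite eq_sym.
Qed.

Lemma shear_unit c : shear c \in unitmx.
Proof.
have e : shear c *m shear (- c) = 1%:M by rewrite shearM subrr /shear scale0r addr0.
by case: (mulmx1_unit e).
Qed.

Lemma mcoeff_shear c (m : 'X_{1..n}) b : (gl_act (shear c) ('X_[m] : R))@_b != 0 ->
  exists2 a : nat, (a <= m l)%N & b = slide m a.
Proof.
rewrite shearX raddf_sum /= => h; apply: contrapT => no; case/eqP: h.
rewrite big1 // => a _; rewrite mcoeffZ mcoeffX; case: eqP => [e|_]; last by rewrite mulr0.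
by case: no; exists a; rewrite // -ltnS.
Qed.

Lemma slide_inj (m : 'X_{1..n}) a b : (a <= m l)%N -> (b <= m l)%N -> slide m a = slide m b -> a = b.
Proof.
move=> al bl /mnmP/(_ k); rewrite /slide !(mnmDE, mnmBE, mulmnE, mnm1E) eqxx eq_sym (negbTE kl).
by lia.
Qed.

Lemma mcoeff_shear_slide c (m : 'X_{1..n}) a : (a <= m l)%N ->
  (gl_act (shear c) ('X_[m] : R))@_(slide m a) = c ^+ a *+ 'C(m l, a).
Proof.
move=> al; rewrite shearX raddf_sum /= (bigD1 (inord a)) //= big1 ?addr0.
  by rewrite inordK ?ltnS // mcoeffZ mcoeffX eqxx mulr1.
move=> b ba; rewrite mcoeffZ mcoeffX; case: eqP => [e|_]; last by rewrite mulr0.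
case/eqP: ba; apply: val_inj; rewrite /= inordK ?ltnS //.
by apply: slide_inj e => //; rewrite -ltnS.
Qed.

Lemma slide0 (m : 'X_{1..n}) : slide m 0 = m.
Proof. by rewrite /slide !mulm0n subm0 addm0. Qed.

Lemma slideS (m : 'X_{1..n}) a : (a < m l)%N -> slide m a.+1 = (slide m a - U_(l) + U_(k))%MM.
Proof.
move=> al; apply/mnmP => i; rewrite /slide !(mnmDE, mnmBE, mulmnE, mnm1E).
case: (eqVneq l i) => [<-|il]; first by rewrite (negbTE kl); lia.
by case: (k == i); lia.
Qed.

Lemma mdeg_slide (m : 'X_{1..n}) a : (a <= m l)%N -> mdeg (slide m a) = mdeg m.
Proof.
move=> al; have le : (U_(l) *+ a <= m)%MM.
  by apply/mnm_lepP => i; rewrite mulmnE mnm1E; case: eqVneq => [<-|]; lia.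
by rewrite -[in RHS](submK le) /slide !mdegD !mdegMn !mdeg1.
Qed.

Variable tau : rel 'X_{1..n}.
Hypothesis tau_order : term_order tau.
Hypothesis tau_kl : tau U_(l)%MM U_(k)%MM.

Lemma tau_slideS (m : 'X_{1..n}) a : (a < m l)%N -> tau (slide m a) (slide m a.+1).
Proof.
move=> al; have [an tr tot _ ad] := tau_order.
have le : (U_(l) <= slide m a)%MM.
  by rewrite lep1mP /slide !(mnmDE, mnmBE, mulmnE, mnm1E) eqxx (negbTE kl); lia.
by rewrite slideS // -{1}(submK le); apply: ad.
Qed.

Lemma tau_slide (m : 'X_{1..n}) a b : (a <= b)%N -> (b <= m l)%N -> tau (slide m a) (slide m b).
Proof.
have [an tr tot _ ad] := tau_order.
move=> /subnKC <-; elim: (b - a)%N => [|c IH] h; first by have := tot (slide m (a + 0)) (slide m a); rewrite addn0 orbb.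
by apply: tr (IH _) _; rewrite ?addnS; [lia|apply: tau_slideS; lia].
Qed.

End Shear.

Section GinStable.
Variables (K : fieldType) (n : nat) (tau : rel 'X_{1..n}) (I : set {mpoly K[n]}).
Local Notation R := {mpoly K[n]}.
Hypothesis K0 : [pchar K] =i pred0.
Hypothesis tau_order : term_order tau.
Hypothesis tau_dec : decreasing_vars tau.
Hypothesis homI : homogeneous_ideal I.
Local Notation inm g := (initial_monomials tau (gl_act g @` I)).

(** With unknown diagonal entries, the row of the lead form of $m$ has leading term $x^m$, and its
    coefficients there are those of $g(x^m)$. So after a generic rescaling of [J] the truncated rank
    is at least the one computed from the monomials of its initial ideal. *)
Lemma generic_shear_rank (J : set R) (g : 'M[K]_n) d mu : homogeneous_ideal J ->
  g \in unitmx ->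
  generic (fun v => (forall i, v i != 0) /\
   (fam_rank (@basis_fam K n _ d (initial_monomials tau J) (fun m => gl_act g 'X_[m]) (@trunc K n tau mu d))
    <= rank_above tau (initial_monomials tau (gl_act g @` (gl_act (diag_mx (\row_k v k)) @` J))) d mu)%N).
Proof.
move=> hJ ug; have [an tr tot _ ad] := tau_order.
pose F (m b : 'X_{1..n < d.+1}) : R :=
  if (mdeg m == d) && initial_monomials tau J m && tau mu b then
    \sum_(m2 <- msupp (lead_basis tau J m))
       ((lead_basis tau J m)@_m2 * (gl_act g 'X_[m2])@_b) *: 'X_[m2]
  else 0.
have leF t b : tau_le tau (F t b) (bmnm t).
  rewrite /F; case: ifP => [/andP[/andP[_ Et] _]|_]; last by move=> m; rewrite msupp0.
  rewrite big_seq; apply: tau_le_sum => m2 m2s m /msuppZ_le; rewrite msuppX inE => /eqP->.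
  by have [_ _ _] := lead_basisP hJ Et; apply.
apply: generic_sub (generic_and (generic_torus K n) (generic_fam_rank_lead tau_order leF)) _.
move=> v [v0 h]; split=> //.
have uv := torus_unit v0.
have hJ2 := gl_act_ideal uv hJ.
have hJ3 := gl_act_ideal ug hJ2.
rewrite -(lead_trunc_rank d mu tau_order hJ3).
rewrite -(basis_fam_rank (T' := _) (L := @trunc K n tau mu d) d _
   (gl_basis ug (gl_basis uv (initial_basis tau_order hJ))) (initial_basis tau_order hJ3)); last first.
  by move=> b; exact: trunc_linear.
have <- : fam_rank (fun t b : 'X_{1..n < d.+1} => (F t b)@_t) = fam_rank (@basis_fam K n _ d (initial_monomials tau J) (fun m => gl_act g 'X_[m]) (@trunc K n tau mu d)).
  congr fam_rank; apply/funext => t; apply/funext => b; rewrite /F /basis_fam /trunc.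
  case: (boolP (mdeg t == d)) => td //=; last by rewrite mcoeff0.
  case: (boolP (initial_monomials tau J t)) => Et /=; last by rewrite mcoeff0.
  case: ifP => _; last by rewrite mcoeff0.
  have [_ _ e1 _] := lead_basisP hJ Et.
  rewrite raddf_sum /= (bigD1_seq (bmnm t)) ?msupp_uniq //=; last by rewrite mcoeff_msupp e1 oner_neq0.
  rewrite mcoeffZ mcoeffX eqxx e1 mulr1 mul1r big1 ?addr0 // => m2 ne.
  by rewrite mcoeffZ mcoeffX (negbTE ne) mulr0.
suff <- : fam_rank (fun t b : 'X_{1..n < d.+1} => (F t b).@[v]) = fam_rank (@basis_fam K n _ d (initial_monomials tau J)
   (fun m => gl_act g (gl_act (diag_mx (\row_k v k)) (lead_basis tau J m))) (@trunc K n tau mu d)) by [].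
congr fam_rank; apply/funext => t; apply/funext => b; rewrite /F /basis_fam /trunc.
case: (boolP (mdeg t == d)) => td //=; last by rewrite meval0.
case: (boolP (initial_monomials tau J t)) => Et /=; last by rewrite meval0.
case: ifP => _; last by rewrite meval0.
rewrite (gl_actE (diag_mx _)) (linear_sum (gl_act g)) [RHS]raddf_sum [LHS]raddf_sum /=.
apply: eq_bigr => m2 _; rewrite gl_actZ mcoeffZ mevalZ -mulrA; congr (_ * _).
have -> : gl_act (diag_mx (\row_k v k)) 'X_[m2] = ('X_[m2] : R).@[v] *: 'X_[m2].
  apply/mpolyP => m; rewrite mcoeff_torus mcoeffZ mcoeffX; case: eqP => [<-|_]; last by rewrite mulr0 mul0r.
  by rewrite mulr1 mul1r.
by rewrite gl_actZ mcoeffZ mulrC.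
Qed.

(* Suppose m is in E but m' := m / x_l * x_k is not. For the shear phi that sends x_l
   to x_l + x_k, the truncations to monomials >= m' of phi(x), for x = m or x >= m'
   in E, are independent. So phi composed with a generic diagonal matrix and g has
   more initial monomials >= m' than E, against maximality. *)
Lemma gin_strongly_stable (E : pred 'X_{1..n}) g : g \in unitmx -> inm g = E ->
  (forall g d mu, mdeg mu = d -> g \in unitmx -> (rank_above tau (inm g) d mu <= rank_above tau E d mu)%N) ->
  strongly_stable E.
Proof.
move=> ug gE maxE m k l kl ml Em; apply/negPn/negP => nE.
have kl' : k != l by rewrite neq_ltn kl.
have [an tr tot _ ad] := tau_order.
have /andP[tkl ntkl] := tau_dec kl.
set m' := (_ + _)%MM in nE; pose d := mdeg m.
have m'E : m' = slide k l m 1 by rewrite slideS // slide0.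
have m'd : mdeg m' = d by rewrite m'E mdeg_slide.
have nm'm : ~~ tau m' m.
  apply: contra ntkl => h; have h2 : tau m m' by rewrite m'E -{1}(slide0 k l m); apply: (tau_slide kl' tau_order tkl).
  have e : m' = m by apply: an; rewrite h h2.
  have /mnmP/(_ l) := e; rewrite m'E /slide !(mnmDE, mnmBE, mulmnE, mnm1E) eqxx (negbTE kl'); lia.
pose phi := shear k l (1 : K); pose psi := shear k l (- 1 : K).
have uphi : phi \in unitmx := shear_unit kl' _.
have hJ := gl_act_ideal ug homI.
have [v [v0 le]] := generic_ex K0 (generic_shear_rank d m' hJ uphi).
rewrite gE in le.
have comp : gl_act phi @` (gl_act (diag_mx (\row_k v k)) @` (gl_act g @` I)) =
  gl_act (phi *m (diag_mx (\row_k v k) *m g)) @` I.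
  apply/seteqP; split=> [_ [_ [_ [f If <-] <-] <-]|_ [f If <-]].
    by exists f => //; rewrite !gl_actM mulmxA.
  exists (gl_act (diag_mx (\row_k v k)) (gl_act g f)); last by rewrite !gl_actM mulmxA.
  by exists (gl_act g f) => //; exists f.
rewrite comp in le.
have ucomp : phi *m (diag_mx (\row_k v k) *m g) \in unitmx.
  by rewrite !unitmx_mul uphi torus_unit.
have := leq_trans le (maxE _ d m' m'd ucomp); apply/negP; rewrite -ltnNge.
have md : (mdeg m < d.+1)%N by [].
pose M := BMultinom md.
pose X := [pred x : 'X_{1..n < d.+1} | [&& mdeg x == d, E x & tau m' x]].
pose Y := [predU1 M & X].
have MX : M \notin X by rewrite inE /= (negbTE nm'm) !andbF.
have cY : #|Y| = (rank_above tau E d m').+1 by rewrite cardU1 MX.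
rewrite -cY.
pose G (x b : 'X_{1..n < d.+1}) : K := if x \in Y then trunc tau m' b (gl_act phi 'X_[x]) else 0.
have YE x : x \in Y -> (mdeg x == d) && E x.
  rewrite !inE => /predU1P[->|/and3P[-> -> _] //]; by rewrite /= eqxx Em.
have -> : #|Y| = fam_rank G; last first.
  apply: fam_rank_le => x; rewrite /G; case: (boolP (x \in Y)) => xY; last first.
    by exists (fun=> 0) => b; rewrite big1 // => s _; rewrite mul0r.
  exists (fun s => (s == x)%:R) => b; rewrite (bigD1 x) //= eqxx mul1r big1 ?addr0 => [|s sx].
    by rewrite /basis_fam (YE x xY).
  by rewrite (negbTE sx) mul0r.
apply/esym; apply: fam_rank_free => [x b xY|c H]; first by rewrite /G (negbTE xY).
have phiK f : gl_act psi (gl_act phi f) = f.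
  by rewrite gl_actM shearM // addNr /shear scale0r addr0 gl_act1.
(* Truncation at [m'] leaves the image of each [x] in [X] intact, and removes from that of [m]
   exactly [m] itself, the only slide of [m] below [m']. *)
have ext : \sum_(x in X) c x *: gl_act phi 'X_[x] + c M *: (gl_act phi 'X_[m] - 'X_[m]) = 0 :> R.
  apply/mpolyP => b; rewrite mcoeff0 mcoeffD mcoeffZ mcoeffB raddf_sum /=.
  have coefX x : x \in X -> (gl_act phi 'X_[x])@_b = if tau m' b then (gl_act phi ('X_[x] : R))@_b else 0.
    rewrite inE => /and3P[_ _ m'x]; case: ifP => // /negbT nb; apply/eqP; apply: contraNT nb.
    case/(mcoeff_shear kl') => a al ->; apply: tr m'x _.
    by rewrite -{1}(slide0 k l x); apply: (tau_slide kl' tau_order tkl).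
  have coefM : (gl_act phi 'X_[m])@_b - ('X_[m] : R)@_b = if tau m' b then (gl_act phi ('X_[m] : R))@_b else 0.
    rewrite mcoeffX; case: eqP => [<-|ne].
      rewrite (negbTE nm'm) -{1}(slide0 k l m) mcoeff_shear_slide // expr0 bin0 mulr1n subrr //.
    rewrite subr0; case: ifP => // /negbT nb; apply/eqP; apply: contraNT nb.
    case/(mcoeff_shear kl') => -[|a] al e; first by rewrite e slide0 in ne.
    by rewrite e m'E; apply: (tau_slide kl' tau_order tkl).
  have [lt|ge] := ltnP (mdeg b) d.+1.
    have := H (BMultinom lt); rewrite (bigD1 M) /=; last by rewrite inE eqxx.
    rewrite /G inE eqxx /= /trunc /= coefM addrC => e; rewrite -[RHS]e; congr (_ + _).
    rewrite [RHS](eq_bigl (fun x => x \in X)) => [|x]; last first.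
      by rewrite !inE; case: (eqVneq x M) => [->|_]; rewrite ?andbT //= (negbTE nm'm) !andbF.
    apply: eq_bigr => x xX; rewrite mcoeffZ coefX //.
    have -> : x \in Y by apply/predU1P; right.
    by case: (tau m' b).
  have big0 x : mdeg x = d -> (gl_act phi ('X_[x] : R))@_b = 0.
    move=> xd; apply/eqP; apply: contraTT ge => /(mcoeff_shear kl')[a al ->].
    by rewrite -ltnNge mdeg_slide // xd.
  rewrite coefM big0 // if_same mulr0 addr0 big1 // => x; rewrite inE => /and3P[/eqP xd _ _].
  by rewrite mcoeffZ big0 ?mulr0.
have ext2 : \sum_(x in X) c x *: 'X_[x] + c M *: ('X_[m] - gl_act psi 'X_[m]) = 0 :> R.
  have := congr1 (gl_act psi) ext; rewrite linear0 => e; apply: etrans e.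
  rewrite (linearD (gl_act psi)) (linear_sum (gl_act psi)) /= gl_actZ (linearB (gl_act psi)) /= phiK; congr (_ + _).
  by apply: eq_bigr => x _; rewrite gl_actZ phiK.
(* After the inverse shear, [m'] occurs only in the term of [M], as it is not in [E]. Its
   coefficient there is the exponent [m l], nonzero in characteristic 0. *)
have cM : c M = 0.
  have := congr1 (mcoeff m') ext2; rewrite mcoeff0 mcoeffD raddf_sum big1 /= => [|x]; last first.
    rewrite inE => /and3P[_ Ex _]; rewrite mcoeffZ mcoeffX; case: eqP => [e|_]; last by rewrite mulr0.
    by rewrite -e Ex in nE.
  rewrite add0r mcoeffZ mcoeffB mcoeffX; case: eqP => [e|_].
    by rewrite -e Em in nE.
  rewrite {1}m'E mcoeff_shear_slide // expr1 bin1 sub0r mulNrn opprK => /eqP.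
  by rewrite mulf_eq0 (pcharf0P K).1 // (gtn_eqF ml) orbF => /eqP.
move=> x; rewrite inE => /predU1P[->//|xX].
have := congr1 (mcoeff x) ext2; rewrite mcoeff0 mcoeffD raddf_sum (bigD1 x) //= big1 => [|y /andP[_ yx]].
  by rewrite cM scale0r mcoeff0 !addr0 mcoeffZ mcoeffX eqxx mulr1.
rewrite mcoeffZ mcoeffX; case: eqP => [e|_]; last by rewrite mulr0.
by case/eqP: yx; apply: val_inj.
Qed.

End GinStable.

(** * Koszul homology of a strongly stable ideal *)

Section LastVariables.
Variables (K : fieldType) (n p : nat).
Hypothesis pn : (p <= n)%N.
Local Notation R := {mpoly K[n]}.
Local Notation ext := {ffun {set 'I_p} -> R}.
Local Notation fn := ({set 'I_p} -> 'X_{1..n} -> K).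
Implicit Types (S T : {set 'I_p}) (s t : 'I_p) (m : 'X_{1..n}) (c : fn).

(** Index 0 is $x_n$. With this reversal the least occurring index precedes all of [S], and its
    Koszul sign is 1 ([sgn_first]). *)
Definition last_var s : 'I_n := rev_ord (widen_ord pn s).
Local Notation lv := last_var.

Lemma ltn_last_var s t : (lv s < lv t)%N = (t < s)%N.
Proof.
have hs := leq_trans (ltn_ord s) pn; have ht := leq_trans (ltn_ord t) pn.
by rewrite /= !subnS; lia.
Qed.

Lemma last_var_inj : injective lv.
Proof.
by move=> s t /rev_ord_inj e; apply: val_inj; exact: (congr1 val e).
Qed.

Lemma eq_last_var s t : (lv s == lv t) = (s == t).
Proof. exact: (inj_eq last_var_inj). Qed.

Definition last_forms : 'M[K]_(p, n) := \matrix_(s, l) (l == lv s)%:R.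

Lemma lin_form_last s : lin_form last_forms s = 'X_(lv s).
Proof.
rewrite /lin_form (bigD1 (lv s)) //= mxE eqxx scale1r big1 ?addr0 // => l ls.
by rewrite mxE (negbTE ls) scale0r.
Qed.

(** Invariant under trading $e_s$ for the variable [lv s] ([occursU], [occursD]), so both cells of a
    matched pair have the same first occurring index. *)
Definition occurs S m s := (s \in S) || (0 < m (lv s))%N.
Definition first_occ S m s := occurs S m s && [forall t, occurs S m t ==> (s <= t)%N].

Lemma first_occP S m s : reflect (occurs S m s /\ forall t, occurs S m t -> (s <= t)%N) (first_occ S m s).
Proof.
apply: (iffP andP) => -[h1 h2]; split=> //.
  by move=> t; have /forallP/(_ t)/implyP := h2.
by apply/forallP => t; apply/implyP; exact: h2.
Qed.

Lemma first_occ_uniq S m s t : first_occ S m s -> first_occ S m t -> s = t.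
Proof.
move=> /first_occP[s1 s2] /first_occP[t1 t2]; apply: val_inj; apply/eqP.
by rewrite eqn_leq s2 // t2.
Qed.

Lemma first_occ_exists S m s : occurs S m s -> exists t, first_occ S m t.
Proof.
move=> os; case: (arg_minnP val os) => t ot le; exists t; apply/first_occP; split=> // u /le //.
Qed.

Lemma eq_first_occ S T m m' : occurs S m =1 occurs T m' -> first_occ S m =1 first_occ T m'.
Proof.
move=> e s; rewrite /first_occ e; congr (_ && _); apply: eq_forallb => t; by rewrite e.
Qed.

Lemma occursU S m s : s \notin S -> (0 < m (lv s))%N ->
  occurs (s |: S) (m - U_(lv s))%MM =1 occurs S m.
Proof.
move=> sS ms t; rewrite /occurs !inE mnmBE mnm1E eq_last_var (eq_sym s t).
by case: (eqVneq t s) => [->|_]; rewrite ?ms ?orbT // subn0.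
Qed.

Lemma occursD S m s : s \in S ->
  occurs (S :\ s)%SET (m + U_(lv s))%MM =1 occurs S m.
Proof.
move=> sS t; rewrite /occurs !inE mnmDE mnm1E eq_last_var (eq_sym s t).
by case: (eqVneq t s) => [->|_] /=; rewrite ?sS ?addn1 // addn0.
Qed.

Definition sgn s T : K := (-1) ^+ #|[pred t in T | (t < s)%N]|.

Lemma sgnU s t T : s \notin T -> sgn t (s |: T)%SET = (-1) ^+ (s < t)%N * sgn t T.
Proof. by move=> sT; rewrite /sgn -exprD card_setU1_lt. Qed.

Lemma sgn_first s T : (forall t, t \in T -> (s <= t)%N) -> sgn s T = 1.
Proof.
move=> h; rewrite /sgn eq_card0 // => t; rewrite !inE; apply/negP => /andP[/h st ts].
by rewrite ltnNge st in ts.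
Qed.

Definition kdiff c : fn := fun T m =>
  \sum_(s | s \notin T) sgn s T *
    (if (0 < m (lv s))%N then c (s |: T)%SET (m - U_(lv s))%MM else 0).

Definition khomot c : fn := fun S m =>
  \sum_(s | (s \in S) && first_occ S m s) c (S :\ s)%SET (m + U_(lv s))%MM.

Definition coefs (u : ext) : fn := fun S m => (u S)@_m.

Lemma coefsB (u v : ext) S m : coefs (u - v) S m = coefs u S m - coefs v S m.
Proof. by rewrite /coefs !ffunE mcoeffB. Qed.

Lemma coefs_diff u : coefs (koszul_diff last_forms u) = kdiff (coefs u).
Proof.
apply/funext => T; apply/funext => m; rewrite /coefs /kdiff ffunE raddf_sum /=; apply: eq_bigr => s _.
rewrite lin_form_last -mulrA -[(-1) ^+ _](rmorph_sign (@mpolyC n K)) /= mcoeffCM; congr (_ * _).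
rewrite mulrC; case: ifP => ms.
  have le : (U_(lv s) <= m)%MM by rewrite lep1mP -lt0n.
  by rewrite -{1}(submK le) addmC mcoeffMX.
apply/eqP; rewrite -[_ == 0]negbK -mcoeff_msupp; apply/negP.
rewrite (perm_mem (msuppMX _ _)) => /mapP[m' _ e].
by move: ms; rewrite e mnmDE mnm1E eqxx.
Qed.

Lemma sub_add_comm m s t : (0 < m (lv s))%N -> s != t ->
  (m - U_(lv s) + U_(lv t))%MM = (m + U_(lv t) - U_(lv s))%MM.
Proof.
move=> ms st; apply/mnmP => i; rewrite !(mnmDE, mnmBE, mnm1E).
by case: (eqVneq (lv s) i) => [e|_]; [rewrite -e eq_last_var eq_sym (negbTE st); lia|lia].
Qed.

Section Homotopy.
Variable E : pred 'X_{1..n}.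
Hypothesis upE : up_closed E.
Hypothesis ssE : strongly_stable E.

Definition kquot c : fn := fun S m => if E m then 0 else c S m.

(* Cells of the quotient by E left unmatched when S is paired with S :\ s, where s
   is the largest of the last p variables that occurs in e_S or m (the least
   index, as last_var reverses the order). *)
Definition critical S m :=
  ~~ E m && (~~ [exists s, occurs S m s] ||
             [exists s, [&& s \in S, first_occ S m s & E (m + U_(lv s))%MM]]).

(** Let [s0] be the first occurring index. Its term of the differential returns [c] itself. If [s0]
    is in [S], the other terms of the two composites cancel in pairs, with opposite signs because of
    [s0]; if not, they vanish. *)
Lemma homotopy_identity c S m : (forall T m', E m' -> c T m' = 0) ->
  ~~ E m -> ~~ critical S m ->
  kquot (kdiff (khomot c)) S m + khomot (kquot (kdiff c)) S m = c S m.
Proof.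
move=> cE Em; rewrite /critical Em negb_or negbK => /andP[/existsP[s' /first_occ_exists[s0 f0]] nc].
rewrite /kquot (negbTE Em); have [o0 le0] := first_occP _ _ _ f0.
have uniqf s : first_occ S m s = (s == s0).
  by apply/idP/eqP => [h|-> //]; exact: first_occ_uniq h f0.
have [s0S|s0S] := boolP (s0 \in S).
- have E0 : ~~ E (m + U_(lv s0))%MM.
    apply: contra nc => E0; apply/existsP; exists s0; by rewrite s0S f0 E0.
  rewrite {2}/khomot (big_pred1 s0) => [|s]; last first.
    by rewrite uniqf /=; case: (eqVneq s s0) => [->|]; rewrite ?s0S ?andbF.
  rewrite (negbTE E0) /kdiff [X in _ + X](bigD1 s0) /=; last by rewrite !inE eqxx.
  rewrite mnmDE mnm1E eqxx addn1 /= finset.setD1K // addmK sgn_first; last first.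
    by move=> t; rewrite !inE => /andP[_ tS]; apply: le0; rewrite /occurs tS.
  rewrite mul1r addrCA -[RHS]addr0; congr (_ + _).
  rewrite [X in _ + X](eq_bigl (fun s => s \notin S)) => [|s]; last first.
    by rewrite !inE; case: eqVneq => [->|]; rewrite ?s0S ?andbT.
  rewrite -big_split big1 //= => s sS; have ss0 : s != s0 by apply: contraNneq sS => ->.
  rewrite mnmDE mnm1E eq_last_var eq_sym (negbTE ss0) addn0.
  case: ifP => ms; last by rewrite !mulr0 addr0.
  have s0s : (s0 < s)%N by rewrite ltn_neqAle eq_sym ss0 le0 // /occurs ms orbT.
  rewrite /khomot (big_pred1 s0) => [|t]; last first.
    rewrite (eq_first_occ (occursU sS ms)) uniqf !inE /=; case: (eqVneq t s0) => [->|]; rewrite ?andbF //.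
    by rewrite s0S orbT.
  rewrite -{1}(finset.setD1K s0S) sgnU ?finset.setD11 // s0s expr1 mulN1r mulNr.
  have -> : ((s |: S) :\ s0 = s |: S :\ s0)%SET.
    by apply/setP => x; rewrite !inE; case: (eqVneq x s0) => // ->; rewrite eq_sym (negbTE ss0).
  by rewrite (sub_add_comm ms ss0) addNr.
- rewrite [X in _ + X]big1 => [|s /andP[sS]]; last by rewrite uniqf => /eqP e; rewrite e (negbTE s0S) in sS.
  have ms0 : (0 < m (lv s0))%N by move: o0; rewrite /occurs (negbTE s0S).
  rewrite addr0 /kdiff (bigD1 s0) //= ms0 sgn_first ?mul1r; last first.
    by move=> t tS; apply: le0; rewrite /occurs tS.
  have hf s : s \notin S -> (0 < m (lv s))%N -> khomot c (s |: S)%SET (m - U_(lv s))%MM =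
      if s == s0 then c S m else 0.
    move=> sS ms; rewrite /khomot; case: eqVneq => [e|ne].
      rewrite (big_pred1 s0) => [|t]; last first.
        rewrite (eq_first_occ (occursU sS ms)) uniqf !inE e /=; case: (eqVneq t s0) => [->|]; rewrite ?andbF //.
      rewrite e finset.setU1K // submK //.
      by rewrite lep1mP -lt0n.
    rewrite big1 // => t /andP[+]; rewrite (eq_first_occ (occursU sS ms)) uniqf => + /eqP e.
    by rewrite e !inE eq_sym (negbTE ne) (negbTE s0S).
  rewrite hf // eqxx big1 ?addr0 // => s /andP[sS ss0].
  by case: ifP => ms; rewrite ?mulr0 // hf // (negbTE ss0) mulr0.
Qed.

(** The cell from which the homotopy would start has its first occurring index outside its wedge
    set, so it is not critical. *)
Lemma khomot_critical c : (forall T m, c T m != 0 -> critical T m) -> forall S m, khomot c S m = 0.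
Proof.
move=> cc S m; rewrite /khomot big1 // => s /andP[sS fs]; apply/eqP/negPn/negP => /cc.
have eo := eq_first_occ (occursD m sS).
case/andP => _ /orP[/existsP[]|/existsP[t /and3P[tS ft _]]].
  by exists s; rewrite occursD // /occurs sS.
by move: tS; rewrite (first_occ_uniq fs (etrans (esym (eo t)) ft)) !inE eqxx.
Qed.

(** A critical cell with first index [t] becomes a monomial of [E] when multiplied by the variable
    [lv t]. Multiplication by an earlier variable instead also lands in [E], by strong stability, so
    every term of the differential dies in the quotient. *)
Lemma kdiff_critical c : (forall T m, c T m != 0 -> critical T m) ->
  forall S m, kquot (kdiff c) S m = 0.
Proof.
move=> cc T m; rewrite /kquot; case: ifP => // Em; rewrite /kdiff big1 // => s sT.
case: ifP => ms; rewrite ?mulr0 //; apply/eqP; rewrite mulf_eq0; apply/orP; right.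
apply/negPn/negP => /cc; have eo := occursU sT ms.
case/andP => _ /orP[/existsP[]|/existsP[t /and3P[tT ft Et]]].
  by exists s; rewrite eo /occurs ms orbT.
have [/negP|] := boolP (E m); first by rewrite Em.
case/negP; have [e|ne] := eqVneq t s; first by move: Et; rewrite e submK // lep1mP -lt0n.
have ts : (t < s)%N.
  rewrite ltn_neqAle ne /=; move: ft; rewrite (eq_first_occ eo) => /first_occP[_]; apply.
  by rewrite /occurs ms orbT.
have := ssE (k := lv s) (l := lv t) _ _ Et; rewrite ltn_last_var => /(_ ts).
rewrite mnmDE mnm1E eqxx addn1 => /(_ isT); rewrite addmK submK //.
by rewrite lep1mP -lt0n.
Qed.

Lemma kdiff_q c : kquot (kdiff (kquot c)) = kquot (kdiff c).
Proof.
apply/funext => S; apply/funext => m; rewrite /kquot; case: ifP => // Em.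
apply: eq_bigr => s _; case: ifP => // ms; case: ifP => // E'; rewrite /kdiff.
by move: Em; rewrite -[m](@submK _ (U_(lv s)) m) ?(upE _ E') // lep1mP -lt0n.
Qed.

Hypothesis K0 : [pchar K] =i pred0.

(** Deduced from [koszul_diffK] by cutting [c] off at degree [mdeg m]: only coefficients of at most
    that degree reach the value at [m]. *)
Lemma kdiffK c S m : kdiff (kdiff c) S m = 0.
Proof.
pose u : ext := [ffun S => \sum_(m' : 'X_{1..n < (mdeg m).+1}) c S m' *: 'X_[m']].
have := koszul_diffK last_forms u K0; move=> /(congr1 (fun w => coefs w S m)).
rewrite !coefs_diff /coefs ffunE mcoeff0 => e; rewrite -[RHS]e.
apply: eq_bigr => s _; congr (_ * _); case: ifP => // _.
apply: eq_bigr => t _; congr (_ * _); case: ifP => // _.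
rewrite ffunE mcoeff_mpoly // ltnS.
by apply: leq_trans (mdegB _ _) (mdegB _ _).
Qed.

Lemma kdiffB c1 c2 : kdiff (fun S m => c1 S m - c2 S m) = fun S m => kdiff c1 S m - kdiff c2 S m.
Proof.
apply/funext => S; apply/funext => m; rewrite /kdiff -sumrB; apply: eq_bigr => s _.
by case: ifP; rewrite ?mulrBr // !mulr0 subr0.
Qed.

(* The homotopy makes the quotient complex retract onto the span of the
   critical cells, on which the differential vanishes. *)
Lemma critical_boundary c b : (forall S m, E m -> b S m = 0) ->
  (forall T m, c T m != 0 -> critical T m) -> (forall S m, c S m = kquot (kdiff b) S m) ->
  forall S m, c S m = 0.
Proof.
move=> bE cc cb S m.
have cbE : c = kquot (kdiff b) by apply/funext => T; apply/funext => m'.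
have [Em|Em] := boolP (E m); first by rewrite cb /kquot Em.
pose w : fn := fun S m => b S m - (kquot (kdiff (khomot b)) S m + khomot (kquot (kdiff b)) S m).
have hE T m' : E m' -> khomot c T m' = 0 by move=> _; exact: khomot_critical.
have wc T m' : w T m' != 0 -> critical T m'.
  apply: contraNT => nc; rewrite /w; have [Em'|Em'] := boolP (E m').
    by rewrite -cbE khomot_critical // bE // /kquot Em' addr0 subr0.
  by rewrite homotopy_identity // subrr.
have := kdiff_critical wc S m.
rewrite /w kdiffB (_ : (fun S m => kquot _ S m + khomot _ S m) = kquot (kdiff (khomot b))); last first.
  by apply/funext => T; apply/funext => m'; rewrite -cbE khomot_critical // addr0.
rewrite {1}/kquot (negbTE Em) => /eqP; rewrite subr_eq0 => /eqP e.
have := congr1 (fun f => f S m) (kdiff_q (kdiff (khomot b))).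
rewrite {1 3}/kquot (negbTE Em) kdiffK => e2.
by rewrite cb /kquot (negbTE Em) e e2.
Qed.

Variables (i : nat) (j : int).
Local Notation J := (mono_ideal E : set R).
Local Notation D := (`|j|.+1)%N.
Local Notation cell := ({set 'I_p} * 'X_{1..n < D})%type.

Definition critical_cells : pred cell :=
  [pred t : cell | (t \in cells i) && critical t.1 t.2].

Lemma coords_in_monoP (u : ext) : coords_in J u <-> forall S m, ~~ E m -> coefs u S m = 0.
Proof.
split=> [h S m Em|h S m]; first by apply: memN_msupp_eq0; apply: contra Em; exact: h.
by apply: contraLR => Em; rewrite mcoeff_msupp negbK; apply/eqP; exact: h.
Qed.

Lemma chain_coefs i' (u : ext) S m : koszul_chain i' j u -> coefs u S m != 0 ->
  #|S| = i' /\ (mdeg m + i')%:Z = j.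
Proof. by move=> /koszul_chainP h; rewrite -mcoeff_msupp; exact: h. Qed.

(** The critical cells give a basis: [critical_boundary] yields independence modulo boundaries, and
    a cycle minus the boundary of its homotopy is supported on them. *)
Lemma koszul_last_dim :
  koszul_homology_dim last_forms J i j = #|critical_cells|.
Proof.
have idJ := mono_ideal_ideal K upE.
have hd : has_quot_dim (koszul_cycles last_forms J i j) (koszul_boundaries last_forms J i j) #|critical_cells|.
  pose e (k : 'I_#|critical_cells|) : ext := single (enum_val k).1 'X_[(enum_val k).2].
  have kc (k : 'I_#|critical_cells|) : enum_val k \in cells (n := n) (p := p) (j := j) i /\ critical (enum_val k).1 (enum_val k).2.
    by apply/andP; have h : enum_val k \in critical_cells := enum_valP k; exact: h.
  have ech k : koszul_chain i j (e k) by apply: single_chain; case: (kc k).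
  have eE k S m : coefs (e k) S m = ((S == (enum_val k).1) && (m == (enum_val k).2))%:R.
    by rewrite /coefs ffunE; case: eqP => _; rewrite ?mcoeff0 // mcoeffX eq_sym.
  have sE (a : 'I_#|critical_cells| -> K) S m :
      coefs (\sum_k a k *: e k) S m = \sum_k a k * coefs (e k) S m.
    rewrite /coefs sum_ffunE raddf_sum; apply: eq_bigr => k _ /=.
    by rewrite !ffunE mcoeffZ.
  have sk (a : 'I_#|critical_cells| -> K) (k : 'I_#|critical_cells|) :
      coefs (\sum_k a k *: e k) (enum_val k).1 (enum_val k).2 = a k.
    rewrite sE (bigD1 k) //= eE !eqxx mulr1 big1 ?addr0 // => l lk.
    rewrite eE; case: eqP => [e1|_]; rewrite ?mulr0 //; case: eqP => [e2|_]; rewrite ?mulr0 //.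
    case/eqP: lk; apply: enum_val_inj; move: e1 e2.
    by case: (enum_val k) (enum_val l) => [A m] [B m'] /= -> /val_inj ->.
  have scrit (a : 'I_#|critical_cells| -> K) S m :
      coefs (\sum_k a k *: e k) S m != 0 -> critical S m.
    apply: contraNT => nc; rewrite sE big1 // => k _; rewrite eE.
    case: eqP => [e1|_]; rewrite ?mulr0 //; case: eqP => [e2|_]; rewrite ?mulr0 //.
    by case/negP: nc; rewrite e1 e2; case: (kc k).
  exists e; split.
  - move=> k; split=> //; apply/coords_in_monoP => S m Em.
    have : kquot (kdiff (coefs (e k))) S m = 0.
      apply: kdiff_critical => T m'; rewrite eE.
      case: (T =P _) => [->|_]; last by rewrite eqxx.
      by case: (m' =P _) => [-> _|_]; [case: (kc k)|rewrite eqxx].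
    by rewrite coefs_diff /kquot (negbTE Em).
  - move=> a [_ [v hv /coords_in_monoP Jv]] k; rewrite -(sk a k).
    apply: (@critical_boundary _ (kquot (coefs v))) => [S m Em|T m|S m].
    + by rewrite /kquot Em.
    + exact: scrit.
    + rewrite kdiff_q /kquot; case: ifP => Em.
        by apply/eqP; apply: contraTT Em => /scrit/andP[].
      have := Jv S m (negbT Em); rewrite coefsB => /eqP.
      by rewrite subr_eq0 coefs_diff => /eqP.
  - move=> z [hz /coords_in_monoP Jz].
    pose zc := kquot (coefs z); pose b := khomot zc.
    have zcE T m' : E m' -> zc T m' = 0 by rewrite /zc /kquot => ->.
    have dz T m' : kquot (kdiff zc) T m' = 0.
      rewrite /zc kdiff_q /kquot; case: ifP => // Em.
      by have := Jz T m' (negbT Em); rewrite coefs_diff.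
    have zcell S m : zc S m != 0 -> #|S| = i /\ (mdeg m + i)%:Z = j.
      by rewrite /zc /kquot; case: ifP; rewrite ?eqxx // => _; exact: chain_coefs.
    have bcell S m : b S m != 0 -> #|S| = i.+1 /\ (mdeg m + i.+1)%:Z = j.
      move=> b0; have [s /andP[sS _] zs] : exists2 s, (s \in S) && first_occ S m s &
          zc (S :\ s)%SET (m + U_(lv s))%MM != 0.
        apply: contrapT => no; case/eqP: b0; rewrite /b /khomot big1 // => s hs.
        by apply/eqP/negPn/negP => h; apply: no; exists s.
      have [c1 c2] := zcell _ _ zs; split; first by rewrite (finset.cardsD1 s S) sS c1.
      by rewrite -c2 mdegD mdeg1 addn1 addSnnS.
    pose v : ext := [ffun S => \sum_(m : 'X_{1..n < D}) b S m *: 'X_[m]].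
    have vE : coefs v = b.
      apply/funext => S; apply/funext => m; rewrite /coefs ffunE.
      have [lt|ge] := ltnP (mdeg m) D; first by rewrite mcoeff_mpoly.
      have -> : b S m = 0.
        apply/eqP; apply: contraTT ge => /bcell[_ <-].
        by rewrite -ltnNge absz_nat ltnS leq_addr.
      rewrite raddf_sum big1 //= => m' _; rewrite mcoeffZ mcoeffX; case: eqP => [e'|_]; last by rewrite mulr0.
      by have := bmdeg m'; rewrite e' ltnNge ge.
    have hv : koszul_chain i.+1 j v.
      apply/koszul_chainP => S m; rewrite mcoeff_msupp -/(coefs v S m) vE; exact: bcell.
    (* Since [zc] is a cycle modulo [E], the homotopy identity reads [zc = kquot (kdiff b)] off the
       critical cells. *)
    pose w S m := zc S m - kquot (kdiff b) S m.
    have wcrit S m : ~~ E m -> ~~ critical S m -> w S m = 0.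
      move=> Em nc; have := homotopy_identity zcE Em nc.
      rewrite [X in _ + X](_ : _ = 0) ?addr0 => [h|]; first by rewrite /w -/b -h subrr.
      by rewrite /khomot big1 // => s _; rewrite dz.
    have hdv := koszul_diff_chain last_forms hv.
    have wcell S m : w S m != 0 -> exists t : cell, [/\ t \in cells i, S = t.1 & m = t.2].
      move=> w0; have [c1 c2] : #|S| = i /\ (mdeg m + i)%:Z = j.
        have [/eqP z0|/zcell //] := boolP (zc S m == 0).
        move: w0; rewrite /w z0 sub0r oppr_eq0 /kquot; case: ifP; rewrite ?eqxx // => _.
        by rewrite -vE -coefs_diff => /(chain_coefs hdv).
      have lt : (mdeg m < D)%N by rewrite -c2 absz_nat ltnS leq_addr.
      by exists (S, BMultinom lt); split; rewrite // unfold_in /cells /= c1 c2 !eqxx.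
    exists (fun k : 'I_#|critical_cells| => w (enum_val k).1 (enum_val k).2).
    set Y := \sum_k _.
    have Ych : koszul_chain i j Y by apply: koszul_chain_sum => k _; exact: ech.
    split; first exact: koszul_chainB.
    exists v => //; apply/coords_in_monoP => S m Em.
    have YE : coefs Y S m = w S m.
      have [cr|nc] := boolP (critical S m); last first.
        rewrite wcrit //; apply/eqP; apply: contraNT nc; exact: scrit.
      have [w0|/eqP w0] := eqVneq (w S m) 0; last first.
        have [t [tc e1 e2]] := wcell S m (introN eqP w0).
        have tcc : t \in critical_cells by apply/andP; rewrite -e1 -e2.
        by rewrite e1 e2 -(enum_rankK_in tcc tcc) sk.
      rewrite w0 sE big1 // => k _; rewrite eE; case: eqP => [e1|_]; last by rewrite mulr0.
      by case: eqP => [e2|_]; rewrite ?mulr0 // -e1 -e2 w0 mul0r.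
    rewrite !coefsB coefs_diff vE YE.
    by rewrite /w /zc /kquot (negbTE Em) opprB addrCA subrr addr0 subrr.
apply: (has_quot_dim_uniq _ (xgetPex 0%N (ex_intro _ _ hd)) hd).
move=> m c x xB; split; first by apply: koszul_chain_sum => k _; case: (xB k).
have ex k : exists v, koszul_chain i.+1 j v /\ coords_in J (x k - koszul_diff last_forms v).
  by have [_ [v ? ?]] := xB k; exists v.
have [v vP] := choice ex.
exists (\sum_k c k *: v k); first by apply: koszul_chain_sum => k _; case: (vP k).
have -> : \sum_k c k *: x k - koszul_diff last_forms (\sum_k c k *: v k) =
          \sum_k c k *: (x k - koszul_diff last_forms (v k)).
  rewrite linear_sum -sumrB; apply: eq_bigr => k _.
  by rewrite linearZ /= scalerBr.
move=> S; rewrite sum_ffunE (eq_bigr (fun k => c k *: (x k - koszul_diff last_forms (v k)) S)).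
  by apply: (ideal_sum idJ) => k _; case: (vP k) => _; apply.
by move=> k _; rewrite ffunE.
Qed.

End Homotopy.
End LastVariables.

(** * Gauss elimination on the linear forms *)

Section GenericIsLast.
Variables (K : fieldType) (n p : nat).
Hypothesis K0 : [pchar K] =i pred0.
Hypothesis pn : (p <= n)%N.
Variable E : pred 'X_{1..n}.
Hypothesis upE : up_closed E.
Hypothesis ssE : strongly_stable E.
Variables (i : nat) (j : int).
Local Notation R := {mpoly K[n]}.
Local Notation J := (mono_ideal E : set R).
Local Notation h A := (koszul_homology_dim (A : 'M[K]_(p, n)) J i j).
Local Notation lv := (last_var pn).
Local Notation Lf := (last_forms K pn).

Lemma mono_ideal_gl (g g' : 'M[K]_n) : cancel (gl_act g') (gl_act g) ->
  (forall m, E m -> J (gl_act g 'X_[m])) -> (forall m, E m -> J (gl_act g' 'X_[m])) ->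
  gl_act g @` J = J.
Proof.
have sub a : (forall m, E m -> J (gl_act a 'X_[m])) -> forall f, J f -> J (gl_act a f).
  move=> H f Jf; rewrite gl_actE big_seq; apply: (ideal_sum (mono_ideal_ideal K upE)) => m mf.
  by apply: H; exact: Jf.
move=> gK /sub h1 /sub h2; apply/seteqP; split=> [_ [f Jf <-]|f Jf]; first exact: h1.
by exists (gl_act g' f); [exact: h2|exact: gK].
Qed.

Lemma slide_stable (k l : 'I_n) (m : 'X_{1..n}) a : (k < l)%N -> (a <= m l)%N -> E m -> E (slide k l m a).
Proof.
move=> kl; have kl' : k != l by rewrite neq_ltn kl.
elim: a => [|a IH] am Em; first by rewrite slide0.
rewrite slideS //; apply: ssE => //; last by apply: IH => //; apply: ltnW.
by rewrite /slide !(mnmDE, mnmBE, mulmnE, mnm1E) eqxx (negbTE kl'); lia.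
Qed.

(** Adding a multiple of a column to an earlier one comes from replacing $x_l$ by $x_l+c x_k$ with
    $k<l$. This preserves a strongly stable ideal, since only slides towards $x_k$ arise. *)
Lemma column_shear (A : 'M[K]_(p, n)) (k l : 'I_n) c : (k < l)%N ->
  h (A *m (shear k l c)^T) = h A.
Proof.
move=> kl; have kl' : k != l by rewrite neq_ltn kl.
rewrite [RHS](koszul_gl A J i j (shear_unit kl' c)) (@mono_ideal_gl _ (shear k l (- c))) //.
- by move=> f; rewrite gl_actM shearM // subrr /shear scale0r addr0 gl_act1.
- move=> m Em b; rewrite mcoeff_msupp => /(mcoeff_shear kl')[a al ->]; exact: slide_stable.
- move=> m Em b; rewrite mcoeff_msupp => /(mcoeff_shear kl')[a al ->]; exact: slide_stable.
Qed.

Lemma column_scale (A : 'M[K]_(p, n)) (v : 'I_n -> K) : (forall l, v l != 0) ->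
  h (A *m (diag_mx (\row_k v k))) = h A.
Proof.
move=> v0; have u := torus_unit v0.
rewrite [RHS](koszul_gl A J i j u) tr_diag_mx.
have vK : cancel (gl_act (diag_mx (\row_k (v k)^-1))) (gl_act (diag_mx (\row_k v k))).
  move=> f; apply/mpolyP => m; rewrite !mcoeff_torus -mulrA !mevalX -big_split big1 ?mulr1 // => l _.
  by rewrite /= -exprMn mulVf // expr1n.
have T a m : E m -> J (gl_act (diag_mx (\row_k a k)) 'X_[m]).
  move=> Em b; rewrite mcoeff_msupp mcoeff_torus mcoeffX; case: (m =P b) => [<- //|_].
  by rewrite mul0r eqxx.
by rewrite (mono_ideal_gl vK) // => m; exact: T.
Qed.

Lemma row_shearE m (A : 'M[K]_(p, m)) (s r : 'I_p) c a b :
  (shear s r c *m A) a b = A a b + (if a == s then c * A r b else 0).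
Proof.
rewrite /shear mulmxDl mul1mx -scalemxAl !mxE; congr (_ + _).
rewrite (bigD1 r) //= !mxE eqxx andbT big1 ?addr0 => [|t tr].
  by case: eqP; rewrite ?mul1r // mul0r mulr0.
by rewrite !mxE (negbTE tr) andbF mul0r.
Qed.

Lemma row_shear (A : 'M[K]_(p, n)) (s r : 'I_p) c : s != r -> h (shear s r c *m A) = h A.
Proof.
move=> sr; have rs : r != s by rewrite eq_sym.
rewrite -[RHS](koszul_row_add A c i j rs (mono_ideal_ideal K upE)).
rewrite (_ : shear s r c *m A = \matrix_(k, l) (A k l + (if k == s then c * A r l else 0))) //.
by apply/matrixP => a b; rewrite row_shearE !mxE.
Qed.

Lemma mul_lastE (A : 'M[K]_(p, n)) s t : (A *m Lf^T) s t = A s (lv t).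
Proof.
rewrite mxE (bigD1 (lv t)) //= !mxE eqxx mulr1 big1 ?addr0 // => l ne.
by rewrite !mxE (negbTE ne) mulr0.
Qed.

(* Progress of Gauss elimination: the first k of the last p columns are diagonal. *)
Definition reduced (A : 'M[K]_(p, n)) k := A *m Lf^T \in unitmx /\
  forall t : 'I_p, (t < k)%N -> A t (lv t) != 0 /\ forall s, s != t -> A s (lv t) = 0.

Lemma clear_column (A : 'M[K]_(p, n)) (k : 'I_p) (r : seq 'I_p) :
  reduced A k -> A k (lv k) != 0 -> uniq r -> k \notin r ->
  exists A', [/\ h A' = h A, reduced A' k, A' k (lv k) != 0 &
     forall s, A' s (lv k) = if s \in r then 0 else A s (lv k)].
Proof.
move=> red Ak; elim: r => [|s r IH]; first by move=> _ _; exists A.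
rewrite cons_uniq in_cons negb_or => /andP[sr ur] /andP[ks kr].
have [A' [hA [uA rA] A'k A'c]] := IH ur kr.
have sk : s != k by rewrite eq_sym.
pose c := - (A' s (lv k) / A' k (lv k)).
exists (shear s k c *m A'); split.
- by rewrite row_shear.
- split; first by rewrite -mulmxA unitmx_mul shear_unit.
  move=> t tk; have [h1 h2] := rA t tk; have kt : k != t by rewrite neq_ltn tk orbT.
  split; first by rewrite row_shearE (h2 k kt) mulr0 if_same addr0.
  by move=> a at'; rewrite row_shearE (h2 k kt) mulr0 if_same addr0 h2.
- by rewrite row_shearE (negbTE ks) addr0.
- move=> a; rewrite row_shearE in_cons; case: (eqVneq a s) => [->|as'] /=.
    have -> : c * A' k (lv k) = - A' s (lv k) by rewrite /c mulNr divfK.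
    by rewrite subrr.
  by rewrite addr0.
Qed.

Lemma reduce_step (A : 'M[K]_(p, n)) (k : 'I_p) : reduced A k ->
  exists A', h A' = h A /\ reduced A' k.+1.
Proof.
move=> redA; have [uA rA] := redA.
have [A1 [h1 red1 A1k]] : exists A1, [/\ h A1 = h A, reduced A1 k & A1 k (lv k) != 0].
  have [Ak|Ak] := eqVneq (A k (lv k)) 0; last by exists A.
  have [r kr Ar] : exists2 r : 'I_p, (k < r)%N & A r (lv k) != 0.
    apply: contrapT => no.
    have A0 (r : 'I_p) : (k <= r)%N -> A r (lv k) = 0.
      rewrite leq_eqVlt => /orP[/eqP/val_inj <- //|kr].
      by apply/eqP/negPn/negP => ne; apply: no; exists r.
    (* Without a pivot, column [k] would be a combination of the earlier, already diagonal columns;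
       [y] is the resulting kernel vector, against invertibility. *)
    pose y : 'cV[K]_p := \col_t (if (t < k)%N then A t (lv k) / A t (lv t) else if t == k then -1 else 0).
    have : (A *m Lf^T) *m y = 0.
      apply/colP => s; rewrite !mxE.
      rewrite (eq_bigr (fun t => A s (lv t) * y t 0)); last by move=> t _; rewrite mul_lastE.
      rewrite (bigD1 k) //= [y k 0]mxE ltnn eqxx mulrN1.
      have z t : t != k -> t != s -> A s (lv t) * y t 0 = 0.
        move=> tk ts; rewrite mxE (negbTE tk); case: ltnP => lt; last by rewrite mulr0.
        by rewrite (rA t lt).2 ?mul0r // eq_sym.
      have [sk|ks] := ltnP s k.
        have nsk : s != k by rewrite neq_ltn sk.
        rewrite (bigD1 s) //= big1 ?addr0 => [|t /andP[tk ts]]; last exact: z.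
        rewrite [y s 0]mxE sk mulrC divfK ?addNr //; exact: (rA s sk).1.
      rewrite A0 // oppr0 add0r big1 // => t tk.
      have [e|] := eqVneq t s; last exact: z.
      by rewrite mxE (negbTE tk) e ltnNge ks mulr0.
    move/(congr1 (mulmx (invmx (A *m Lf^T)))); rewrite mulKmx // mulmx0 => /colP/(_ k).
    by rewrite !mxE ltnn eqxx => /eqP; rewrite oppr_eq0 oner_eq0.
  have kr' : k != r by rewrite neq_ltn kr.
  exists (shear k r 1 *m A); split.
  - by rewrite row_shear.
  - split; first by rewrite -mulmxA unitmx_mul shear_unit.
    move=> t tk; have [g1 g2] := rA t tk.
    have tr : r != t by rewrite neq_ltn (ltn_trans tk kr) orbT.
    split; first by rewrite row_shearE (g2 r tr) mulr0 if_same addr0.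
    by move=> a at'; rewrite row_shearE (g2 r tr) mulr0 if_same addr0 g2.
  - by rewrite row_shearE eqxx Ak add0r mul1r.
have [|A2 [h2 [u2 r2] A2k A2c]] := clear_column (r := [seq s <- enum 'I_p | s != k]) red1 A1k (filter_uniq _ (enum_uniq _)).
  by rewrite mem_filter eqxx.
exists A2; split; first by rewrite h2.
split; first exact: u2.
move=> t; rewrite ltnS leq_eqVlt => /orP[/eqP/val_inj ->|]; last exact: r2.
by split=> // s sk; rewrite A2c mem_filter sk mem_enum.
Qed.

Lemma reduce_rows (A : 'M[K]_(p, n)) : A *m Lf^T \in unitmx -> exists A', h A' = h A /\ reduced A' p.
Proof.
move=> uA; suff H k : (k <= p)%N -> exists A', h A' = h A /\ reduced A' k by exact: H.
elim: k => [|k IH] kp; first by exists A; split.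
have [A' [h1 red]] := IH (ltnW kp).
have [A'' [h2 red']] := @reduce_step A' (Ordinal kp) red.
by exists A''; split; [exact: etrans h2 h1|exact: red'].
Qed.

Lemma clear_entries (A : 'M[K]_(p, n)) (r : seq ('I_p * 'I_n)) : reduced A p ->
  (forall x, x \in r -> forall t, x.2 != lv t) -> (forall x, x \in r -> (x.2 < lv x.1)%N) -> uniq r ->
  exists A', [/\ h A' = h A, reduced A' p, (forall s t, A' s (lv t) = A s (lv t)) &
     forall s k, (forall t, k != lv t) -> A' s k = if (s, k) \in r then 0 else A s k].
Proof.
move=> red; elim: r => [|[s k] r IH] nl lt; first by move=> _; exists A.
rewrite cons_uniq => /andP[skr ur].
have [||//|A' [hA' redA' A'l A'e]] := IH.
- by move=> x xr; apply: nl; rewrite in_cons xr orbT.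
- by move=> x xr; apply: lt; rewrite in_cons xr orbT.
have kl : (k < lv s)%N by have := lt (s, k); rewrite mem_head => /(_ isT).
have nk t : k != lv t by have := nl (s, k); rewrite mem_head => /(_ isT).
have [A's A's0] := redA'.2 s (ltn_ord s).
pose c := - (A' s k / A' s (lv s)).
have BE a b : (A' *m (shear k (lv s) c)^T) a b = A' a b + (if b == k then c * A' a (lv s) else 0).
  rewrite /shear linearD /= trmx1 mulmxDr mulmx1 linearZ /= trmx_delta -scalemxAr !mxE; congr (_ + _).
  rewrite (bigD1 (lv s)) //= !mxE eqxx big1 ?addr0 => [|l ls]; last by rewrite !mxE (negbTE ls) mulr0.
  by case: eqP; rewrite ?mulr1 // !mulr0.
have Bl a t : (A' *m (shear k (lv s) c)^T) a (lv t) = A' a (lv t).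
  by rewrite BE eq_sym (negbTE (nk t)) addr0.
exists (A' *m (shear k (lv s) c)^T); split.
- by rewrite column_shear.
- split; last by move=> t tp; rewrite Bl; split=> [|a]; [exact: (redA'.2 t tp).1|rewrite Bl; exact: (redA'.2 t tp).2].
  rewrite (_ : _ *m _ = A' *m Lf^T); first exact: redA'.1.
  by apply/matrixP => a b; rewrite !mul_lastE Bl.
- by move=> a t; rewrite Bl.
- move=> a b nb; rewrite BE in_cons xpair_eqE A'e //; case: (eqVneq b k) => [->|bk].
    case: (eqVneq a s) => [->|as'] /=; last by rewrite A's0 // mulr0 addr0.
    have -> : c * A' s (lv s) = - A' s k by rewrite /c mulNr divfK.
    by rewrite A'e // (negbTE skr) subrr.
  by rewrite andbF addr0.
Qed.

(** Row operations, which keep the span of the forms, make the last [p] columns diagonal. Column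
    shears from these pivots clear all other columns, and a diagonal change of variables turns the
    pivots into 1. *)
Lemma unit_last (A : 'M[K]_(p, n)) : A *m Lf^T \in unitmx -> h A = h Lf.
Proof.
move=> /reduce_rows[A1 [<- red1]].
pose r := [seq x <- enum [set: 'I_p * 'I_n]%SET | [forall t, x.2 != lv t] & (x.2 < lv x.1)%N].
have [|||A2 [<- [u2 red2] A2l A2e]] := clear_entries (r := r) red1.
- by move=> x; rewrite mem_filter => /andP[/andP[/forallP]].
- by move=> x; rewrite mem_filter => /andP[/andP[]].
- by rewrite filter_uniq ?enum_uniq.
have A2E s k : A2 s k = if k == lv s then A2 s (lv s) else 0.
  case: eqVneq => [->//|ks]; have [/existsP[t /eqP e]|] := boolP [exists t, k == lv t].
    rewrite e; apply: (red2 t (ltn_ord t)).2; apply: contraNneq ks => ->; by rewrite e.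
  rewrite negb_exists => nk; rewrite A2e; last by move=> t; have /forallP := nk; apply.
  (* A column other than the last [p] lies to the left of all of them, so a column shear in the
     permitted direction could clear it. *)
  rewrite mem_filter mem_enum inE nk andbT /=; case: ltnP => // le; exfalso.
  have /forallP nk' := nk.
  have hk := ltn_ord k; have hs := ltn_ord s.
  have tp : (n - k.+1 < p)%N by move: le; rewrite /= ; lia.
  have := nk' (Ordinal tp); case/eqP; apply: val_inj; rewrite /=; lia.
pose v l := if [pick t | l == lv t] is Some t then A2 t (lv t) else 1.
have vl t : v (lv t) = A2 t (lv t).
  rewrite /v; case: pickP => [t' /eqP/last_var_inj <- //|/(_ t)]; by rewrite eqxx.
have v0 l : v l != 0.
  rewrite /v; case: pickP => [t _|_]; last exact: oner_neq0.
  exact: (red2 t (ltn_ord t)).1.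
rewrite -(column_scale Lf v0).
suff -> : A2 = Lf *m diag_mx (\row_k v k) by [].
apply/matrixP => s k; rewrite A2E mxE (bigD1 k) //= !mxE eqxx mulr1n big1 ?addr0 => [|l lk].
  by case: eqP => [->|_]; rewrite ?mul1r ?vl // mul0r.
by rewrite !mxE (negbTE lk) mulr0n mulr0.
Qed.

Lemma betti_last : koszul_betti J i j p = h Lf.
Proof.
have g1 := betti_generic p K0 (mono_ideal_ideal K upE) (mono_basis K E) i j.
have pd : polyfn (fun v : 'I_(p * n) -> K => \det (@vec_mx K p n (\row_k v k) *m Lf^T)).
  apply: polyfn_det; apply: polyfn_mulmx; first exact: polyfn_entry.
  by move=> a b; exact: polyfn_cst.
have g2 := @generic_polyfn _ _ _ (mxvec Lf 0) pd.
rewrite (_ : vec_mx _ = Lf) in g2; last first.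
  by rewrite (_ : \row_k _ = mxvec Lf) ?mxvecK //; apply/rowP => k; rewrite mxE.
rewrite (_ : Lf *m Lf^T = 1%:M) ?det1 ?oner_neq0 in g2; last first.
  by apply/matrixP => s t; rewrite mul_lastE !mxE eq_last_var eq_sym.
have [v [<- dv]] := generic_ex K0 (generic_and g1 (g2 isT)).
by apply: unit_last; rewrite unitmxE unitfE.
Qed.

End GenericIsLast.

(** * Bigatti's comparison with the lex segment *)

Section MonomialCounts.
Variable n : nat.
Implicit Types (m x y z w : 'X_{1..n}) (P Q B Y : pred 'X_{1..n}) (d v k : nat).

Definition mons d : seq 'X_{1..n} :=
  [seq m <- map val (enum {: 'X_{1..n < d.+1}}) | mdeg m == d].

Definition cnt P d := count P (mons d).

Lemma mem_mons d m : (m \in mons d) = (mdeg m == d).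
Proof.
rewrite mem_filter; case: eqVneq => //= <-.
have lt : (mdeg m < (mdeg m).+1)%N by [].
by apply/mapP; exists (BMultinom lt); rewrite ?mem_enum.
Qed.

Lemma mons_uniq d : uniq (mons d).
Proof. by apply: filter_uniq; rewrite map_inj_uniq; [exact: enum_uniq|exact: val_inj]. Qed.

Lemma mem_filter_mons P d m : (m \in [seq x <- mons d | P x]) = P m && (mdeg m == d).
Proof. by rewrite mem_filter mem_mons. Qed.

Lemma cnt_inj P Q d d' (f : 'X_{1..n} -> 'X_{1..n}) :
  (forall m, mdeg m = d -> P m -> mdeg (f m) = d' /\ Q (f m)) ->
  (forall m m', mdeg m = d -> mdeg m' = d -> P m -> P m' -> f m = f m' -> m = m') ->
  (cnt P d <= cnt Q d')%N.
Proof.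
move=> h inj; rewrite /cnt -!size_filter -(size_map f); apply: uniq_leq_size.
  rewrite map_inj_in_uniq ?(filter_uniq _ (mons_uniq d)) // => m m'.
  by rewrite !mem_filter_mons => /andP[Pm /eqP md] /andP[Pm' /eqP md']; apply: inj.
move=> _ /mapP[m + ->]; rewrite !mem_filter_mons => /andP[Pm /eqP md].
by have [-> ->] := h m md Pm; rewrite eqxx.
Qed.

Lemma cnt_sub P Q d : (forall m, mdeg m = d -> P m -> Q m) -> (cnt P d <= cnt Q d)%N.
Proof. by move=> h; apply: (cnt_inj (f := id)) => // m md Pm; split=> //; apply: h. Qed.

Lemma eq_cnt P Q d : (forall m, mdeg m = d -> P m = Q m) -> cnt P d = cnt Q d.
Proof. by move=> h; apply/eqP; rewrite eqn_leq !cnt_sub // => m md; rewrite h. Qed.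

Lemma cnt_lt P Q d w : mdeg w = d -> (forall m, mdeg m = d -> P m -> Q m) -> Q w -> ~~ P w ->
  (cnt P d < cnt Q d)%N.
Proof.
move=> wd h Qw Pw; rewrite /cnt -!size_filter -(size_map id) -[(size _).+1]/(size (w :: map id _)).
rewrite map_id; apply: uniq_leq_size; rewrite /= ?(filter_uniq _ (mons_uniq d)) ?andbT.
  by rewrite mem_filter_mons (negbTE Pw).
move=> m; rewrite inE => /predU1P[->|]; rewrite !mem_filter_mons ?Qw ?wd ?eqxx //.
by move=> /andP[Pm /eqP md]; rewrite md eqxx h.
Qed.

Lemma cnt_predI P Q d : cnt P d = (cnt (fun m => P m && Q m) d + cnt (fun m => P m && ~~ Q m) d)%N.
Proof.
by rewrite /cnt; elim: (mons d) => //= x s ->; case: (P x); case: (Q x) => /=; lia.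
Qed.

Lemma cnt_partition P d N (g : 'X_{1..n} -> nat) :
  (forall m, mdeg m = d -> P m -> (g m < N)%N) ->
  cnt P d = (\sum_(k < N) cnt (fun m => P m && (g m == k)) d)%N.
Proof.
elim: N P => [|N IH] P h.
  rewrite big_ord0; apply/eqP; rewrite -leqn0 -(count_pred0 (mons d)).
  by apply: cnt_sub => m md /(h m md).
rewrite big_ord_recr /= (cnt_predI P (fun m => g m != N)) (IH (fun m => P m && (g m != N))).
  congr (_ + _)%N; last by apply: eq_cnt => m _; rewrite negbK.
  apply: eq_bigr => k _; apply: eq_cnt => m _; rewrite -andbA; congr (_ && _).
  by case: (g m =P k) => [->|_]; rewrite ?andbF // andbT ltn_eqF.
by move=> m md /andP[/(h m md)]; rewrite ltnS leq_eqVlt => /predU1P[->|//]; rewrite eqxx.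
Qed.

Lemma degree_countE P d : degree_count P d = cnt P d.
Proof.
rewrite /degree_count /cnt count_filter count_map cardE size_filter -enumT.
by apply: eq_count => m /=; rewrite inE andbC.
Qed.

Definition supp_lt v m := [forall i : 'I_n, (v <= i)%N ==> (m i == 0%N)].

Lemma supp_ltP v m : reflect (forall i : 'I_n, (v <= i)%N -> m i = 0%N) (supp_lt v m).
Proof.
apply: (iffP forallP) => h i; first by move=> vi; have /implyP/(_ vi)/eqP := h i.
by apply/implyP => /h ->.
Qed.

Lemma supp_lt_leq v v' m : (v <= v')%N -> supp_lt v m -> supp_lt v' m.
Proof. by move=> vv /supp_ltP h; apply/supp_ltP => i vi; apply: h; apply: leq_trans vi. Qed.

Lemma supp_lt_n m : supp_lt n m.
Proof. by apply/supp_ltP => i; rewrite leqNgt ltn_ord. Qed.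

Lemma mdeg_lt_pointwise m m' (i : 'I_n) : (forall t, (m t <= m' t)%N) -> (m i < m' i)%N ->
  (mdeg m < mdeg m')%N.
Proof.
move=> h hi; rewrite !mdegE (bigD1 i) //= [X in (_ < X)%N](bigD1 i) //= -addSn.
by apply: leq_add => //; apply: leq_sum.
Qed.

Lemma mdeg_move m (k l : 'I_n) : (0 < m l)%N -> mdeg (m - U_(l) + U_(k))%MM = mdeg m.
Proof.
move=> ml; have le : (U_(l) <= m)%MM by rewrite lep1mP -lt0n.
by rewrite -[in RHS](submK le) !mdegD !mdeg1.
Qed.

Lemma ltmc_move m (k l : 'I_n) : (k < l)%N -> (0 < m l)%N -> (m < (m - U_(l) + U_(k))%MM)%O.
Proof.
move=> kl ml; apply/ltmcP; first by rewrite mdeg_move.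
exists k => [t tk|]; rewrite !(mnmDE, mnmBE, mnm1E).
  have -> : (l == t) = false by apply/negbTE; rewrite neq_ltn (ltn_trans tk kl) orbT.
  have -> : (k == t) = false by apply/negbTE; rewrite neq_ltn tk orbT.
  by rewrite subn0 addn0.
have -> : (l == k) = false by apply/negbTE; rewrite neq_ltn kl orbT.
by rewrite eqxx subn0 addn1.
Qed.

(* Dividing by the largest variable turns z + x_q >= x + x_v into z >= x. *)
Lemma lemc_divide z x (q l : 'I_n) : mdeg z = mdeg x -> supp_lt q.+1 z -> (q <= l)%N ->
  ((x + U_(l))%MM <= (z + U_(q))%MM)%O -> (x <= z)%O.
Proof.
move=> deg zs ql le; rewrite leNgt; apply: contraTN le => /(ltmcP deg)[i eqi lti].
rewrite -ltNge; have [iq|qi] := ltnP i q.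
  apply/ltmcP; first by rewrite !mdegD !mdeg1 deg.
  have nq (t : 'I_n) : (t < q)%N -> (q == t :> 'I_n) = false /\ (l == t :> 'I_n) = false.
    by move=> tq; split; apply/negbTE; rewrite neq_ltn ?tq ?(leq_trans tq ql) orbT.
  exists i => [t ti|]; rewrite !mnmDE !mnm1E.
    by have [-> ->] := nq t (ltn_trans ti iq); rewrite eqi.
  by have [-> ->] := nq i iq; rewrite !addn0.
have := @mdeg_lt_pointwise z x i; rewrite deg ltnn => H; suff : false by [].
apply: H => // t; have [ti|it|/val_inj ->] := ltngtP t i; first by rewrite eqi.
  by have /supp_ltP -> := zs; rewrite //; apply: leq_ltn_trans qi it.
exact: ltnW.
Qed.

(** [cnt (restr v B) d] is the number $M_v(d)$ in Bigatti's theorem. *)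
Definition restr v B m := B m && supp_lt v m.

Lemma cnt_last_var v B d (l : 'I_n) : nat_of_ord l = v ->
  cnt (fun m => restr v.+1 B m && ~~ supp_lt v m) d.+1 =
  cnt (fun m => supp_lt v.+1 m && B (m + U_(l))%MM) d.
Proof.
move=> lv; apply/eqP; rewrite eqn_leq; apply/andP; split.
  apply: (cnt_inj (f := fun m => (m - U_(l))%MM)) => [m md /andP[/andP[Bm sm] ns]|m m' md md' /andP[/andP[_ sm] ns] /andP[/andP[_ sm'] ns'] e].
    have ml : (U_(l) <= m)%MM.
      rewrite lep1mP; apply: contraNneq ns => m0; apply/supp_ltP => i; rewrite leq_eqVlt => /predU1P[e|]; last by move/supp_ltP: sm; apply.
      by have -> : i = l by apply: ord_inj; rewrite lv.
    split; first by rewrite -(submK ml) mdegD mdeg1 addn1 in md; case: md.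
    rewrite submK // Bm andbT; apply/supp_ltP => i /(supp_ltP _ _ sm) mi.
    by rewrite mnmBE mi.
  have hl x : supp_lt v.+1 x -> ~~ supp_lt v x -> (U_(l) <= x)%MM.
    move=> sx nx; rewrite lep1mP; apply: contraNneq nx => m0; apply/supp_ltP => i; rewrite leq_eqVlt => /predU1P[e'|]; last by move/supp_ltP: sx; apply.
    by have -> : i = l by apply: ord_inj; rewrite lv.
  by rewrite -(submK (hl _ sm ns)) e submK // hl.
apply: (cnt_inj (f := fun m => (m + U_(l))%MM)) => [m md /andP[sm Bm]|m m' _ _ _ _]; last exact: addIm.
split; first by rewrite mdegD mdeg1 md addn1.
rewrite /restr Bm /=; apply/andP; split.
  apply/supp_ltP => i vi; rewrite mnmDE (supp_ltP _ _ sm _ vi) mnm1E.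
  by rewrite (_ : l == i = false) //; apply/eqP => e; move: vi; rewrite -e lv ltnn.
apply/negP => /supp_ltP/(_ l); rewrite lv mnmDE mnm1E eqxx => /(_ (leqnn _)).
by rewrite addn1.
Qed.

End MonomialCounts.

Section Bigatti.
Variable n : nat.
Implicit Types (m x y z w : 'X_{1..n}) (P Q B Y X : pred 'X_{1..n}) (d v k : nat).

Lemma supp_lt0 m : supp_lt 0 m -> m = 0%MM.
Proof. by move=> /supp_ltP h; apply/mnmP => i; rewrite h // mnm0E. Qed.

Lemma cnt_eq0 P d : (forall m, mdeg m = d -> ~~ P m) -> cnt P d = 0%N.
Proof.
move=> h; apply/eqP; rewrite -leqn0 -(count_pred0 (mons n d)); apply: cnt_sub => m md.
by rewrite (negbTE (h m md)).
Qed.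

Lemma cnt_restr0 Y d : cnt (restr 0 Y) d.+1 = 0%N.
Proof.
apply: cnt_eq0 => m md; apply/negP => /andP[_ /supp_lt0 m0].
by rewrite m0 mdeg0 in md.
Qed.

Lemma cnt_restrS v Y d (l : 'I_n) : nat_of_ord l = v ->
  cnt (restr v.+1 Y) d.+1 =
  (cnt (restr v Y) d.+1 + cnt (fun m => supp_lt v.+1 m && Y (m + U_(l))%MM) d)%N.
Proof.
move=> lv; rewrite (cnt_predI _ (supp_lt v)) -(cnt_last_var Y d lv); congr (_ + _)%N.
apply: eq_cnt => m _; rewrite /restr -andbA; congr (_ && _).
by apply/andP/idP => [[]//|h]; split=> //; apply: supp_lt_leq h.
Qed.

(** Sort the monomials of [Y] by their last variable and divide by it. *)
Lemma shadow_upper v X Y d : (v <= n)%N ->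
  (forall (l : 'I_n) z, (l < v)%N -> mdeg z = d -> supp_lt l.+1 z -> Y (z + U_(l))%MM -> X z) ->
  (cnt (restr v Y) d.+1 <= \sum_(k < v) cnt (restr k.+1 X) d)%N.
Proof.
elim: v => [|v IH] vn h; first by rewrite cnt_restr0.
rewrite big_ord_recr /= (@cnt_restrS v Y d (Ordinal vn)) //; apply: leq_add.
  apply: IH; first exact: ltnW.
  by move=> l z lv; apply: h; apply: ltnW.
by apply: cnt_sub => z zd /andP[zs Yz]; rewrite /restr zs andbT; apply: h Yz.
Qed.

(** Multiplying [z] by variables from its last one on produces every product once, the last factor
    being recoverable as the last variable. So the shadow of a strongly stable set has at least
    $\sum_k M_k$ elements, the upper bound available for lex segments. *)
Lemma shadow_lower v X Y d : (v <= n)%N ->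
  (forall (l : 'I_n) z, (l < v)%N -> mdeg z = d -> supp_lt l.+1 z -> X z -> Y (z + U_(l))%MM) ->
  (\sum_(k < v) cnt (restr k.+1 X) d <= cnt (restr v Y) d.+1)%N.
Proof.
elim: v => [|v IH] vn h; first by rewrite big_ord0.
rewrite big_ord_recr /= (@cnt_restrS v Y d (Ordinal vn)) //; apply: leq_add.
  apply: IH; first exact: ltnW.
  by move=> l z lv; apply: h; apply: ltnW.
by apply: cnt_sub => z zd /andP[Xz zs]; rewrite zs /=; apply: h Xz.
Qed.

Lemma cnt_le_add1 P Q d w : (forall m, mdeg m = d -> Q m -> m != w -> P m) ->
  (cnt Q d <= (cnt P d).+1)%N.
Proof.
move=> h; rewrite (cnt_predI Q (pred1 w)) -add1n; apply: leq_add.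
  apply: leq_trans (_ : (count_mem w (mons n d) <= 1)%N).
    by apply: sub_count => m /andP[].
  by rewrite (count_uniq_mem _ (mons_uniq n d)) leq_b1.
by apply: cnt_sub => m md /andP[]; exact: h.
Qed.

Lemma extremal_mon (R : rel 'X_{1..n}) P d : transitive R -> total R -> cnt P d != 0%N ->
  exists x, [/\ mdeg x = d, P x & forall y, mdeg y = d -> P y -> R y x].
Proof.
move=> tr to c0; have [|x] := @tau_max _ R [seq x <- mons n d | P x] tr to.
  by apply: contraNneq c0 => e; rewrite /cnt -size_filter e.
rewrite mem_filter_mons => /andP[Px /eqP xd] h; exists x; split=> // y yd Py.
by apply: h; rewrite mem_filter_mons Py yd eqxx.
Qed.

Definition lex_up w : pred 'X_{1..n} := fun m => (w <= m)%O.

Section Step.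
Variables (v : nat) (f0 f1 : 'I_n) (d : nat) (B : pred 'X_{1..n}) (m0 : 'X_{1..n}).
Hypothesis f0v : nat_of_ord f0 = v.+1.
Hypothesis f1v : nat_of_ord f1 = v.
Hypothesis IH : forall d B w, strongly_stable B -> mdeg w = d ->
  (cnt (restr v.+1 (lex_up w)) d <= cnt (restr v.+1 B) d)%N ->
  forall k, (k <= v.+1)%N -> (cnt (restr k (lex_up w)) d <= cnt (restr k B) d)%N.
Hypothesis ssB : strongly_stable B.
Hypothesis m0d : mdeg m0 = d.
Hypothesis m0s : supp_lt v.+1 m0.

(* The variables f0 and f1 are x_(v+2) and x_(v+1): layer j cuts B at the exponent
   d - j of x_(v+2), and above j is the layer of {m > m0}, where m0 does not
   involve x_(v+2), so x_(v+1) may stand for x_(v+2). *)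
Let layer j : pred 'X_{1..n} := fun x => supp_lt v.+1 x && B (x + U_(f0) *+ (d - j))%MM.
Let above j : pred 'X_{1..n} := fun x => (m0 < (x + U_(f1) *+ (d - j))%MM)%O.

Hypothesis top : (cnt (restr v.+1 B) d <= cnt (restr v.+1 (above d)) d)%N.

Let vn : (v.+1 <= n)%N.
Proof. by rewrite -f0v ltnW. Qed.

Lemma layer_stable j : strongly_stable (layer j).
Proof.
move=> m k l kl ml /andP[ms Bm]; apply/andP.
have lv : (l < v.+1)%N by rewrite ltnNge; apply: contraL ml => lv; rewrite -leqNgt (supp_ltP _ _ ms).
split.
  apply/supp_ltP => i vi; rewrite !(mnmDE, mnmBE, mnm1E) (supp_ltP _ _ ms _ vi).
  by rewrite (_ : k == i = false) //; apply/eqP => e; move: vi; rewrite -e leqNgt (ltn_trans kl lv).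
have -> : (m - U_(l) + U_(k) + U_(f0) *+ (d - j) = m + U_(f0) *+ (d - j) - U_(l) + U_(k))%MM.
  apply/mnmP => i; rewrite !(mnmDE, mnmBE, mulmnE, mnm1E).
  by case: (l =P i) => [<-|_]; lia.
by apply: ssB => //; rewrite mnmDE ltn_addr.
Qed.

(* Descending induction on j: if layer j were larger than above j, the lex segment
   just longer than above j would, by the inductive hypothesis, have a shadow no
   larger than that of layer j, but its shadow exceeds above j.+1. *)
Lemma layer_le e j : (j + e)%N = d ->
  (cnt (restr v.+1 (layer j)) j <= cnt (restr v.+1 (above j)) j)%N.
Proof.
elim: e j => [|e IHe] j je.
  rewrite addn0 in je; rewrite je; apply: leq_trans top; apply: cnt_sub => x _ /andP[/andP[xs Bx] _].
  by rewrite /restr xs andbT; rewrite subnn mulm0n addm0 in Bx.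
have {}IHe : (cnt (restr v.+1 (layer j.+1)) j.+1 <= cnt (restr v.+1 (above j.+1)) j.+1)%N.
  by apply: IHe; rewrite addSnnS.
have dj : (d - j = (d - j.+1).+1)%N by lia.
rewrite leqNgt; apply/negP => lt.
have c0 : cnt (fun x => supp_lt v.+1 x && ~~ above j x) j != 0%N.
  rewrite -lt0n (leq_trans (_ : 0 < cnt (restr v.+1 (layer j)) j - cnt (restr v.+1 (above j)) j)%N) //.
    by rewrite subn_gt0.
  rewrite leq_subLR; have := cnt_predI (supp_lt v.+1) (above j) j => e1.
  apply: (@leq_trans (cnt (supp_lt v.+1) j)); first by apply: cnt_sub => x _ /andP[].
  by rewrite e1 leq_add2r; apply: cnt_sub => x _ /andP[a b]; rewrite /restr b a.
(* [x] is the largest monomial in the first [v.+1] variables that is missing from [above j], so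
   [lex_up x] is there at most one element longer. *)
have [x [xd /andP[xs nx] xmax]] := extremal_mon (@le_trans _ _) (@le_total _ _) c0.
have le1 : (cnt (restr v.+1 (lex_up x)) j <= cnt (restr v.+1 (layer j)) j)%N.
  apply: leq_trans lt; apply: (@cnt_le_add1 _ _ _ x) => y yd /andP[xy ys] yx.
  rewrite /restr ys andbT; apply/negPn/negP => ny.
  have := xmax y yd; rewrite ys ny => /(_ isT) yle.
  by move: yx; rewrite eq_le yle; case/negP.
have le2 := IH (@layer_stable j) xd le1.
have xf : mdeg (x + U_(f1))%MM = j.+1 by rewrite mdegD mdeg1 xd addn1.
have up : (cnt (restr v.+1 (lex_up (x + U_(f1))%MM)) j.+1 <= \sum_(k < v.+1) cnt (restr k.+1 (lex_up x)) j)%N.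
  apply: shadow_upper => // l z lv zd zs; apply: lemc_divide => //; first by rewrite zd.
  by rewrite f1v.
have mid : (\sum_(k < v.+1) cnt (restr k.+1 (lex_up x)) j <= \sum_(k < v.+1) cnt (restr k.+1 (layer j)) j)%N.
  by apply: leq_sum => k _; apply: le2.
have low : (\sum_(k < v.+1) cnt (restr k.+1 (layer j)) j <= cnt (restr v.+1 (layer j.+1)) j.+1)%N.
  apply: shadow_lower => // l z lv zd zs /andP[zs' Bz]; apply/andP; split.
    apply/supp_ltP => i vi; rewrite mnmDE (supp_ltP _ _ zs' _ vi) mnm1E.
    by rewrite (_ : l == i = false) //; apply/eqP => e2; move: vi; rewrite -e2 leqNgt lv.
  have zf : supp_lt v.+1 z := zs'.
  have -> : (z + U_(l) + U_(f0) *+ (d - j.+1) = z + U_(f0) *+ (d - j) - U_(f0) + U_(l))%MM.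
    by apply/mnmP => i; rewrite dj !(mnmDE, mnmBE, mulmnE, mnm1E) mulnS; lia.
  apply: ssB => //; first by rewrite f0v.
  by rewrite mnmDE mulmnE mnm1E eqxx dj mul1n addnS.
have : (cnt (restr v.+1 (above j.+1)) j.+1 < cnt (restr v.+1 (lex_up (x + U_(f1))%MM)) j.+1)%N.
  have xfs : supp_lt v.+1 (x + U_(f1))%MM.
    apply/supp_ltP => i vi; rewrite mnmDE (supp_ltP _ _ xs _ vi) mnm1E.
    by rewrite (_ : f1 == i = false) //; apply/eqP => e2; move: vi; rewrite -e2 f1v ltnn.
  have e3 : (x + U_(f1) + U_(f1) *+ (d - j.+1) = x + U_(f1) *+ (d - j))%MM.
    by rewrite dj mulmS addmA.
  apply: (cnt_lt xf) => [y yd /andP[ya ys]||].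
  - rewrite /restr ys andbT /lex_up ltW // -(ltmc_add2l _ _ (U_(f1) *+ (d - j.+1))%MM) e3.
    by apply: le_lt_trans ya; rewrite leNgt.
  - by rewrite /restr xfs /lex_up lexx.
  - by apply: contra nx => /andP[+ _]; rewrite /above e3.
by rewrite ltnNge; apply/negP/negPn; exact: leq_trans up (leq_trans mid (leq_trans low IHe)).
Qed.

(** The first difference from [m0] lies among the first [v] exponents, untouched by the exchange of
    variables. Otherwise [m0], which ends at $x_{v+1}$, would be a proper divisor of a monomial of
    the same degree. *)
Lemma above_last j x : mdeg x = j -> (j <= d)%N -> supp_lt v.+1 x -> above j x ->
  (m0 < (x + U_(f0) *+ (d - j))%MM)%O.
Proof.
move=> xd jd xs; rewrite /above => /ltmcP H.
have deg (f : 'I_n) : mdeg m0 = mdeg (x + U_(f) *+ (d - j))%MM.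
  by rewrite mdegD mdegMn mdeg1 mul1n xd subnKC.
have [i eqi lti] := H (deg f1).
have [iv|vi] := ltnP i v.
  apply/ltmcP; first exact: deg.
  have nf (f t : 'I_n) : (t < v)%N -> (v <= f)%N -> (x + U_(f) *+ (d - j))%MM t = x t.
    move=> tv fv; rewrite mnmDE mulmnE mnm1E.
    by rewrite (_ : f == t = false) ?addn0 //; apply/eqP => e; move: tv; rewrite -e ltnNge fv.
  have vf0 : (v <= f0)%N by rewrite f0v.
  have vf1 : (v <= f1)%N by rewrite f1v.
  exists i => [t ti|]; last by rewrite nf //; move: lti; rewrite nf.
  have tv := ltn_trans ti iv; rewrite nf // eqi // nf //.
have := @mdeg_lt_pointwise _ m0 (x + U_(f1) *+ (d - j))%MM i; rewrite -(deg f1) ltnn => H2.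
suff : false by []; apply: H2 => // t.
have [ti|it|/val_inj ->] := ltngtP t i; [by rewrite eqi| |exact: ltnW].
by rewrite (supp_ltP _ _ m0s) //; apply: leq_ltn_trans vi it.
Qed.

(** Sum of the layer inequalities over the exponent of $x_{v+2}$, with [above_last] putting that
    variable back. *)
Lemma cnt_le_above : (cnt (restr v.+2 B) d <= cnt (restr v.+2 (fun y => m0 < y)%O) d)%N.
Proof.
have bound m : mdeg m = d -> (m f0 < d.+1)%N.
  by move=> <-; rewrite ltnS mdegE (bigD1 f0) //= leq_addr.
rewrite (@cnt_partition _ _ _ d.+1 (fun m => m f0)) => [|m md _]; last exact: bound.
rewrite [X in (_ <= X)%N](@cnt_partition _ _ _ d.+1 (fun m => m f0)) => [|m md _]; last exact: bound.
apply: leq_sum => k _; have kd : (k <= d)%N by rewrite -ltnS.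
have subd : supp_lt v.+1 =1 fun x => supp_lt v.+2 x && (x f0 == 0%N).
  move=> x; apply/idP/andP => [xs|[/supp_ltP xs /eqP x0]].
    by split; [apply: supp_lt_leq xs|rewrite (supp_ltP _ _ xs) // f0v].
  apply/supp_ltP => i; rewrite leq_eqVlt => /predU1P[e|]; last exact: xs.
  by have -> : i = f0 by apply: ord_inj; rewrite f0v.
apply: (@leq_trans (cnt (restr v.+1 (layer (d - k))) (d - k))).
  apply: (cnt_inj (f := fun m => (m - U_(f0) *+ k)%MM)) => [m md /andP[/andP[Bm ms] /eqP mk]|m m' _ _ /andP[_ /eqP mk] /andP[_ /eqP mk'] e].
    have le : (U_(f0) *+ k <= m)%MM.
      by apply/mnm_lepP => i; rewrite mulmnE mnm1E; case: eqP => [<-|]; rewrite ?mul1n ?mk.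
    have ms' : supp_lt v.+1 (m - U_(f0) *+ k)%MM.
      rewrite subd mnmBE mulmnE mnm1E eqxx mul1n mk subnn eqxx andbT.
      by apply/supp_ltP => i vi; rewrite mnmBE (supp_ltP _ _ ms).
    split.
      have deg := congr1 mdeg (submK le); rewrite mdegD mdegMn mdeg1 mul1n md in deg.
      by apply/eqP; rewrite -(eqn_add2r k) subnK // deg.
    by rewrite /restr /layer ms' subKn // submK // Bm.
  have hl x : x f0 = k -> (U_(f0) *+ k <= x)%MM.
    by move=> xk; apply/mnm_lepP => i; rewrite mulmnE mnm1E; case: eqP => [<-|]; rewrite ?mul1n ?xk.
  by rewrite -(submK (hl m mk)) e submK // hl.
apply: leq_trans (layer_le (subnK kd)) _.
apply: (cnt_inj (f := fun m => (m + U_(f0) *+ k)%MM)) => [m md /andP[am ms]|m m' _ _ _ _]; last exact: addIm.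
split; first by rewrite mdegD mdegMn mdeg1 mul1n md subnK.
have := above_last md (leq_subr _ _) ms am; rewrite subKn // /restr => -> /=.
move: ms; rewrite subd => /andP[ms /eqP m00]; rewrite mnmDE m00 mulmnE mnm1E eqxx mul1n add0n eqxx andbT.
apply/supp_ltP => i vi; rewrite mnmDE (supp_ltP _ _ ms _ vi) mulmnE mnm1E.
by rewrite (_ : f0 == i = false) //; apply/eqP => e; move: vi; rewrite -e f0v ltnn.
Qed.

End Step.

(** An inequality rather than equality of sizes is assumed so that the induction closes. If the
    claim failed one variable lower, take the smallest monomial [m0] of the segment there: [B] would
    have at most as many elements as $\{y>m_0\}$ in those variables, hence by [cnt_le_above] in one
    more, where the segment contains [m0] in addition. *)
Theorem lex_segment_min v d B w : (v <= n)%N -> strongly_stable B -> mdeg w = d ->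
  (cnt (restr v (lex_up w)) d <= cnt (restr v B) d)%N ->
  forall k, (k <= v)%N -> (cnt (restr k (lex_up w)) d <= cnt (restr k B) d)%N.
Proof.
elim: v d B w => [|v IH] d B w vn ssB wd h k.
  by rewrite leqn0 => /eqP ->.
rewrite leq_eqVlt => /predU1P[->//|]; rewrite ltnS.
suff h' : (cnt (restr v (lex_up w)) d <= cnt (restr v B) d)%N by apply: IH => //; exact: ltnW.
rewrite leqNgt; apply/negP => lt.
have c0 : cnt (restr v (lex_up w)) d != 0%N by rewrite -lt0n (leq_ltn_trans _ lt).
have trv : transitive (fun a b : 'X_{1..n} => (b <= a)%O) by move=> a b c ba ca; exact: le_trans ca ba.
have tov : total (fun a b : 'X_{1..n} => (b <= a)%O) by move=> a b; exact: le_total.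
have [m0 [m0d /andP[wm0 m0s] m0min]] := extremal_mon trv tov c0.
case: v vn IH h lt c0 m0s m0min => [|v] vn IH h lt c0 m0s m0min.
  have d0 : d = 0%N by rewrite -m0d (supp_lt0 m0s) mdeg0.
  have e X : cnt (restr 1 X) d = cnt (restr 0 X) d.
    apply: eq_cnt => m md; have -> : m = 0%MM by apply/eqP; rewrite -mdeg_eq0 md d0.
    rewrite /restr; congr (_ && _); apply/idP/idP => _; apply/supp_ltP => i _; exact: mnm0E.
  by move: h; rewrite !e leqNgt lt.
pose f0 := Ordinal vn; pose f1 := Ordinal (ltnW vn).
have top : (cnt (restr v.+1 B) d <= cnt (restr v.+1 (fun x => m0 < (x + U_(f1) *+ (d - d))%MM)%O) d)%N.
  rewrite -ltnS; apply: leq_trans lt _; apply: (@cnt_le_add1 _ _ _ m0) => y yd /andP[wy ys] ym.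
  rewrite /restr ys andbT subnn mulm0n addm0 lt_neqAle eq_sym ym.
  by apply: m0min => //; rewrite /restr wy.
have := @cnt_le_above v f0 f1 d B m0 (erefl _) (erefl _) (fun d B w => IH d B w (ltnW vn)) ssB m0d m0s top.
rewrite leqNgt; case/negP; apply: leq_trans h.
apply: (cnt_lt m0d) => [y yd /andP[my ys]||]; rewrite /restr.
- by rewrite ys andbT /lex_up (le_trans wm0) // ltW.
- by rewrite wm0 (supp_lt_leq _ m0s).
- by rewrite ltxx.
Qed.

End Bigatti.

Section LexMonomials.
Variables (n : nat) (E : pred 'X_{1..n}).
Hypothesis upE : up_closed E.
Hypothesis ssE : strongly_stable E.
Implicit Types (m x y : 'X_{1..n}) (d v : nat).

Definition lex_monomials : pred 'X_{1..n} :=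
  fun m => m \in lex_largest n (mdeg m) (cnt E (mdeg m)).
Local Notation L := lex_monomials.

Lemma lex_monomials_upper x y : mdeg x = mdeg y -> (x <= y)%O -> L x -> L y.
Proof.
rewrite /L /lex_largest => e xy; rewrite -e -/(mons n (mdeg x)); set s := sort _ _ => xs.
have ys : y \in s by rewrite mem_sort mem_mons e.
have xs' := mem_take xs.
move: xs; rewrite !in_take // => /(leq_ltn_trans _); apply.
have us : uniq s by rewrite sort_uniq mons_uniq.
have tr : transitive (fun m1 m2 : 'X_{1..n} => (m2 <= m1)%O) by move=> a b c ba ca; exact: le_trans ca ba.
have so : sorted (fun m1 m2 : 'X_{1..n} => (m2 <= m1)%O) s.
  by apply: sort_sorted => a b; exact: le_total.
rewrite leqNgt; apply/negP => lt.
have := sorted_ltn_index tr so _ _ xs' ys lt => yx.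
by move: lt; rewrite (_ : x = y) ?ltnn //; apply/eqP; rewrite eq_le xy yx.
Qed.

Lemma cnt_lex_monomials d : cnt L d = cnt E d.
Proof.
rewrite (@eq_cnt _ _ (fun m => m \in lex_largest n d (cnt E d))); last by move=> m <-.
rewrite /lex_largest -/(mons n d); set s := sort _ _.
have ss : perm_eq s (mons n d) by rewrite perm_sort.
rewrite /cnt -(seq.permP ss) -[X in count _ X](cat_take_drop (cnt E d) s) count_cat.
have us : uniq (take (cnt E d) s ++ drop (cnt E d) s) by rewrite cat_take_drop (perm_uniq ss) mons_uniq.
have /and3P[_ h _] : [&& uniq (take (cnt E d) s), ~~ has (mem (take (cnt E d) s)) (drop (cnt E d) s) & uniq (drop (cnt E d) s)].
  by rewrite -cat_uniq.
rewrite (eqP (_ : count _ (drop _ _) == 0%N)); last by rewrite -leqn0 leqNgt -has_count.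
rewrite addn0 (eq_in_count (a2 := predT)) // count_predT size_take_min; apply/minn_idPl.
by rewrite (perm_size ss) count_size.
Qed.

Lemma lex_monomials_stable : strongly_stable L.
Proof.
move=> m k l kl ml; apply: lex_monomials_upper; first by rewrite mdeg_move.
by apply: ltW; exact: ltmc_move.
Qed.

Lemma cnt_restr_lex v d : (v <= n)%N -> (cnt (restr v L) d <= cnt (restr v E) d)%N.
Proof.
move=> vn; have [c0|c0] := eqVneq (cnt L d) 0%N.
  by rewrite (leq_trans _ (leq0n _)) // -c0; apply: cnt_sub => m _ /andP[].
have tr : transitive (fun a b : 'X_{1..n} => (b <= a)%O) by move=> a b c ba ca; exact: le_trans ca ba.
have to : total (fun a b : 'X_{1..n} => (b <= a)%O) by move=> a b; exact: le_total.
have [w [wd Lw wmin]] := extremal_mon tr to c0.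
have e k : cnt (restr k L) d = cnt (restr k (lex_up w)) d.
  apply: eq_cnt => m md; congr (_ && _); apply/idP/idP; first exact: wmin.
  by move=> wm; apply: lex_monomials_upper Lw; rewrite ?wd ?md.
rewrite e; apply: (@lex_segment_min n n d E w) => //; rewrite -e.
have r (P : pred 'X_{1..n}) : cnt (restr n P) d = cnt P d.
  by apply: eq_cnt => m _; rewrite /restr supp_lt_n andbT.
by rewrite !r cnt_lex_monomials.
Qed.

(** Macaulay's theorem, obtained from Bigatti's inequalities: the shadow of the lex segment is at
    most $\sum_k M_k$ for [lex_monomials E], hence at most $\sum_k M_k$ for [E], and [E] contains
    that many monomials in the next degree. *)
Lemma lex_monomials_up_closed : up_closed L.
Proof.
suff step m (l : 'I_n) : L m -> L (m + U_(l))%MM.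
  move=> m m'; move: {-1}(mdeg m') (erefl (mdeg m')) => d; elim: d m m' => [|d IH] m m' m'd Lm.
    by move/eqP: m'd; rewrite mdeg_eq0 => /eqP ->; rewrite addm0.
  have [l ml] : exists l, (0 < m' l)%N.
    apply: contrapT => no; move: m'd; rewrite mdegE big1 // => l _.
    by apply/eqP; rewrite -leqn0 leqNgt; apply/negP => h; apply: no; exists l.
  have le : (U_(l) <= m')%MM by rewrite lep1mP -lt0n.
  rewrite -(submK le) [(_ - _ + _)%MM]addmC addmA; apply: IH; last exact: step.
  by move: (congr1 mdeg (submK le)); rewrite mdegD mdeg1 m'd addn1 => -[].
move=> Lm; pose d := mdeg m.
have n0 : (0 < n)%N by apply: leq_ltn_trans (ltn_ord l).
have [q qn] : exists q : 'I_n, q.+1 = n.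
  by have lt : (n.-1 < n)%N by [rewrite ltn_predL]; exists (Ordinal lt); rewrite /= prednK.
(* Multiplying by the last variable gives the lex-smallest product, so this case implies the
   others. *)
suff Lq : L (m + U_(q))%MM.
  apply: lex_monomials_upper Lq; first by rewrite !mdegD !mdeg1.
  have [lq|ql|/ord_inj -> //] := ltngtP l q; last by move: ql; rewrite -ltnS qn ltnNge ltn_ord.
  have := @ltmc_move n (m + U_(q))%MM l q lq; rewrite addmK mnmDE mnm1E eqxx addn1 => /(_ isT).
  exact: ltW.
apply/negPn/negP => nL; pose Y : pred 'X_{1..n} := lex_up (m + U_(q))%MM.
have mqd : mdeg (m + U_(q))%MM = d.+1 by rewrite mdegD mdeg1 addn1.
have r (P : pred 'X_{1..n}) k : cnt (restr n P) k = cnt P k.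
  by apply: eq_cnt => z _; rewrite /restr supp_lt_n andbT.
have lt : (cnt L d.+1 < cnt Y d.+1)%N.
  apply: (cnt_lt mqd) => [z zd Lz||]; [|exact: lexx|exact: nL].
  rewrite /Y /lex_up leNgt; apply: contra nL => zm.
  by apply: lex_monomials_upper Lz; rewrite ?zd ?mqd // ltW.
suff le : (cnt Y d.+1 <= cnt E d.+1)%N by move: lt; rewrite cnt_lex_monomials ltnNge le.
rewrite -r; apply: leq_trans (shadow_upper (X := L) (leqnn n) _) _ => [t z _ zd zs Yz|].
  apply: lex_monomials_upper Lm; first by rewrite zd.
  by apply: lemc_divide Yz; rewrite ?zd // -ltnS qn ltn_ord.
apply: (@leq_trans (\sum_(k < n) cnt (restr k.+1 E) d)).
  by apply: leq_sum => k _; apply: cnt_restr_lex.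
by rewrite -(r E d.+1); apply: shadow_lower => // t z _ _ _ Ez; exact: upE.
Qed.

End LexMonomials.

(** * Comparison of the critical cells *)

Section CriticalCount.
Variables (n p : nat).
Hypothesis pn : (p <= n)%N.
Implicit Types (E : pred 'X_{1..n}) (S : {set 'I_p}) (s t : 'I_p) (m : 'X_{1..n}).
Local Notation lv := (last_var pn).

Lemma card_bmnm D d (P : pred 'X_{1..n}) : (d < D)%N ->
  #|[pred m : 'X_{1..n < D} | (mdeg m == d) && P m]| = cnt P d.
Proof.
move=> dD; rewrite /cnt -size_filter cardE -(size_map (@bmnm n D)).
apply: perm_size; apply: uniq_perm.
- by rewrite map_inj_uniq ?enum_uniq //; exact: val_inj.
- by rewrite filter_uniq ?mons_uniq.
move=> m; rewrite mem_filter_mons; apply/mapP/andP => [[m' + ->]|[Pm /eqP md]].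
  by rewrite mem_enum inE => /andP[-> ->].
have lt : (mdeg m < D)%N by rewrite md.
by exists (BMultinom lt); rewrite // mem_enum inE /= md eqxx.
Qed.

Lemma first_occ_min S m s : s \in S ->
  first_occ pn S m s = [forall t, (t \in S) ==> (s <= t)%N] && supp_lt (lv s).+1 m.
Proof.
move=> sS; apply/first_occP/andP => [[os h]|[/forallP h /supp_ltP ms]].
  split; first by apply/forallP => t; apply/implyP => tS; apply: h; rewrite /occurs tS.
  apply/supp_ltP => l sl; apply/eqP; rewrite -leqn0 leqNgt; apply/negP => ml.
  have sp := ltn_ord s; have ln := ltn_ord l.
  have sl' : (n - s.+1 < l)%N by [].
  have tp : (n - l.+1 < p)%N by lia.
  have e : lv (Ordinal tp) = l by apply: ord_inj => /=; lia.
  by have := h (Ordinal tp); rewrite /occurs e ml orbT => /(_ isT) /=; lia.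
split=> [|t]; first by rewrite /occurs sS.
move=> /orP[tS|mt]; first by have /implyP := h t; apply.
by rewrite leqNgt; apply: contraL mt => ts; rewrite -leqNgt ms // ltn_last_var.
Qed.

Definition first_sets i s : pred {set 'I_p} :=
  [pred S : {set 'I_p} | [&& #|S| == i, s \in S & [forall t, (t \in S) ==> (s <= t)%N]]].

Definition boundary_count E d s :=
  cnt (fun m => supp_lt (lv s).+1 m && (~~ E m && E (m + U_(lv s))%MM)) d.

(** For [i > 0] the set [S] is nonempty, so some index occurs. The critical cells then split by
    their first index [s], and for fixed [s] the conditions on [S] and on [m] are independent. *)
Lemma card_critical E i d (j := (d + i)%:Z) : (0 < i)%N ->
  #|critical_cells pn E i (j := j)| = (\sum_s #|first_sets i s| * boundary_count E d s)%N.
Proof.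
move=> i0; rewrite -sum1_card big_mkcond /=.
pose X s S : nat := S \in first_sets i s.
pose Y s m : nat := (mdeg m == d) && (supp_lt (lv s).+1 m && (~~ E m && E (m + U_(lv s))%MM)).
have XY (t : {set 'I_p} * 'X_{1..n < `|j|.+1}) :
    (if t \in critical_cells pn E i (j := j) then 1 else 0)%N = (\sum_s X s t.1 * Y s t.2)%N.
  case: t => S m /=; rewrite unfold_in /= unfold_in /cells /=.
  have jd : ((mdeg m + i)%:Z == j) = (mdeg m == d) by rewrite /j eqz_nat eqn_add2r.
  case: ifP => [/andP[/andP[/eqP cS md] /andP[Em]]|nc].
    case/orP => [/existsP[]|/existsP[s /and3P[sS fs Es]]].
      have /card_gt0P[s sS] : (0 < #|S|)%N by rewrite cS.
      by exists s; rewrite /occurs sS.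
    move: (fs); rewrite first_occ_min // => /andP[ms ss].
    rewrite (bigD1 s) //= big1 ?addn0 => [|t ts].
      by rewrite /X /Y inE cS eqxx sS ms -jd md ss Em Es.
    rewrite /X inE; case: and3P => // -[_ tS mt]; case/eqP: ts; apply: ord_inj.
    apply/eqP; rewrite eqn_leq.
    by have /forallP/(_ s)/implyP -> := mt; rewrite //; have /forallP/(_ t)/implyP -> := ms.
  rewrite big1 // => s _; rewrite /X /Y inE; case: and3P => // -[cS sS ms].
  case: andP => // -[md /and3P[ss Em Es]]; case/negP: nc; rewrite cS jd md /=; apply/andP; split=> //.
  by apply/orP; right; apply/existsP; exists s; rewrite sS first_occ_min // ms ss.
transitivity (\sum_(t : {set 'I_p} * 'X_{1..n < `|j|.+1}) \sum_s X s t.1 * Y s t.2)%N.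
  by apply: eq_bigr => t _; exact: XY.
rewrite exchange_big /=; apply: eq_bigr => s _.
rewrite -(pair_bigA _ (fun S (m : 'X_{1..n < `|j|.+1}) => X s S * Y s m)%N) /=.
rewrite -big_distrlr /=; congr (_ * _)%N.
  by rewrite -sum1_card [RHS]big_mkcond.
have dj : (d < `|j|.+1)%N by rewrite /j absz_nat ltnS leq_addr.
rewrite /boundary_count -(card_bmnm _ dj) -sum1_card [RHS]big_mkcond; apply: eq_bigr => m _.
by rewrite inE /Y; case: (_ && _).
Qed.

Lemma card_critical0 E d (j := d%:Z) :
  #|critical_cells pn E 0 (j := j)| = cnt (fun m => supp_lt (n - p) m && ~~ E m) d.
Proof.
have dj : (d < `|j|.+1)%N by rewrite /j absz_nat.
rewrite -(card_bmnm _ dj); rewrite !cardE -(size_map snd) -[in RHS](size_map id) map_id.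
apply: perm_size; apply: uniq_perm; rewrite ?enum_uniq //.
  rewrite map_inj_in_uniq ?enum_uniq // => -[S m] [S' m']; rewrite !mem_enum.
  move=> /andP[/andP[+ _] _] /andP[/andP[+ _] _]; rewrite !cards_eq0 /=.
  by move=> /eqP -> /eqP -> ->.
have crit (m : 'X_{1..n}) : critical pn E finset.set0 m = supp_lt (n - p) m && ~~ E m.
  rewrite /critical andbC; congr (_ && _); rewrite [X in _ || X](_ : _ = false) ?orbF; last first.
    by apply/existsP => -[s]; rewrite finset.in_set0.
  apply/existsPn/supp_ltP => [no i pi|h s].
    apply/eqP; rewrite -leqn0 leqNgt; have ln := ltn_ord i; have tp : (n - i.+1 < p)%N by lia.
    have := no (Ordinal tp); rewrite /occurs finset.in_set0 (_ : lv _ = i) //.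
    by apply: ord_inj => /=; lia.
  rewrite /occurs finset.in_set0 h //=; have := ltn_ord s; lia.
move=> m; rewrite mem_enum inE; apply/mapP/andP => [[[S m'] + ->]|[md mE]].
  rewrite mem_enum => /andP[/andP[+ +] +]; rewrite cards_eq0 addn0 -crit /= eqz_nat.
  by move=> /eqP -> ->.
exists (finset.set0, m) => //; rewrite mem_enum; apply/andP; split; last by rewrite /= crit.
by apply/andP; rewrite /= cards0 addn0 eqz_nat.
Qed.

(** Replacing the minimum [t] by the smaller [s] is injective. *)
Lemma card_first_sets_le i s t : (s <= t)%N -> (#|first_sets i t| <= #|first_sets i s|)%N.
Proof.
move=> st; pose f S := (s |: (S :\ t))%SET.
have sS S : S \in first_sets i t -> s \notin (S :\ t)%SET.
  rewrite inE => /and3P[_ _ /forallP h]; rewrite !inE; apply/andP => -[ne sS].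
  by case/eqP: ne; apply: ord_inj; apply/eqP; rewrite eqn_leq st (implyP (h s)).
rewrite -(card_in_image (f := f)).
  apply: subset_leq_card; apply/fintype.subsetP => _ /fintype.imageP[S hS ->]; have nS := sS S hS.
  move: hS; rewrite !inE => /and3P[/eqP cS tS /forallP h]; apply/and3P; split.
  - by rewrite cardsU1 nS; move: cS; rewrite (finset.cardsD1 t S) tS => <-.
  - by rewrite eqxx.
  - apply/forallP => u; apply/implyP; rewrite !inE => /predU1P[->//|/andP[_ uS]].
    apply: (leq_trans st); exact: (implyP (h u)).
move=> S S' hS hS' e; have nS := sS S hS; have nS' := sS S' hS'.
move: hS hS'; rewrite !inE => /and3P[_ tS _] /and3P[_ tS' _].
by rewrite -(finset.setD1K tS) -(finset.setD1K tS') -(finset.setU1K nS) -/(f S) e (finset.setU1K nS').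
Qed.

(** Split the degree [d.+1] monomials of [E] in the first [n - s] variables: those without the last
    of these variables, and those divisible by it, whose quotient either is in [E] or is counted by
    [boundary_count]. *)
Lemma boundary_countE E d s : up_closed E ->
  (boundary_count E d s + cnt (restr (n - s) E) d + cnt (restr (n - s.+1) E) d.+1 =
   cnt (restr (n - s) E) d.+1)%N.
Proof.
move=> upE; have e : (n - s = (lv s).+1)%N by have := ltn_ord s; rewrite /=; lia.
rewrite e (@cnt_restrS _ _ E d (lv s) (erefl _)) [RHS]addnC; congr (_ + _)%N.
rewrite [RHS](cnt_predI _ E) addnC; congr (_ + _)%N; apply: eq_cnt => m _; rewrite /restr.
  by case Em: (E m); rewrite ?andbF // andbT upE // andbT.
by rewrite -andbA [X in _ && X]andbC.
Qed.

End CriticalCount.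

(* Summation by parts: c decreases, so only the partial sums of a and b matter. *)
Lemma leq_sum_decreasing p (a b c : nat -> nat) :
  (forall s t, (s <= t < p)%N -> (c t <= c s)%N) ->
  (forall r, (r <= p)%N -> (\sum_(s < r) a s <= \sum_(s < r) b s)%N) ->
  (\sum_(s < p) c s * a s <= \sum_(s < p) c s * b s)%N.
Proof.
move=> dc ab.
(* Abel summation without subtraction: [e] is a lower bound for the weights used so far. The
   induction step invokes the hypothesis at [c r], and the goal is the case [e = 0]. *)
suff H r e : (r <= p)%N -> (forall s, (s < r)%N -> (e <= c s)%N) ->
    (\sum_(s < r) c s * a s + e * \sum_(s < r) b s <= \sum_(s < r) c s * b s + e * \sum_(s < r) a s)%N.
  by have := H p 0%N (leqnn _) (fun _ _ => leq0n _); rewrite !mul0n !addn0.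
elim: r e => [|r IH] e rp ec; first by rewrite !big_ord0.
have {}IH : (\sum_(s < r) c s * a s + c r * \sum_(s < r) b s <= \sum_(s < r) c s * b s + c r * \sum_(s < r) a s)%N.
  by apply: IH => [|s sr]; [exact: ltnW|apply: dc; rewrite rp (ltnW sr)].
have := ab _ rp; have := ec r (ltnSn r); rewrite !big_ord_recr /=.
move: IH (ab _ (ltnW rp)); set A := (\sum_(s < r) a s)%N; set B := (\sum_(s < r) b s)%N.
set X := (\sum_(s < r) c s * a s)%N; set Y := (\sum_(s < r) c s * b s)%N.
move=> h1 _ /subnK <- /subnK => h2; move: h1; rewrite -[in X in X -> _](subnK (ec r (ltnSn r))); nia.
Qed.

Section LexCritical.
Variables (n p : nat) (E : pred 'X_{1..n}).
Hypothesis pn : (p <= n)%N.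
Hypothesis upE : up_closed E.
Hypothesis ssE : strongly_stable E.
Local Notation L := (lex_monomials E).

Let bc (P : pred 'X_{1..n}) d (s : nat) : nat :=
  if insub s is Some s' then boundary_count pn P d s' else 0%N.

(** The terms of degree [d.+1] in [boundary_countE] telescope, so a partial sum of boundary counts
    is $M_n(d+1)$ minus other numbers $M_v$. *)
Lemma sum_boundary_count P d r : up_closed P -> (r <= p)%N ->
  (\sum_(s < r) bc P d s + \sum_(s < r) cnt (restr (n - s) P) d + cnt (restr (n - r) P) d.+1 =
   cnt (restr n P) d.+1)%N.
Proof.
move=> upP; elim: r => [|r IH] rp; first by rewrite !big_ord0 subn0.
rewrite -IH ?(ltnW rp) // !big_ord_recr /=.
have := @boundary_countE n p pn P d (Ordinal rp) upP.
have -> : boundary_count pn P d (Ordinal rp) = bc P d r.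
  by rewrite /bc (insubT (fun x => x < p)%N rp).
by move=> /= e; lia.
Qed.

(** The value $M_n$ is common to both ideals and the other $M_v$ are smallest for the lex segment,
    so its partial sums of boundary counts are larger. The weights decrease by
    [card_first_sets_le]. *)
Lemma card_critical_lex i j :
  (#|critical_cells pn E i (j := j)| <= #|critical_cells pn L i (j := j)|)%N.
Proof.
have upL := lex_monomials_up_closed upE ssE.
have [[d ->]|no] := pselect (exists d : nat, j = (d + i)%:Z); last first.
  rewrite eq_card0 // => t; rewrite inE; apply/negP => /andP[/andP[_ /eqP e] _].
  by apply: no; exists (mdeg t.2).
have le v k : (v <= n)%N -> (cnt (restr v L) k <= cnt (restr v E) k)%N by exact: cnt_restr_lex.
have [->|i0] := posnP i.
  rewrite addn0 !card_critical0; have vn : (n - p <= n)%N by exact: leq_subr.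
  have e (P : pred 'X_{1..n}) : cnt (fun m => supp_lt (n - p) m && P m) d = cnt (restr (n - p) P) d.
    by apply: eq_cnt => m _; rewrite /restr andbC.
  have := cnt_predI (supp_lt (n - p)) L d; rewrite (cnt_predI _ E) !e.
  by have := le _ d vn; lia.
rewrite !card_critical //.
pose c (s : nat) : nat := if insub s is Some s' then #|first_sets i (s' : 'I_p)| else 0%N.
have sumE (P : pred 'X_{1..n}) :
    (\sum_s #|first_sets i s| * boundary_count pn P d s = \sum_(s < p) c s * bc P d s)%N.
  by apply: eq_bigr => s _; rewrite /c /bc valK.
rewrite !sumE; apply: leq_sum_decreasing => [s t /andP[st tp]|r rp].
  rewrite /c (insubT (fun x => x < p)%N tp) (insubT (fun x => x < p)%N (leq_ltn_trans st tp)).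
  exact: card_first_sets_le.
have := sum_boundary_count d upE rp; have := sum_boundary_count d upL rp.
have nE : cnt (restr n L) d.+1 = cnt (restr n E) d.+1.
  have r' (P : pred 'X_{1..n}) : cnt (restr n P) d.+1 = cnt P d.+1.
    by apply: eq_cnt => z _; rewrite /restr supp_lt_n andbT.
  by rewrite !r' cnt_lex_monomials.
have := le _ d.+1 (leq_subr r n).
have : (\sum_(s < r) cnt (restr (n - s) L) d <= \sum_(s < r) cnt (restr (n - s) E) d)%N.
  by apply: leq_sum => s _; apply: le; exact: leq_subr.
lia.
Qed.

End LexCritical.

(** * The lex ideal and the Hilbert function *)

Section LexIdeal.
Variables (K : fieldType) (n : nat) (tau : rel 'X_{1..n}) (I : set {mpoly K[n]}).
Hypothesis tau_order : term_order tau.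
Hypothesis homI : homogeneous_ideal I.

Lemma subspace_dim_degree d :
  subspace_dim (degree_part I d) = degree_count (initial_monomials tau I) d.
Proof.
set X := [pred m : 'X_{1..n < d.+1} | (mdeg m == d) && initial_monomials tau I m].
have hd : has_quot_dim (degree_part I d) [set 0] (degree_count (initial_monomials tau I) d).
  have [gb span] := initial_basis tau_order homI.
  have kX (k : 'I_#|X|) : (mdeg (enum_val k) == d) && initial_monomials tau I (enum_val k).
    by have := enum_valP k; rewrite inE.
  exists (fun k : 'I_#|X| => lead_basis tau I (enum_val k)); split.
  - by move=> k; have /andP[/eqP kd /gb[h1 h2]] := kX k; split; rewrite // -[X in X.-homog]kd.
  - move=> c c0 k; pose c' (t : 'X_{1..n < d.+1}) := c (enum_rank_in (enum_valP k) t).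
    have := @lead_basis_free K n tau I d c' tau_order homI _ _ (enum_valP k).
    rewrite /c' enum_valK_in; apply; rewrite -[RHS]c0 big_enum_val /=.
    by apply: eq_bigr => l _; rewrite enum_valK_in.
  - move=> z [Iz zd]; have [c ->] := span d d.+1 z (ltnSn d) Iz zd.
    exists (fun k : 'I_#|X| => c (enum_val k)); apply/eqP; rewrite subr_eq0; apply/eqP.
    by apply: etrans (big_enum_val (fun t : 'X_{1..n < d.+1} => c t *: lead_basis tau I t)); apply: eq_bigl => t; rewrite inE.
apply: (has_quot_dim_uniq _ (xgetPex 0%N (ex_intro _ _ hd)) hd).
by move=> m c e e0; rewrite big1 //= => k _; rewrite (e0 k) scaler0.
Qed.

(** $\mathrm{Lex}(I)$ sees only the Hilbert function of $I$, so it can be formed from any monomial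
    set [E] with the same counts, in particular from $\mathrm{Gin}(I)$. *)
Lemma LexE (E : pred 'X_{1..n}) : (forall d, degree_count (initial_monomials tau I) d = cnt E d) ->
  Lex I = mono_ideal (lex_monomials E).
Proof.
move=> h; apply/seteqP; split=> f Lf.
  move=> m mf; have := Lf (mdeg m) m.
  by rewrite subspace_dim_degree h; apply; rewrite mcoeff_msupp mcoeff_pihomog eqxx -mcoeff_msupp.
move=> d m; rewrite mcoeff_msupp mcoeff_pihomog; case: (mdeg m =P d) => [<-|_]; last by rewrite eqxx.
by rewrite -mcoeff_msupp subspace_dim_degree h; exact: Lf.
Qed.

End LexIdeal.

Theorem theorem4p2 (K : fieldType) (n : nat) (I : set {mpoly K[n]})
    (tau : rel 'X_{1..n}) :
  [pchar K] =i pred0 ->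
  homogeneous_ideal I ->
  term_order tau ->
  decreasing_vars tau ->
  (forall (i : nat) (j : int) (p : nat), (p <= n)%N ->
     (koszul_betti I i j p <= koszul_betti (Gin tau I) i j p)%N) /\
  (forall (i : nat) (j : int) (p : nat), (p <= n)%N ->
     (koszul_betti I i j p <= koszul_betti (Lex I) i j p)%N).
Proof.
move=> K0 homI tau_order tau_dec.
have [E [-> [g ug gE] maxE]] := gin_exists K0 tau_order homI.
have upE : up_closed E by rewrite -gE; apply: initial_up_closed tau_order (gl_act_ideal ug homI).
have ssE : strongly_stable E by move=> m k l; apply: (gin_strongly_stable K0 tau_order tau_dec homI ug gE maxE).
have le p (A : 'M[K]_(p, n)) i j : (koszul_betti I i j p <= koszul_homology_dim A (mono_ideal E) i j)%N.
  by rewrite -gE; exact: betti_le_gl_initial.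
split=> i j p pn.
  (* The bound [le] holds for every [A], in particular for one computing the Betti number of
     $\mathrm{Gin}(I)$. *)
  have [A [_ _ ->]] := betti_min p K0 (mono_ideal_ideal K upE) (mono_basis K E) i j.
  exact: le.
have upL := lex_monomials_up_closed upE ssE; have ssL := @lex_monomials_stable n E.
rewrite (LexE tau_order homI (E := E)) => [|d]; last first.
  by rewrite -(degree_count_gl d tau_order homI ug) gE degree_countE.
rewrite (betti_last K0 pn upL ssL) (koszul_last_dim pn upL ssL K0).
apply: leq_trans (le _ (last_forms K pn) i j) _.
by rewrite (koszul_last_dim pn upE ssE K0); exact: card_critical_lex.
Qed.
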